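(* Let $\Omega$ be a finite or countable union of disjoint, possibly unbounded open intervals, $\Omega=\bigcup_{i\in I}(\alpha_i,\beta_i)$. Assume that the lengths of the intervals are bounded below by a positive number: $l:=\inf_{i\in I}(\beta_i-\alpha_i)>0$. Let $\{U(t)\}_{t\in\mathbb{R}}$ be a strongly continuous unitary group with the integrability property on $L^2(\Omega)$. Then there exists a unitary matrix $B=(b_{i,k})_{i,k\in I,\ \alpha_i>-\infty,\ \beta_k<\infty}$ such that for any $\epsilon$ with $0<\epsilon<l$ and any $i\in I$ with $\alpha_i>-\infty$, if $f\in L^2(\Omega)$ is supported on $[\alpha_i,\alpha_i+\epsilon]$, then $U(\epsilon)f$ is supported on $\bigcup_{k\in I,\beta_k<\infty}[\beta_k-\epsilon,\beta_k]$ and $$U(\epsilon)f=\sum_{k\in I,\ \beta_k<\infty}b_{i,k}\,T(\alpha_i+\epsilon-\beta_k)f.\qquad(1)$$ Similarly, if $\beta_k<\infty$ and $f\in L^2(\Omega)$ is supported on $[\beta_k-\epsilon,\beta_k]$, then $U(-\epsilon)f$ is supported on $\bigcup_{j\in I,\alpha_j>-\infty}[\alpha_j,\alpha_j+\epsilon]$ and $$U(-\epsilon)f=\sum_{j\in I,\ \alpha_j>-\infty}\overline{b_{j,k}}\,T(\beta_k-\alpha_j-\epsilon)f.\qquad(2)$$ Conversely, if $B=(b_{i,k})_{i,k\in I,\ \alpha_i>-\infty,\ \beta_k<\infty}$ is a unitary matrix, then there exists a unitary group $\{U(t)\}_{t\in\mathbb{R}}$ with the integrability property on $L^2(\Omega)$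 such that the relations (1) and (2) are satisfied (for all $\epsilon$, $i$, $k$, $f$ as in the first part).
   Context: The rows of $B$ are indexed by $\{i\in I:\alpha_i>-\infty\}$ and its columns by $\{k\in I:\beta_k<\infty\}$; unitary means that it defines a unitary operator between the corresponding $l^2$ spaces. $T(t)f(x)=f(x+t)$, where a function $f$ on $\Omega$ is extended by $0$ to $\mathbb{R}$; sums are in $L^2(\Omega)$. ''Supported on'' is understood up to measure zero. Integrability property: a strongly continuous unitary representation $\{U(t)\}_{t\in\mathbb{R}}$ on $L^2(\Omega)$ has the integrability property if for every $x\in\Omega$, all neighborhoods $V$ of $x$ in $\Omega$ and all $\epsilon>0$ such that $V+t\subset\Omega$ for all $t\in\mathbb{R}$ with $|t|<\epsilon$, one has $(U(t)f)(y)=f(y+t)$ for (almost) all $y\in V$, all $|t|<\epsilon$ and all $f\in L^2(\Omega)$. *)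

(* Defs.v *)
From HB Require Import structures.
From mathcomp Require Import all_boot all_order all_algebra finmap.
From mathcomp Require Import complex.
From mathcomp Require Import all_classical all_reals all_analysis.
From mathcomp.analysis Require showcase.summability.
Import Order.TTheory GRing.Theory Num.Theory.
Import numFieldNormedType.Exports.

Set Implicit Arguments.
Unset Strict Implicit.
Unset Printing Implicit Defensive.

Local Open Scope classical_set_scope.
Local Open Scope ring_scope.

(* Convergence of partial_sum along totally is unconditional summability: the
   finite index subsets are directed by inclusion. *)
Notation partial_sum := summability.partial_sum.
Notation totally := summability.totally.

(* A Hilbert space presented by representatives: [fmem] is the set of functions
   that represent a vector, [feq] holds when two of them represent the same
   vector, [fip] is the inner product, antilinear in its second argument. *)
Record funspace (R : realType) (X : Type) := FunSpace {
  fmem : set (X -> R[i]) ;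
  feq : (X -> R[i]) -> (X -> R[i]) -> Prop ;
  fip : (X -> R[i]) -> (X -> R[i]) -> R[i] }.

Record unitary_operator (R : realType) (X Y : Type)
    (E : funspace R X) (F : funspace R Y)
    (V : (X -> R[i]) -> (Y -> R[i])) : Prop := UnitaryOperator {
  unitary_fmem : forall f, fmem E f -> fmem F (V f) ;
  unitary_feq : forall f g, fmem E f -> fmem E g -> feq E f g ->
    feq F (V f) (V g) ;
  unitary_linear : forall (a : R[i]) f g, fmem E f -> fmem E g ->
    feq F (V (fun x => a * f x + g x)) (fun y => a * V f y + V g y) ;
  unitary_fip : forall f g, fmem E f -> fmem E g ->
    fip F (V f) (V g) = fip E f g ;
  unitary_onto : forall h, fmem F h -> exists2 f, fmem E f & feq F (V f) h }.

Definition l2 (R : realType) (K : choiceType) : funspace R K := {|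
  fmem := [set v | (\esum_(k in [set: K]) (Normc.normc (v k) ^+ 2)%:E < +oo)%E];
  feq := eq ;
  fip := fun v w => summability.sum (fun k => v k * (w k)^*%C : R[i]^o) |}.

Definition unitary_matrix (R : realType) (J K : choiceType)
    (B : J -> K -> R[i]) : Prop :=
  exists V : (K -> R[i]) -> (J -> R[i]),
    unitary_operator (l2 R K) (l2 R J) V /\
    forall v, fmem (l2 R K) v -> forall j,
      partial_sum (fun k => B j k * v k : R[i]^o) @ totally --> (V v j : R[i]^o).

Section L2.
Variable R : realType.
Notation mu := (@lebesgue_measure R).

Definition L2norm (f : R -> R[i]) : \bar R :=
  'N[mu]_2%:E[EFin \o (fun x => Normc.normc (f x))]%E.

(* The elements of L^2(O) are extended by 0 to the whole line. *)
Definition L2 (O : set R) : funspace R R := {|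
  fmem := [set f | [/\ measurable_fun [set: R] (fun x => complex.Re (f x)),
                       measurable_fun [set: R] (fun x => complex.Im (f x)),
                       (L2norm f < +oo)%E &
                       forall x, ~ O x -> f x = 0] ] ;
  feq := fun f g => f = g %[ae mu] ;
  fip := fun f g =>
    Complex (\int[mu]_x complex.Re (f x * (g x)^*%C))
            (\int[mu]_x complex.Im (f x * (g x)^*%C)) |}.

Definition supported_on (f : R -> R[i]) (S : set R) : Prop :=
  {ae mu, forall x, ~ S x -> f x = 0}.

Definition L2sum (K : choiceType) (F : K -> R -> R[i]) (g : R -> R[i]) : Prop :=
  (fun A : {fset K} => L2norm (fun x => partial_sum (F ^~ x) A - g x))
    @ totally --> 0%E.

(* The translate f(x + t), as an element of L^2(O). *)
Definition translate (O : set R) (t : R) (f : R -> R[i]) : R -> R[i] :=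
  fun x => if x \in O then f (x + t) else 0.

Record strongly_continuous_unitary_group (O : set R)
    (U : R -> (R -> R[i]) -> (R -> R[i])) : Prop := {
  group_unitary : forall t, unitary_operator (L2 O) (L2 O) (U t) ;
  group_id : forall f, fmem (L2 O) f -> feq (L2 O) (U 0 f) f ;
  group_add : forall s t f, fmem (L2 O) f ->
    feq (L2 O) (U (s + t) f) (U s (U t f)) ;
  group_continuous : forall f, fmem (L2 O) f -> forall t0 : R,
    (fun t => L2norm (fun x => U t f x - U t0 f x)) @ t0 --> 0%E }.

(* As O is open in the application, the neighborhoods of x in O are the
   neighborhoods of x in R contained in O. *)
Definition integrability_property (O : set R)
    (U : R -> (R -> R[i]) -> (R -> R[i])) : Prop :=
  forall (x : R) (V : set R) (e : R), O x -> nbhs x V -> V `<=` O -> 0 < e ->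
    (forall t y, `|t| < e -> V y -> O (y + t)) ->
    forall t f, `|t| < e -> fmem (L2 O) f ->
      {ae mu, forall y, V y -> U t f y = f (y + t)}.

Section intervals.
Variables (I : countType) (alpha beta : I -> \bar R).

Definition itv_of (i : I) : set R :=
  [set x | (alpha i < x%:E)%E /\ (x%:E < beta i)%E].

Definition itv_union : set R := \bigcup_i itv_of i.

Definition itv_minlength : \bar R :=
  ereal_inf (range (fun i => (beta i - alpha i)%E)).

Definition left_index : countType := {i : I | (-oo < alpha i)%E}.
Definition right_index : countType := {k : I | (beta k < +oo)%E}.

(* When alpha i < beta i for all i, these endpoints are real numbers, so that
   fine does not lose information. *)
Definition left_end (i : left_index) : R := fine (alpha (val i)).
Definition right_end (k : right_index) : R := fine (beta (val k)).

Definition boundary_relation1 (U : R -> (R -> R[i]) -> (R -> R[i]))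
    (B : left_index -> right_index -> R[i]) : Prop :=
  forall (e : R) (i : left_index) (f : R -> R[i]),
    0 < e -> (e%:E < itv_minlength)%E -> fmem (L2 itv_union) f ->
    supported_on f `[left_end i, left_end i + e]%classic ->
    supported_on (U e f) (\bigcup_k `[right_end k - e, right_end k]%classic) /\
    L2sum (fun k x => B i k *
             translate itv_union (left_end i + e - right_end k) f x)
          (U e f).

Definition boundary_relation2 (U : R -> (R -> R[i]) -> (R -> R[i]))
    (B : left_index -> right_index -> R[i]) : Prop :=
  forall (e : R) (k : right_index) (f : R -> R[i]),
    0 < e -> (e%:E < itv_minlength)%E -> fmem (L2 itv_union) f ->
    supported_on f `[right_end k - e, right_end k]%classic ->
    supported_on (U (- e) f) (\bigcup_j `[left_end j, left_end j + e]%classic) /\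
    L2sum (fun j x => (B j k)^*%C *
             translate itv_union (right_end k - left_end j - e) f x)
          (U (- e) f).

End intervals.
End L2.

(* Main.v *)
Require Import Defs.
From HB Require Import structures.
From mathcomp Require Import all_boot all_order all_algebra finmap.
From mathcomp Require Import complex.
From mathcomp Require Import all_classical all_reals all_analysis.
From mathcomp Require Import measurable_realfun ring lra.
From Stdlib Require Setoid Morphisms.
Import Order.TTheory GRing.Theory Num.Theory.
Import numFieldNormedType.Exports.

Local Open Scope classical_set_scope.
Local Open Scope ring_scope.

(** The integrability property says that U t moves functions along every path inside
    the union O (integrability_moves): U t f (x) = f (x + t) as long as the whole way from
    x to x + t lies in O. For t < l the points without such a way form, up to a null set,
    the right layer, consisting of the cells of length t next to the finite right ends, and the points
    that are not reached form the left layer. All the freedom in U lies therefore in the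
    way in which the values on the left layer turn into values on the right one, and by
    conservation of the norm this is an isometry (en_layer_transfer). A layer is a stack
    of cells of the same length, so that L2 of a layer consists of the functions on
    ]0, t[ with values in l2 (integral_layer).

    From the group to the matrix. Take a step that has the constant value v k on the
    right cell k, for a vector v of l2, and run the group backwards for the duration of
    the step. Comparing steps of different lengths shows that the outcome on each left
    cell is invariant under shifts, hence constant (constant_of_shift,
    back_rconst_cst). Thus the group sends vectors of boundary values to vectors of
    boundary values. This map is isometric, it does not depend on the duration
    (back_rconst_indep), and it is onto (leftvec_onto); its matrix, conjugated, is B.
    The images of the steps under the inverse of U e being known, testing against steps
    gives U e f on each right cell for an arbitrary f on a left cell (adjoint_test), and
    the second relation follows from the first one in the same manner
    (cell_relation_adjoint). The sums over k converge in the mean because the cells are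
    disjoint (L2sum_layer).

    From the matrix to the group. For t < l define the evolution by translation off the
    right layer, and by the transpose of B, at each distance from the ends, from the left
    layer to the right one (local_op). It is unitary (local_op_unitary), and for short
    times it satisfies the semigroup law, since a point passes at most one end
    (local_opD). It extends to a one-parameter group (one_parameterD), which is strongly
    continuous because translations are continuous in the mean and the layers shrink to
    nothing (L2_shift, local_op_continuous). *)

Set Implicit Arguments.
Unset Strict Implicit.
Unset Printing Implicit Defensive.

(** * Complex numbers by real and imaginary parts *)

Section complex_modulus.
Variable R : realType.
Implicit Types z w : R[i].

Definition csq z : R := complex.Re z ^+ 2 + complex.Im z ^+ 2.

Lemma ReD z w : complex.Re (z + w) = complex.Re z + complex.Re w.
Proof. by case: z w => [? ?] [? ?]. Qed.

Lemma ImD z w : complex.Im (z + w) = complex.Im z + complex.Im w.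
Proof. by case: z w => [? ?] [? ?]. Qed.

Lemma ReN z : complex.Re (- z) = - complex.Re z.
Proof. by case: z => [? ?]. Qed.

Lemma ImN z : complex.Im (- z) = - complex.Im z.
Proof. by case: z => [? ?]. Qed.

Lemma ReM z w : complex.Re (z * w) =
  complex.Re z * complex.Re w - complex.Im z * complex.Im w.
Proof. by case: z w => [? ?] [? ?]. Qed.

Lemma ImM z w : complex.Im (z * w) =
  complex.Re z * complex.Im w + complex.Im z * complex.Re w.
Proof. by case: z w => [? ?] [? ?]. Qed.

Lemma ReJ z : complex.Re z^*%C = complex.Re z.
Proof. by case: z => [? ?]. Qed.

Lemma ImJ z : complex.Im z^*%C = - complex.Im z.
Proof. by case: z => [? ?]. Qed.

Lemma complex_ext z w : complex.Re z = complex.Re w ->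
  complex.Im z = complex.Im w -> z = w.
Proof. by case: z w => [? ?] [? ?] /= -> ->. Qed.

Definition ReImE := (ReD, ImD, ReN, ImN, ReM, ImM, ReJ, ImJ).

Lemma csq_ge0 z : 0 <= csq z.
Proof. by rewrite addr_ge0 ?sqr_ge0. Qed.

Lemma normc_sqr z : Normc.normc z ^+ 2 = csq z.
Proof. by case: z => x y /=; rewrite sqr_sqrtr// addr_ge0 ?sqr_ge0. Qed.

Lemma csq0 : csq 0 = 0.
Proof. by rewrite /csq /= expr0n addr0. Qed.

Lemma csq_eq0 z : csq z = 0 -> z = 0.
Proof.
move=> /eqP; rewrite /csq paddr_eq0 ?sqr_ge0// !sqrf_eq0 => /andP[/eqP x0 /eqP y0].
exact: complex_ext.
Qed.

Lemma csqM z w : csq (z * w) = csq z * csq w.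
Proof. by rewrite /csq !ReImE; ring. Qed.

Lemma csqJ z : csq z^*%C = csq z.
Proof. by rewrite /csq !ReImE; ring. Qed.

Lemma csqN z : csq (- z) = csq z.
Proof. by rewrite /csq !ReImE; ring. Qed.

Lemma csqD z w : csq (z + w) = csq z + csq w + 2 * complex.Re (z * w^*%C).
Proof. by rewrite /csq !ReImE; ring. Qed.

Lemma csqD_le z w : csq (z + w) <= 2 * csq z + 2 * csq w.
Proof.
rewrite /csq !ReImE -subr_ge0.
have -> : 2 * (complex.Re z ^+ 2 + complex.Im z ^+ 2) +
  2 * (complex.Re w ^+ 2 + complex.Im w ^+ 2) -
  ((complex.Re z + complex.Re w) ^+ 2 + (complex.Im z + complex.Im w) ^+ 2) =
  (complex.Re z - complex.Re w) ^+ 2 + (complex.Im z - complex.Im w) ^+ 2 by ring.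
by rewrite addr_ge0 ?sqr_ge0.
Qed.

Lemma Im_mulJ z w : complex.Im (z * w^*%C) = complex.Re (z * ('i%C * w)^*%C).
Proof. by rewrite !ReImE /=; ring. Qed.

End complex_modulus.

Section complex_measurable.
Variable R : realType.
Notation mu := (@lebesgue_measure R).
Implicit Types f g : R -> R[i].

Definition cmeas f := measurable_fun [set: R] (fun x => complex.Re (f x)) /\
  measurable_fun [set: R] (fun x => complex.Im (f x)).

Lemma cmeas_cst z : cmeas (fun=> z).
Proof. by split; exact: measurable_cst. Qed.

Lemma cmeasD f g : cmeas f -> cmeas g -> cmeas (fun x => f x + g x).
Proof.
move=> [f1 f2] [g1 g2]; split.
  by under eq_fun do rewrite ReD; exact: measurable_funD.
by under eq_fun do rewrite ImD; exact: measurable_funD.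
Qed.

Lemma cmeasM f g : cmeas f -> cmeas g -> cmeas (fun x => f x * g x).
Proof.
move=> [f1 f2] [g1 g2]; split.
  by under eq_fun do rewrite ReM; apply: measurable_funB; exact: measurable_funM.
by under eq_fun do rewrite ImM; apply: measurable_funD; exact: measurable_funM.
Qed.

Lemma cmeasZ z f : cmeas f -> cmeas (fun x => z * f x).
Proof. by apply: cmeasM; exact: cmeas_cst. Qed.

Lemma cmeasN f : cmeas f -> cmeas (fun x => - f x).
Proof.
move=> /(cmeasZ (-1)) => mf.
by under eq_fun do rewrite -mulN1r.
Qed.

Lemma cmeasB f g : cmeas f -> cmeas g -> cmeas (fun x => f x - g x).
Proof. by move=> mf /cmeasN mg; exact: cmeasD. Qed.

Lemma cmeasJ f : cmeas f -> cmeas (fun x => (f x)^*%C).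
Proof.
move=> [f1 f2]; split; first by under eq_fun do rewrite ReJ.
by under eq_fun do rewrite ImJ; exact: measurable_funN.
Qed.

Lemma cmeas_comp f (phi : R -> R) : measurable_fun [set: R] phi -> cmeas f ->
  cmeas (f \o phi).
Proof.
move=> mphi [f1 f2]; split.
  exact: (measurableT_comp f1 mphi).
exact: (measurableT_comp f2 mphi).
Qed.

Lemma cmeas_shift f t : cmeas f -> cmeas (fun x => f (x + t)).
Proof. by apply: cmeas_comp; exact: measurable_funD. Qed.

Lemma cmeas_if (A : set R) f g : measurable A -> cmeas f -> cmeas g ->
  cmeas (fun x => if x \in A then f x else g x).
Proof.
move=> mA [f1 f2] [g1 g2].
have mA' : measurable_fun [set: R] (fun x => x \in A).
  apply: (@measurable_fun_bool _ _ _ _ true).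
  rewrite setTI (_ : _ @^-1` _ = A)//.
  by apply/seteqP; split => x /= => [/set_mem|/mem_set].
split.
  under eq_fun do rewrite (fun_if (@complex.Re R)).
  by apply: measurable_fun_ifT.
under eq_fun do rewrite (fun_if (@complex.Im R)).
by apply: measurable_fun_ifT.
Qed.

Lemma measurable_csq f : cmeas f -> measurable_fun [set: R] (fun x => csq (f x)).
Proof.
by move=> [f1 f2]; apply: measurable_funD; exact: measurable_funX.
Qed.

Lemma emeasurable_csq f D : cmeas f -> measurable_fun D (fun x => (csq (f x))%:E).
Proof.
move=> mf; apply: measurable_funTS.
by apply/measurable_EFinP; exact: measurable_csq.
Qed.

End complex_measurable.

(** * Square-integrable functions on the line *)

Section energy.
Variable R : realType.
Notation mu := (@lebesgue_measure R).
Implicit Types f g h : R -> R[i].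

Definition en f : \bar R := (\int[mu]_x (csq (f x))%:E)%E.

Lemma en_ge0 f : (0 <= en f)%E.
Proof. by apply: integral_ge0 => x _; rewrite lee_fin csq_ge0. Qed.

Lemma L2normE f : L2norm f = (en f `^ (2^-1))%E.
Proof.
rewrite /L2norm /en unlock /=; congr (_ `^ _)%E.
apply: eq_integral => x _ /=; rewrite powR_mulrn ?normr_ge0//.
by rewrite ger0_norm ?normc_sqr//; case: (f x) => u v /=; rewrite sqrtr_ge0.
Qed.

Lemma L2norm_lty f : (L2norm f < +oo)%E <-> (en f < +oo)%E.
Proof.
rewrite L2normE; split; last exact: poweR_lty.
by apply: lty_poweRy; rewrite invr_neq0.
Qed.

Lemma ae_imp (P S : R -> Prop) : {ae mu, forall x, P x} ->
  (forall x, P x -> S x) -> {ae mu, forall x, S x}.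
Proof.
move=> p h; apply: (@filterS _ _ (ae_filter_ringOfSetsType mu)) p => x.
exact: h.
Qed.

Lemma ae_imp2 (P Q S : R -> Prop) : {ae mu, forall x, P x} -> {ae mu, forall x, Q x} ->
  (forall x, P x -> Q x -> S x) -> {ae mu, forall x, S x}.
Proof.
move=> p q h; apply: (@filterS2 _ _ (ae_filter_ringOfSetsType mu)) p q => x.
exact: h.
Qed.

Lemma ae_and (P Q : R -> Prop) : {ae mu, forall x, P x} -> {ae mu, forall x, Q x} ->
  {ae mu, forall x, P x /\ Q x}.
Proof. by move=> p q; apply: (ae_imp2 p q). Qed.

Lemma ae_eq_setT (U : Type) (f g : R -> U) :
  {ae mu, forall x, f x = g x} -> ae_eq mu setT f g.
Proof. by move=> /ae_imp; apply => x ->. Qed.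

Lemma ae_eqP f g : f = g %[ae mu] <-> {ae mu, forall x, f x = g x}.
Proof. by split => /ae_imp; apply => x // /(_ I). Qed.

Lemma en_ae f g : cmeas f -> cmeas g -> {ae mu, forall x, f x = g x} ->
  en f = en g.
Proof.
move=> mf mg fg; apply: ge0_ae_eq_integral => //.
- exact: emeasurable_csq.
- exact: emeasurable_csq.
- by move=> x _; rewrite lee_fin csq_ge0.
- by move=> x _; rewrite lee_fin csq_ge0.
- by apply: ae_eq_setT; refine (ae_imp fg _) => x ->.
Qed.

Lemma en_eq0 f : cmeas f -> en f = 0%E -> {ae mu, forall x, f x = 0}.
Proof.
move=> mf en0; have : (\int[mu]_x `|(csq (f x))%:E| = 0)%E.
  by rewrite -[RHS]en0; apply: eq_integral => x _; rewrite gee0_abs// lee_fin csq_ge0.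
move=> /(ae_eq_integral_abs mu measurableT (emeasurable_csq mf)).1.
by move=> /ae_imp; apply => x /(_ I)[] /csq_eq0.
Qed.

Lemma enD_le f g : cmeas f -> cmeas g ->
  (en (fun x => f x + g x)%R <= 2%:E * en f + 2%:E * en g)%E.
Proof.
move=> mf mg; rewrite -!ge0_integralZl//; last 4 first.
- exact: emeasurable_csq.
- by move=> x _; rewrite lee_fin csq_ge0.
- exact: emeasurable_csq.
- by move=> x _; rewrite lee_fin csq_ge0.
rewrite -ge0_integralD//; last 4 first.
- by move=> x _; rewrite mule_ge0// lee_fin csq_ge0.
- by apply: measurable_funeM; exact: emeasurable_csq.
- by move=> x _; rewrite mule_ge0// lee_fin csq_ge0.
- by apply: measurable_funeM; exact: emeasurable_csq.
apply: ge0_le_integral => //.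
- by move=> x _; rewrite lee_fin csq_ge0.
- by apply: emeasurable_csq; exact: cmeasD.
- by apply: emeasurable_funD; apply: measurable_funeM; exact: emeasurable_csq.
- by move=> x _; rewrite -!EFinM -EFinD lee_fin csqD_le.
Qed.

Lemma enZ z f : cmeas f -> en (fun x => z * f x) = ((csq z)%:E * en f)%E.
Proof.
move=> mf; rewrite -ge0_integralZl//.
- by apply: eq_integral => x _; rewrite csqM EFinM.
- exact: emeasurable_csq.
- by move=> x _; rewrite lee_fin csq_ge0.
- by rewrite lee_fin csq_ge0.
Qed.

Lemma en0 : en (fun=> 0) = 0%E.
Proof. by apply: integral0_eq => x _; rewrite csq0. Qed.

Lemma enN f : en (fun x => - f x) = en f.
Proof. by apply: eq_integral => x _; rewrite csqN. Qed.

Definition sqint f := cmeas f /\ (en f < +oo)%E.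

Lemma sqintD f g : sqint f -> sqint g -> sqint (fun x => f x + g x).
Proof.
move=> [mf ef] [mg eg]; split; first exact: cmeasD.
apply: le_lt_trans (enD_le mf mg) _.
by rewrite lte_add_pinfty// lte_mul_pinfty// ?lee_fin.
Qed.

Lemma sqintZ z f : sqint f -> sqint (fun x => z * f x).
Proof.
move=> [mf ef]; split; first exact: cmeasZ.
by rewrite enZ// lte_mul_pinfty// ?lee_fin ?csq_ge0.
Qed.

Lemma sqintN f : sqint f -> sqint (fun x => - f x).
Proof. by move=> [mf ef]; split; [exact: cmeasN|rewrite enN]. Qed.

Lemma sqintB f g : sqint f -> sqint g -> sqint (fun x => f x - g x).
Proof. by move=> mf /sqintN mg; exact: sqintD. Qed.

Lemma fmemP O f : fmem (L2 O) f <-> sqint f /\ (forall x, ~ O x -> f x = 0).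
Proof.
split => /=.
  by move=> [m1 m2 /L2norm_lty ef off]; split=> //; split.
by move=> [[[m1 m2] ef] off]; split => //; exact/L2norm_lty.
Qed.

Lemma fmem_sqint O f : fmem (L2 O) f -> sqint f.
Proof. by move=> /fmemP[]. Qed.

Lemma fmem_cmeas O f : fmem (L2 O) f -> cmeas f.
Proof. by move=> /fmemP[[]]. Qed.

Lemma fmem_off O f x : fmem (L2 O) f -> ~ O x -> f x = 0.
Proof. by move=> /fmemP[_]; exact. Qed.

Lemma fmem_lin O z f g : fmem (L2 O) f -> fmem (L2 O) g ->
  fmem (L2 O) (fun x => z * f x + g x).
Proof.
move=> /fmemP[sf of_] /fmemP[sg og]; apply/fmemP; split.
  by apply: sqintD => //; exact: sqintZ.
by move=> x Ox; rewrite of_// og// mulr0 addr0.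
Qed.

Lemma fmemD O f g : fmem (L2 O) f -> fmem (L2 O) g -> fmem (L2 O) (fun x => f x + g x).
Proof. by move=> f2 g2; have := fmem_lin 1 f2 g2; under eq_fun do rewrite mul1r. Qed.

Lemma fmemB O f g : fmem (L2 O) f -> fmem (L2 O) g -> fmem (L2 O) (fun x => f x - g x).
Proof.
by move=> f2 g2; have := fmem_lin (-1) g2 f2; under eq_fun do rewrite mulN1r addrC.
Qed.

Definition cint f : R[i] :=
  Complex (\int[mu]_x complex.Re (f x))%R (\int[mu]_x complex.Im (f x))%R.

Lemma fipE O f g : fip (L2 O) f g = cint (fun x => f x * (g x)^*%C).
Proof. by []. Qed.

Lemma integrable_csq f : sqint f -> mu.-integrable [set: R] (fun x => (csq (f x))%:E).
Proof.
move=> [mf ef]; apply/integrableP; split; first exact: emeasurable_csq.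
by under eq_integral do rewrite gee0_abs ?lee_fin ?csq_ge0//.
Qed.

Lemma integrable_ReMJ f g : sqint f -> sqint g ->
  mu.-integrable [set: R] (fun x => (complex.Re (f x * (g x)^*%C))%:E).
Proof.
move=> sf sg; have [mf _] := sf; have [mg _] := sg.
apply: (@le_integrable _ _ _ mu setT measurableT _
  (fun x => ((csq (f x))%:E + (csq (g x))%:E)%E)).
- apply/measurable_EFinP.
  exact: (cmeasM mf (cmeasJ mg)).1.
- move=> x _; rewrite -EFinD !abse_EFin lee_fin [leRHS]ger0_norm; last first.
    by rewrite addr_ge0 ?csq_ge0.
  rewrite !ReImE /csq ler_norml; apply/andP; split; rewrite -subr_ge0.
    have : 0 <= (complex.Re (f x) + complex.Re (g x)) ^+ 2 + (complex.Im (f x) + complex.Im (g x)) ^+ 2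
      + (complex.Re (f x) ^+ 2 + complex.Im (f x) ^+ 2 + complex.Re (g x) ^+ 2 + complex.Im (g x) ^+ 2).
      by rewrite !addr_ge0 ?sqr_ge0.
    by move=> h; lra.
  have : 0 <= (complex.Re (f x) - complex.Re (g x)) ^+ 2 + (complex.Im (f x) - complex.Im (g x)) ^+ 2
      + (complex.Re (f x) ^+ 2 + complex.Im (f x) ^+ 2 + complex.Re (g x) ^+ 2 + complex.Im (g x) ^+ 2).
    by rewrite !addr_ge0 ?sqr_ge0.
  by move=> h; lra.
- by apply: integrableD => //; exact: integrable_csq.
Qed.

(** Polarization: the norm determines the real part of the inner product. *)
Lemma enD f g : sqint f -> sqint g ->
  en (fun x => f x + g x) =
  (en f + en g + (2 * \int[mu]_x complex.Re (f x * (g x)^*%C))%R%:E)%E.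
Proof.
move=> sf sg; have [mf ef] := sf; have [mg eg] := sg.
have ires := integrable_ReMJ sf sg.
rewrite /en EFinM /Rintegral fineK; last exact: integrable_fin_num.
rewrite -integralZl// -integralD//; [|exact: integrable_csq|exact: integrable_csq].
rewrite -integralD//; last 2 first.
- by apply: integrableD => //; exact: integrable_csq.
- exact: integrableZl.
by apply: eq_integral => x _; rewrite csqD !EFinD EFinM.
Qed.

Lemma cint_ae f g : cmeas f -> cmeas g -> {ae mu, forall x, f x = g x} ->
  cint f = cint g.
Proof.
move=> [mf1 mf2] [mg1 mg2] fg; apply: complex_ext => /=; congr fine.
  apply: ae_eq_integral => //; [exact/measurable_EFinP|exact/measurable_EFinP|].
  by apply: ae_eq_setT; refine (ae_imp fg _) => x ->.
apply: ae_eq_integral => //; [exact/measurable_EFinP|exact/measurable_EFinP|].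
by apply: ae_eq_setT; refine (ae_imp fg _) => x ->.
Qed.

Lemma Re_fip O f g : sqint f -> sqint g ->
  complex.Re (fip (L2 O) f g) =
  (fine (en (fun x => f x + g x)) - fine (en f) - fine (en g)) / 2.
Proof.
move=> sf sg; rewrite enD//=.
have fn h : sqint h -> exists r, en h = r%:E.
  by move=> [_ eh]; exists (fine (en h)); rewrite fineK// ge0_fin_numE// en_ge0.
have [[a ->] [b ->]] := (fn _ sf, fn _ sg).
by rewrite /=; field.
Qed.

Lemma Im_fip O f g : complex.Im (fip (L2 O) f g) =
  complex.Re (fip (L2 O) f (fun x => 'i%C * g x)).
Proof.
by rewrite /=; congr fine; apply: eq_integral => x _; rewrite Im_mulJ.
Qed.

Lemma fip_self O f : sqint f -> complex.Re (fip (L2 O) f f) = fine (en f).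
Proof.
move=> sf; rewrite /=; congr fine; apply: eq_integral => x _.
by rewrite !ReImE /csq; congr (_%:E); ring.
Qed.

End energy.

(** * Translations and layers of cells *)

Section translation.
Variable R : realType.
Notation mu := (@lebesgue_measure R).

Definition shift (t : R) : measurableTypeR R -> measurableTypeR R :=
  fun x : R => x + t.

Lemma measurable_shift t : measurable_fun setT (shift t).
Proof. exact: measurable_funD. Qed.

Lemma lebesgue_measure_shift t (A : set R) : measurable A ->
  pushforward mu (shift t) A = mu A.
Proof.
move=> mA; apply/esym/lebesgue_measure_unique => //=.
  exact: measurable_shift.
move=> ? _ [[a b]] _ <-.
rewrite /pushforward (_ : shift t @^-1` _ = `]a - t, b - t]%classic); last first.
  apply/seteqP; split => x /=; rewrite /shift !in_itv/=.
    by rewrite ltrBlDr lerBrDr.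
  by rewrite ltrBlDr lerBrDr.
rewrite !lebesgue_measure_itv/= !lte_fin ltrD2r.
by case: ifP => // _; rewrite -!EFinD; congr (_%:E); ring.
Qed.

Lemma ge0_integral_shift t (f : R -> \bar R) : measurable_fun [set: R] f ->
  (forall x, (0 <= f x)%E) -> (\int[mu]_x f (x + t)%R = \int[mu]_x f x)%E.
Proof.
move=> mf f0; rewrite -[LHS]/(\int[mu]_(x in shift t @^-1` setT) (f \o shift t) x)%E.
rewrite -(ge0_integral_pushforward (measurable_shift t))//.
apply: eq_measure_integral => /=; first exact: measurable_shift.
by move=> _ A mA _; exact: lebesgue_measure_shift.
Qed.

Lemma measurable_fun_shift t (f : R -> R) : measurable_fun [set: R] f ->
  measurable_fun [set: R] (fun x => f (x + t)).
Proof. by move=> mf; apply: (measurableT_comp mf); exact: measurable_funD. Qed.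

Lemma ae_shift t (P : R -> Prop) : {ae mu, forall x, P x} ->
  {ae mu, forall x, P (x + t)}.
Proof.
move=> [N [mN N0 PN]]; exists (shift t @^-1` N); split.
- rewrite -[X in measurable X]setTI; exact: measurable_shift.
- by rewrite -[LHS]/(pushforward mu (shift t) N) lebesgue_measure_shift.
- by move=> x /= nP; apply: PN.
Qed.

Lemma en_shift t (f : R -> R[i]) : cmeas f -> en (fun x => f (x + t)) = en f.
Proof.
move=> mf; rewrite /en (ge0_integral_shift t (f := fun x => (csq (f x))%:E))//.
  exact: emeasurable_csq.
by move=> x; rewrite lee_fin csq_ge0.
Qed.

Lemma sqint_shift t (f : R -> R[i]) : sqint f -> sqint (fun x => f (x + t)).
Proof. by move=> [mf ef]; split; [exact: cmeas_shift|rewrite en_shift]. Qed.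

End translation.

Section countable_index.
Variable R : realType.
Notation mu := (@lebesgue_measure R).
Variable J : countType.

Lemma bigcup_pickle T (F : J -> set T) :
  \bigcup_j F j = \bigcup_n (if @pickle_inv J n is Some j then F j else set0).
Proof.
apply/seteqP; split => x [].
  by move=> j _ Fx; exists (choice.pickle j) => //; rewrite pickleK_inv.
by move=> n _; case: (@pickle_inv J n) => // j Fx; exists j.
Qed.

Lemma measurable_bigcup_count d (T : measurableType d) (F : J -> set T) :
  (forall j, measurable (F j)) -> measurable (\bigcup_j F j).
Proof.
move=> mF; rewrite bigcup_pickle; apply: bigcupT_measurable => n.
by case: (@pickle_inv J n).
Qed.

Lemma ae_forall_count (P : J -> R -> Prop) :
  (forall j, {ae mu, forall x, P j x}) -> {ae mu, forall x, forall j, P j x}.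
Proof.
move=> aeP.
have /ae_foralln : forall n, {ae mu, forall x,
    if @pickle_inv J n is Some j then P j x else True}.
  by move=> n; case: (@pickle_inv J n) => [j|]; [exact: aeP|exact/aeW].
move=> /ae_imp; apply => x Px j.
by have := Px (choice.pickle j); rewrite pickleK_inv.
Qed.

Lemma esum_pickle (a : J -> \bar R) : (forall j, (0 <= a j)%E) ->
  (\esum_(j in [set: J]) a j =
   \sum_(n <oo) (if @pickle_inv J n is Some j then a j else 0))%E.
Proof.
move=> a0.
have b0 n : (0 <= if @pickle_inv J n is Some j then a j else 0)%E.
  by case: (@pickle_inv J n).
rewrite nneseries_esumT//.
rewrite (@esumID _ _ (range (@choice.pickle J)) setT)// setTI.
rewrite esum_image/=; last by move=> x y _ _; exact: (pcan_inj (@choice.pickleK J)).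
rewrite [X in (_ + X)%E]esum1 ?adde0; last first.
  move=> n [_ /= hn]; case E: (@pickle_inv J n) => [j|//].
  by exfalso; apply: hn; exists j => //; have := @pickle_invK J n; rewrite /oapp E.
by apply: eq_esum => j _; rewrite pickleK_inv.
Qed.

Lemma measurable_esum d (T : measurableType d) (a : J -> T -> \bar R) (D : set T) :
  (forall j x, (0 <= a j x)%E) -> (forall j, measurable_fun D (a j)) ->
  measurable_fun D (fun x => (\esum_(j in [set: J]) a j x)%E).
Proof.
move=> a0 ma; rewrite (_ : (fun x => _) = fun x =>
    (\sum_(n <oo) (if @pickle_inv J n is Some j then a j x else 0))%E); last first.
  by apply/funext => x; rewrite esum_pickle.
apply: ge0_emeasurable_sum.
  by move=> n x _ _; case: (@pickle_inv J n).
by move=> n; case: (@pickle_inv J n) => [j _|_]; [exact: ma|exact: measurable_cst].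
Qed.

Lemma integral_esum (D : set R) (a : J -> R -> \bar R) : measurable D ->
  (forall j x, (0 <= a j x)%E) -> (forall j, measurable_fun D (a j)) ->
  (\int[mu]_(x in D) (\esum_(j in [set: J]) a j x) =
   \esum_(j in [set: J]) (\int[mu]_(x in D) a j x))%E.
Proof.
move=> mD a0 ma; rewrite esum_pickle; last first.
  by move=> j; apply: integral_ge0.
under eq_integral do rewrite esum_pickle//.
rewrite integral_nneseries//.
- apply: eq_eseriesr => n _; case: (@pickle_inv J n) => //.
  exact: integral0.
- by move=> n; case: (@pickle_inv J n) => [j|//]; exact: ma.
- by move=> n x _; case: (@pickle_inv J n).
Qed.

End countable_index.

Section layers.
Variable R : realType.
Notation mu := (@lebesgue_measure R).
Variables (J : countType) (p : J -> R) (e : R).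

Definition layer : set R := \bigcup_j `]p j, p j + e[%classic.

Hypothesis layer_triv : trivIset setT (fun j => `]p j, p j + e[%classic).

Lemma layerP x : layer x <-> exists j s, [/\ 0 < s, s < e & x = p j + s].
Proof.
split; first move=> [j _ /=]; rewrite ?in_itv/=.
  move=> /andP[h1 h2]; exists j, (x - p j); split; rewrite ?subr_gt0 ?ltrBlDl//.
  by rewrite addrC subrK.
by move=> [j [s [s0 se ->]]]; exists j => //=; rewrite in_itv/= ltrDl s0 ltrD2l.
Qed.

Lemma layer_in j s : 0 < s -> s < e -> layer (p j + s).
Proof. by move=> s0 se; apply/layerP; exists j, s. Qed.

Lemma measurable_layer : measurable layer.
Proof. by apply: measurable_bigcup_count => j; exact: measurable_itv. Qed.

Lemma layer_inj i j s r : 0 < s < e -> 0 < r < e -> p i + s = p j + r ->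
  i = j /\ s = r.
Proof.
move=> /andP[s0 se] /andP[r0 re] eq.
have ij : i = j.
  apply: contrapT => /eqP ij; have /trivIsetP/(_ i j I I ij) := layer_triv.
  rewrite -subset0 => /(_ (p i + s)); apply; split => /=.
    by rewrite in_itv/= ltrDl s0 ltrD2l.
  by rewrite eq in_itv/= ltrDl r0 ltrD2l.
by split=> //; move: eq; rewrite ij => /addrI.
Qed.

(** Stacking the cells over one interval turns the integral over the layer into the
    integral of a sum. In this way a square-integrable function on the layer becomes
    a square-integrable family of vectors of l2, one at each distance from the ends. *)
Lemma integral_layer (g : R -> \bar R) : measurable_fun [set: R] g ->
  (forall x, (0 <= g x)%E) ->
  (\int[mu]_(x in layer) g x =
   \int[mu]_(s in `]0%R, e[) (\esum_(j in [set: J]) g (p j + s)%R))%E.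
Proof.
move=> mg g0; rewrite integral_esum//; last first.
  move=> j; apply: measurable_funTS; apply: (measurableT_comp mg).
  exact: measurable_funD.
rewrite /layer bigcup_pickle ge0_integral_bigcup//; last 3 first.
- by move=> n; case: (@pickle_inv J n) => // j; exact: measurable_itv.
- exact: measurable_funTS.
- apply/trivIsetP => m n _ _ mn.
  case Em: (@pickle_inv J m) => [i|]; last by rewrite set0I.
  case En: (@pickle_inv J n) => [j|]; last by rewrite setI0.
  move/trivIsetP : layer_triv; apply => //; apply: contra_neq mn => ij.
  have := @pickle_invK J m; have := @pickle_invK J n.
  by rewrite /oapp Em En ij => -> ->.
rewrite esum_pickle; last by move=> j; exact: integral_ge0.
apply: eq_eseriesr => n _; case: (@pickle_inv J n) => [j|]; last first.
  by rewrite integral_set0.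
rewrite integral_mkcond/= [RHS]integral_mkcond/=.
rewrite -(ge0_integral_shift (p j)).
- apply: eq_integral => x _; rewrite /patch.
  rewrite (_ : (x + p j \in _) = (x \in `]0%R, e[%classic)) 1?addrC//.
  apply/idP/idP => /set_mem/= h; apply/mem_set => /=; move: h.
    by rewrite !in_itv/= => /andP[? ?]; apply/andP; split; lra.
  by rewrite !in_itv/= => /andP[? ?]; apply/andP; split; lra.
- by apply/(measurable_restrictT _ _).1 => //; exact: measurable_funTS.
- by move=> x; rewrite /patch; case: ifP.
Qed.

End layers.

(** * Cutting off and testing against intervals *)

Section cutoff.
Variable R : realType.
Notation mu := (@lebesgue_measure R).
Implicit Types (f g : R -> R[i]) (A : set R).

Definition cut A f : R -> R[i] := fun x => if x \in A then f x else 0.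

Lemma cut_in A f x : A x -> cut A f x = f x.
Proof. by move=> Ax; rewrite /cut mem_set. Qed.

Lemma cut_out A f x : ~ A x -> cut A f x = 0.
Proof. by move=> Ax; rewrite /cut memNset. Qed.

Lemma cmeas_cut A f : measurable A -> cmeas f -> cmeas (cut A f).
Proof. by move=> mA mf; apply: cmeas_if => //; exact: cmeas_cst. Qed.

Lemma en_cut A f : en (cut A f) = (\int[mu]_(x in A) (csq (f x))%:E)%E.
Proof.
rewrite integral_mkcond; apply: eq_integral => x _.
by rewrite /patch /cut; case: ifP => // _; rewrite csq0.
Qed.

Lemma en_cut_split A B f : measurable A -> measurable B -> [disjoint A & B]%classic ->
  cmeas f -> en (cut (A `|` B) f) = (en (cut A f) + en (cut B f))%E.
Proof.
move=> mA mB AB mf; rewrite !en_cut ge0_integral_setU//.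
  exact: emeasurable_csq.
by move=> x _; rewrite lee_fin csq_ge0.
Qed.

Lemma en_splitC A f : measurable A -> cmeas f ->
  en f = (en (cut A f) + en (cut (~` A) f))%E.
Proof.
move=> mA mf; rewrite -en_cut_split//; last 2 first.
- exact: measurableC.
- by apply/eqP; rewrite setICr.
by apply: eq_integral => x _; rewrite setUv cut_in.
Qed.

Lemma en_cut_le A f : measurable A -> cmeas f -> (en (cut A f) <= en f)%E.
Proof. by move=> mA mf; rewrite [leRHS](en_splitC mA)// leeDl// en_ge0. Qed.

(** At almost every point the function is the derivative of its indefinite
    integral. *)
Lemma integrable_cdf_ae (f g : R -> R) :
  mu.-integrable setT (EFin \o f) -> mu.-integrable setT (EFin \o g) ->
  (forall x, (\int[mu]_(t in `]-oo, x]) f t = \int[mu]_(t in `]-oo, x]) g t)%R) ->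
  {ae mu, forall x, f x = g x}.
Proof.
move=> intf intg fg.
have half h : mu.-integrable setT (EFin \o h) ->
    {ae mu, forall x : R,
      derive1 (fun y : R => \int[mu]_(t in `]-oo, y]) h t)%R x = h x}.
  move=> inth.
  have hy (y : R) : mu.-integrable `]-oo, y] (EFin \o h) by apply: integrableS inth.
  have hl : locally_integrable [set: R] h.
    by apply: open_integrable_locally => //; exact: openT.
  by refine (ae_imp (FTC1Ny hy hl) _) => x [].
apply: (ae_imp2 (half _ intf) (half _ intg)) => x <- <-.
by congr (derive1 _ x); apply/funext.
Qed.

Lemma sqint_cst_itv (z : R[i]) (u v : R) : sqint (cut `]u, v[%classic (fun=> z)).
Proof.
split; first by apply: cmeas_cut => //; exact: cmeas_cst.
rewrite en_cut integral_cst//= lte_mul_pinfty// ?lee_fin ?csq_ge0//.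
by rewrite lebesgue_measure_itv/=; case: ifP => // _; rewrite -EFinB ltry.
Qed.

Lemma cut_mulJ A f x : cut A f x = f x * (cut A (fun=> 1) x)^*%C.
Proof. by rewrite /cut; case: ifP => _; rewrite ?conjc1 ?conjc0 ?mulr1 ?mulr0. Qed.

Lemma integrable_cut_Re f (u v : R) : sqint f ->
  mu.-integrable setT (fun x => (complex.Re (cut `]u, v[%classic f x))%:E).
Proof.
move=> sf; have := integrable_ReMJ sf (sqint_cst_itv 1 u v).
by apply: eq_integrable => // x _; rewrite -cut_mulJ.
Qed.

(** Equal integrals over all subintervals make the indefinite integrals equal; the
    imaginary part is the real part after multiplication by - i. *)
Lemma interval_test f g (u v : R) : sqint f -> sqint g ->
  (forall c d, u <= c -> c < d -> d <= v ->
    cint (cut `]c, d[%classic f) = cint (cut `]c, d[%classic g)) ->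
  {ae mu, forall x, u < x < v -> f x = g x}.
Proof.
move=> sf sg fg.
have hRe f1 g1 : sqint f1 -> sqint g1 ->
    (forall c d, u <= c -> c < d -> d <= v ->
    complex.Re (cint (cut `]c, d[%classic f1)) =
    complex.Re (cint (cut `]c, d[%classic g1))) ->
    {ae mu, forall x, u < x < v -> complex.Re (f1 x) = complex.Re (g1 x)}.
  move=> sf1 sg1 fg1.
  have restr h (x : R) : sqint h ->
    (\int[mu]_(t in `]-oo, x]) complex.Re (cut `]u, v[%classic h t))%R =
    (\int[mu]_t complex.Re (cut `]u, Num.min x v[%classic h t))%R.
    move=> sh; rewrite -Rintegral_itv_bndo_bndc; last first.
      by apply: integrableS (integrable_cut_Re u v sh).
    rewrite Rintegral_mkcond; congr fine; apply: eq_integral => t _.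
    rewrite /patch /cut; congr (_%:E).
    have -> : (t \in `]u, Num.min x v[%classic) =
        (t \in `]-oo, x[%classic) && (t \in `]u, v[%classic).
      apply/idP/andP; rewrite !inE /= !in_itv /= lt_min.
        by move=> /and3P[-> -> ->].
      by move=> [-> /andP[-> ->]].
    by case: (t \in _).
  have := @integrable_cdf_ae (fun x => complex.Re (cut `]u, v[%classic f1 x))
    (fun x => complex.Re (cut `]u, v[%classic g1 x)) (integrable_cut_Re u v sf1)
    (integrable_cut_Re u v sg1).
  move=> H; have {H} := H _.
  move=> H; have /ae_imp : {ae mu, forall x, complex.Re (cut `]u, v[%classic f1 x) = complex.Re (cut `]u, v[%classic g1 x)}.
    apply: H => x; rewrite !restr//.
    have [ux|xu] := ltP u (Num.min x v).
      by apply: fg1 => //; rewrite ge_min lexx orbT.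
    congr fine; apply: eq_integral => t _; congr (_%:E).
    by rewrite !cut_out//= in_itv/= => /andP[h1 h2]; move: (lt_le_trans (lt_trans h1 h2) xu); rewrite ltxx.
  by apply=> x + uxv; rewrite !cut_in//= in_itv.
have hI f1 : sqint f1 -> sqint (fun x => - 'i%C * f1 x) by move=> s1; exact: sqintZ.
have cutI (h : R -> R[i]) c d : complex.Re (cint (cut `]c, d[%classic (fun x => - 'i%C * h x))) =
   complex.Im (cint (cut `]c, d[%classic h)).
  rewrite /=; congr fine; apply: eq_integral => t _; congr (_%:E).
  by rewrite /cut; case: ifP => // _; rewrite !ReImE /=; ring.
apply: (ae_imp2 (hRe f g sf sg _) (hRe _ _ (hI _ sf) (hI _ sg) _)).
- by move=> c d uc cd dv; rewrite fg.
- by move=> c d uc cd dv; rewrite !cutI fg.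
move=> x fgr fgi uxv; apply: complex_ext; first exact: fgr.
by have := fgi uxv; rewrite !ReImE/=; lra.
Qed.

End cutoff.

(** * Unconditional sums and square-summable families *)

#[global] Existing Instance summability.totally_filter.

Section nets.
Variable R : realType.

Lemma complex_cvg (T : Type) (F : set_system T) (FF : Filter F) (f : T -> R[i])
    (z : R[i]) :
  (fun t => complex.Re (f t)) @ F --> complex.Re z ->
  (fun t => complex.Im (f t)) @ F --> complex.Im z ->
  (f : T -> R[i]^o) @ F --> (z : R[i]^o).
Proof.
move=> /cvgrPdist_lt fr /cvgrPdist_lt fi; apply/cvgrPdist_lt => -[e e'].
rewrite ltcE /= => /andP[/eqP -> e0].
have e20 : 0 < e / 2 by rewrite divr_gt0.
near=> t.
have : `|complex.Re z - complex.Re (f t)| < e / 2 by near: t; exact: fr.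
have : `|complex.Im z - complex.Im (f t)| < e / 2 by near: t; exact: fi.
rewrite normc_def ltcR -ReN -ImN -ReD -ImD => hi hr.
rewrite (le_lt_trans _ (_ : `|complex.Re (z - f t)| + `|complex.Im (z - f t)| < e))//; last first.
  by rewrite [e]splitr ltrD.
rewrite -[leRHS]ger0_norm ?addr_ge0// -sqrtr_sqr ler_wsqrtr// sqrrD.
rewrite !real_normK ?num_real// lerD2r lerDl.
by rewrite mulrn_wge0// mulr_ge0.
Unshelve. all: by end_near. Qed.

Lemma complex_cvg_Re (T : Type) (F : set_system T) (FF : Filter F) (f : T -> R[i])
    (z : R[i]) : (f : T -> R[i]^o) @ F --> (z : R[i]^o) ->
  (fun t => complex.Re (f t)) @ F --> complex.Re z.
Proof.
move=> /cvgrPdist_lt fz; apply/cvgrPdist_lt => e e0.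
have := fz (e%:C)%C; rewrite ltcR => /(_ e0); apply: filterS => t /=.
rewrite -ReN -ReD -ltcR; apply: le_lt_trans; exact: normc_ge_Re.
Qed.

Lemma complex_cvg_Im (T : Type) (F : set_system T) (FF : Filter F) (f : T -> R[i])
    (z : R[i]) : (f : T -> R[i]^o) @ F --> (z : R[i]^o) ->
  (fun t => complex.Im (f t)) @ F --> complex.Im z.
Proof.
move=> /cvgrPdist_lt fz; apply/cvgrPdist_lt => e e0.
have := fz (e%:C)%C; rewrite ltcR => /(_ e0); apply: filterS => t /=.
rewrite -ImN -ImD -ltcR; apply: le_lt_trans.
have := normc_ge_Re ('i%C * (z - f t)).
by rewrite normrM (normc_def 'i%C)/= expr0n expr1n add0r sqrtr1 mul1r ReM/= mul0r sub0r mul1r normrN.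
Qed.

Variable K : choiceType.

Lemma partial_sumE (V : zmodType) (a : K -> V) (A : {fset K}) :
  partial_sum a A = \sum_(k <- A) a k.
Proof. by rewrite /partial_sum big_seq_fsetE. Qed.

Lemma partial_sum_le_esum (a : K -> R) (A : {fset K}) : (forall k, 0 <= a k) ->
  ((partial_sum a A)%:E <= \esum_(k in [set: K]) (a k)%:E)%E.
Proof.
move=> a0; apply: esum_ge; exists [set` A]; first by split.
by rewrite partial_sumE fsbig_finite//= set_fsetK sumEFin.
Qed.

Lemma partial_sum_mono (a : K -> R) (A B : {fset K}) : (forall k, 0 <= a k) ->
  (A `<=` B)%fset -> partial_sum a A <= partial_sum a B.
Proof.
move=> a0 AB; rewrite !partial_sumE [leRHS](big_fsetID _ (mem A))/=.
rewrite (_ : [fset x in B | x \in A]%fset = A); last first.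
  apply/fsetP => x; rewrite !inE/= andbC; apply: andb_idr => xA.
  exact: (fsubsetP AB).
by rewrite lerDl sumr_ge0.
Qed.

Lemma partial_sum_cvg (a : K -> R) : (forall k, 0 <= a k) ->
  (\esum_(k in [set: K]) (a k)%:E < +oo)%E ->
  partial_sum a @ totally --> fine (\esum_(k in [set: K]) (a k)%:E)%E.
Proof.
move=> a0 aoo; set S := (\esum_(k in _) _)%E.
have Sfin : S \is a fin_num.
  by rewrite ge0_fin_numE//; apply: esum_ge0 => k _; rewrite lee_fin.
apply/cvgrPdist_lt => e e0.
have : (S - e%:E < S)%E by rewrite lteBlDr// lteDl// lte_fin.
rewrite {2}/S => /ereal_sup_gt[_ [X [finX _] <-]] SX.
exists (fset_set X) => // A /= XA.
have hA : (S - e%:E < (partial_sum a A)%:E)%E.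
  apply: lt_le_trans SX _.
  rewrite fsbig_finite//= sumEFin lee_fin -partial_sumE.
  exact: partial_sum_mono.
have hA' := partial_sum_le_esum A a0; rewrite -/S in hA'.
rewrite -lte_fin -(fineK Sfin) -EFinB lte_fin in hA *.
rewrite -(fineK Sfin) lee_fin in hA'.
by rewrite ger0_norm ?subr_ge0// ltrBlDr addrC -ltrBlDr.
Qed.

Lemma esum_single (a : K -> \bar R) k0 : (0 <= a k0)%E ->
  (forall k, k != k0 -> a k = 0%E) -> (\esum_(k in [set: K]) a k = a k0)%E.
Proof.
move=> a0 ak; rewrite (@esumID _ _ [set k0])//; last first.
  by move=> k _; case: (eqVneq k k0) => [->//|/ak ->].
rewrite !setTI esum_set1// esum1 ?adde0// => k /= /eqP.
exact: ak.
Qed.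

End nets.

Section l2_space.
Variables (R : realType) (K : choiceType).
Implicit Types v w : K -> R[i].

Definition l2n v : \bar R := (\esum_(k in [set: K]) (csq (v k))%:E)%E.

Lemma l2n_ge0 v : (0 <= l2n v)%E.
Proof. by apply: esum_ge0 => k _; rewrite lee_fin csq_ge0. Qed.

Lemma l2memE v : fmem (l2 R K) v <-> (l2n v < +oo)%E.
Proof.
have <- : (\esum_(k in [set: K]) (Normc.normc (v k) ^+ 2)%:E)%E = l2n v; last by [].
by apply: eq_esum => k _; rewrite normc_sqr.
Qed.

Lemma l2n_fin v : fmem (l2 R K) v -> l2n v \is a fin_num.
Proof. by move=> /l2memE h; rewrite ge0_fin_numE// l2n_ge0. Qed.

Lemma esumZ (a : K -> \bar R) (c : R) : 0 <= c -> (forall k, (0 <= a k)%E) ->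
  (\esum_(k in [set: K]) (c%:E * a k) = c%:E * \esum_(k in [set: K]) a k)%E.
Proof.
move=> c0 a0; rewrite /esum -ereal_supZl//; last first.
  apply/set0P; exists 0%E => /=; exists set0; first exact: fsets_set0.
  by rewrite fsbig_set0.
congr ereal_sup; apply/seteqP; split => x /=.
  move=> [X fX <-]; exists (\sum_(k \in X) a k)%E; first by exists X.
  by rewrite ge0_mule_fsumr.
by move=> [_ [X fX <-] <-]; exists X => //; rewrite ge0_mule_fsumr.
Qed.

Lemma l2nZ z v : l2n (fun k => z * v k) = ((csq z)%:E * l2n v)%E.
Proof.
rewrite /l2n -esumZ ?csq_ge0//.
  by apply: eq_esum => k _; rewrite csqM EFinM.
by move=> k; rewrite lee_fin csq_ge0.
Qed.

Lemma l2nD_le v w : (l2n (fun k => v k + w k)%R <= 2%:E * l2n v + 2%:E * l2n w)%E.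
Proof.
rewrite /l2n -!esumZ// -?esumD//.
- by apply: le_esum => k _; rewrite -!EFinM -EFinD lee_fin csqD_le.
- by move=> k _; rewrite mule_ge0// lee_fin csq_ge0.
- by move=> k _; rewrite mule_ge0// lee_fin csq_ge0.
- by move=> k; rewrite lee_fin csq_ge0.
- by move=> k; rewrite lee_fin csq_ge0.
Qed.

Lemma l2mem_lin z v w : fmem (l2 R K) v -> fmem (l2 R K) w ->
  fmem (l2 R K) (fun k => z * v k + w k).
Proof.
move=> /l2memE v2 /l2memE w2; apply/l2memE.
apply: le_lt_trans (l2nD_le _ _) _; rewrite l2nZ.
by rewrite lte_add_pinfty// !lte_mul_pinfty// ?lee_fin ?csq_ge0.
Qed.

Lemma l2memZ z v : fmem (l2 R K) v -> fmem (l2 R K) (fun k => z * v k).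
Proof.
move=> /l2memE v2; apply/l2memE; rewrite l2nZ.
by rewrite lte_mul_pinfty// ?lee_fin ?csq_ge0.
Qed.

Lemma l2memD v w : fmem (l2 R K) v -> fmem (l2 R K) w ->
  fmem (l2 R K) (fun k => v k + w k).
Proof.
by move=> v2 w2; have := l2mem_lin 1 v2 w2; under eq_fun do rewrite mul1r.
Qed.

Lemma l2nJ v : l2n (fun k => (v k)^*%C) = l2n v.
Proof. by apply: eq_esum => k _; rewrite csqJ. Qed.

Lemma l2memJ v : fmem (l2 R K) v -> fmem (l2 R K) (fun k => (v k)^*%C).
Proof. by move=> /l2memE v2; apply/l2memE; rewrite l2nJ. Qed.

Definition l2e (k0 : K) : K -> R[i] := fun k => if k == k0 then 1 else 0.

Lemma l2n_single (k0 : K) z : l2n (fun k => if k == k0 then z else 0) = (csq z)%:E.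
Proof.
rewrite /l2n (@esum_single _ _ _ k0) ?eqxx ?lee_fin ?csq_ge0//.
by move=> k /negbTE ->; rewrite csq0.
Qed.

Lemma l2mem_single (k0 : K) z : fmem (l2 R K) (fun k => if k == k0 then z else 0).
Proof. by apply/l2memE; rewrite l2n_single ltry. Qed.

Lemma l2n_ge v k : ((csq (v k))%:E <= l2n v)%E.
Proof.
rewrite /l2n (@esumID _ _ [set k])//; last by move=> i _; rewrite lee_fin csq_ge0.
rewrite !setTI esum_set1 ?lee_fin ?csq_ge0// leeDl//.
by apply: esum_ge0 => i _; rewrite lee_fin csq_ge0.
Qed.

Lemma l2n_eq0 v : l2n v = 0%E -> v = fun=> 0.
Proof.
move=> v0; apply/funext => k; apply: csq_eq0; apply/eqP; rewrite eq_le csq_ge0 andbT.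
by rewrite -lee_fin (le_trans (l2n_ge v k))// v0.
Qed.

(** The real part of the inner product, by polarization: this form shows that an
    isometry preserves it, and that the series of products converges. *)
Definition l2polar v w : R :=
  (fine (l2n (fun k => v k + w k)) - fine (l2n v) - fine (l2n w)) / 2.

Lemma l2ip_cvg v w : fmem (l2 R K) v -> fmem (l2 R K) w ->
  partial_sum (fun k => v k * (w k)^*%C : R[i]^o) @ totally -->
  (Complex (l2polar v w) (l2polar v (fun k => 'i%C * w k)) : R[i]^o).
Proof.
move=> v2 w2.
have real u : fmem (l2 R K) u ->
    (fun A => complex.Re (partial_sum (fun k => v k * (u k)^*%C : R[i]^o) A))
      @ totally --> l2polar v u.
  move=> u2.
  have sq x : fmem (l2 R K) x ->
      partial_sum (fun k => csq (x k)) @ totally --> fine (l2n x).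
    move=> x2; apply: partial_sum_cvg; first by move=> k; exact: csq_ge0.
    exact/l2memE.
  have h1 := sq _ (l2memD v2 u2).
  have FT : Filter (@totally K) by apply: filter_filter.
  have /(_ FT) h2 := cvgB h1 (sq _ v2).
  have /(_ FT) h3 := cvgB h2 (sq _ u2).
  have /(_ FT) := cvgM h3 (@cvg_cst _ (2^-1 : R) _ (@totally K) FT).
  rewrite -[X in _ --> X]/(l2polar v u); apply: cvg_trans.
  apply: near_eq_cvg; apply: nearW => A /=.
  rewrite !fctE !partial_sumE -!sumrB.
  have -> : complex.Re (\sum_(k <- A) v k * (u k)^*%C) =
      \sum_(k <- A) complex.Re (v k * (u k)^*%C).
    by elim/big_rec2 : _ => // i y1 y2 _; rewrite ReD => ->.
  by rewrite mulr_suml; apply: eq_bigr => k _; rewrite csqD; field.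
apply: complex_cvg; first exact: real.
rewrite /=; have := real _ (l2memZ 'i%C w2); apply: cvg_trans.
apply: near_eq_cvg; apply: nearW => A /=; rewrite !partial_sumE.
have Resum (F : K -> R[i]) : complex.Re (\sum_(k <- A) F k) = \sum_(k <- A) complex.Re (F k).
  by elim/big_rec2 : _ => // i y1 y2 _; rewrite ReD => ->.
have Imsum (F : K -> R[i]) : complex.Im (\sum_(k <- A) F k) = \sum_(k <- A) complex.Im (F k).
  by elim/big_rec2 : _ => // i y1 y2 _; rewrite ImD => ->.
by rewrite Resum Imsum; apply: eq_bigr => k _; rewrite Im_mulJ.
Qed.

Lemma l2fipE v w : fmem (l2 R K) v -> fmem (l2 R K) w ->
  fip (l2 R K) v w = Complex (l2polar v w) (l2polar v (fun k => 'i%C * w k)).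
Proof.
move=> v2 w2; rewrite /= /summability.sum.
apply: (@cvg_lim (R[i]^o) _ {fset K} (@totally K)).
- exact: norm_hausdorff.
- exact: l2ip_cvg.
Qed.

End l2_space.

(** * Unitary operators of l2 and their matrices *)

Section l2_basis.
Variables (R : realType) (K : choiceType).
Implicit Types v w : K -> R[i].

Lemma totally_unique (V : K -> R[i]) (a b : R[i]) :
  partial_sum (V : K -> R[i]^o) @ totally --> (a : R[i]^o) ->
  partial_sum (V : K -> R[i]^o) @ totally --> (b : R[i]^o) -> a = b.
Proof.
move=> ha hb; apply: (@cvg_unique (R[i]^o) _ (partial_sum (V : K -> R[i]^o) @ totally)) => //.
Qed.

Lemma partial_sum_single (a : K -> R[i]) k0 : (forall k, k != k0 -> a k = 0) ->
  partial_sum (a : K -> R[i]^o) @ totally --> (a k0 : R[i]^o).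
Proof.
move=> ak; apply: (@cvg_trans _ ((fun=> a k0 : R[i]^o) @ @totally K)); last first.
  by apply: cvg_cst.
apply: near_eq_cvg; exists [fset k0]%fset => // A /=.
rewrite fsub1set => kA; rewrite partial_sumE (big_fsetD1 k0)//= big_seq big1 ?addr0//.
by move=> k; rewrite !inE => /andP[/ak].
Qed.

Lemma l2eE (k0 : K) : l2e R k0 k0 = 1.
Proof. by rewrite /l2e eqxx. Qed.

Lemma l2mem_e k0 : fmem (l2 R K) (l2e R k0).
Proof. exact: l2mem_single. Qed.

Lemma l2fip_unique v w z : fmem (l2 R K) v -> fmem (l2 R K) w ->
  partial_sum (fun k => v k * (w k)^*%C : R[i]^o) @ totally --> (z : R[i]^o) ->
  fip (l2 R K) v w = z.
Proof.
move=> v2 w2 hz; rewrite l2fipE//; apply: totally_unique hz.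
exact: l2ip_cvg.
Qed.

Lemma l2fip_cvg v w : fmem (l2 R K) v -> fmem (l2 R K) w ->
  partial_sum (fun k => v k * (w k)^*%C : R[i]^o) @ totally -->
  (fip (l2 R K) v w : R[i]^o).
Proof. by move=> v2 w2; rewrite l2fipE//; exact: l2ip_cvg. Qed.

Lemma l2fip_er v k0 : fmem (l2 R K) v -> fip (l2 R K) v (l2e R k0) = v k0.
Proof.
move=> v2; apply: l2fip_unique => //; first exact: l2mem_e.
have := @partial_sum_single (fun k => v k * (l2e R k0 k)^*%C) k0.
rewrite l2eE conjc1 mulr1; apply => k /negbTE kk.
by rewrite /l2e kk conjc0 mulr0.
Qed.

Lemma l2fip_el v k0 : fmem (l2 R K) v -> fip (l2 R K) (l2e R k0) v = (v k0)^*%C.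
Proof.
move=> v2; apply: l2fip_unique => //; first exact: l2mem_e.
have := @partial_sum_single (fun k => l2e R k0 k * (v k)^*%C) k0.
rewrite l2eE mul1r; apply => k /negbTE kk.
by rewrite /l2e kk mul0r.
Qed.

Lemma l2polar_self v : fmem (l2 R K) v -> l2polar v v = fine (l2n v).
Proof.
move=> v2; rewrite /l2polar (_ : (fun k => v k + v k) = (fun k => 2 * v k)); last first.
  by apply/funext => k; rewrite mulr_natl mulr2n.
rewrite l2nZ fineM ?l2n_fin//= (_ : csq 2 = 4) 1?/csq; last first.
  by rewrite ReD ImD /=; ring.
by field.
Qed.

End l2_basis.

Section l2_unitary.
Variables (R : realType) (K J : choiceType) (V : (K -> R[i]) -> (J -> R[i])).
Implicit Types v w : K -> R[i].

Lemma l2_isometry_fip :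
  (forall v, fmem (l2 R K) v -> fmem (l2 R J) (V v)) ->
  (forall z v w, fmem (l2 R K) v -> fmem (l2 R K) w ->
    V (fun k => z * v k + w k) = (fun j => z * V v j + V w j)) ->
  (forall v, fmem (l2 R K) v -> l2n (V v) = l2n v) ->
  forall v w, fmem (l2 R K) v -> fmem (l2 R K) w ->
  fip (l2 R J) (V v) (V w) = fip (l2 R K) v w.
Proof.
move=> Vm Vl Vn v w v2 w2.
have VD x y : fmem (l2 R K) x -> fmem (l2 R K) y ->
    V (fun k => x k + y k) = (fun j => V x j + V y j).
  move=> x2 y2; rewrite -(_ : (fun k => 1 * x k + y k) = (fun k => x k + y k)).
    by rewrite Vl//; apply/funext => j; rewrite mul1r.
  by apply/funext => j; rewrite mul1r.
have V0 : V (fun=> 0) = fun=> 0.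
  apply: l2n_eq0; rewrite Vn; first by rewrite /l2n esum1// => k _; rewrite csq0.
  by apply/l2memE; rewrite /l2n esum1 ?ltry// => k _; rewrite csq0.
have m0 : fmem (l2 R K) (fun=> 0).
  by apply/l2memE; rewrite /l2n esum1 ?ltry// => k _; rewrite csq0.
have VZ z x : fmem (l2 R K) x -> V (fun k => z * x k) = (fun j => z * V x j).
  move=> x2; have := Vl z x (fun=> 0) x2 m0; rewrite V0.
  by under eq_fun do rewrite addr0; move=> ->; apply/funext => j; rewrite addr0.
have pol x y : fmem (l2 R K) x -> fmem (l2 R K) y -> l2polar (V x) (V y) = l2polar x y.
  by move=> x2 y2; rewrite /l2polar -VD// !Vn//; exact: l2memD.
rewrite !l2fipE//; [|exact: Vm|exact: Vm].
by rewrite pol// -VZ// pol//; exact: l2memZ.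
Qed.

Hypothesis VU : unitary_operator (l2 R K) (l2 R J) V.

Lemma unitary_l2n v : fmem (l2 R K) v -> l2n (V v) = l2n v.
Proof.
move=> v2; have Vv2 := unitary_fmem VU v2.
have := unitary_fip VU v2 v2; rewrite !l2fipE// => /(congr1 (@complex.Re R)) /=.
rewrite !l2polar_self// => vv.
by rewrite -(fineK (l2n_fin Vv2)) vv fineK ?l2n_fin.
Qed.

(** A unitary operator of l2 is given by the matrix of its values on the basis:
    expand the target coordinate against the preimage of a basis vector. *)
Lemma unitary_row_cvg v j : fmem (l2 R K) v ->
  partial_sum (fun k => V (l2e R k) j * v k : R[i]^o) @ totally --> (V v j : R[i]^o).
Proof.
move=> v2; have [u u2 Vu] := unitary_onto VU (l2mem_e R j).
rewrite -(l2fip_er j (unitary_fmem VU v2)) -Vu (unitary_fip VU v2 u2).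
apply: cvg_trans (l2fip_cvg v2 u2); apply: near_eq_cvg; apply: nearW => A.
rewrite !partial_sumE; apply: eq_bigr => k _; rewrite mulrC; congr (_ * _).
have ek := l2mem_e R k.
by rewrite -(l2fip_el k u2) -(unitary_fip VU ek u2) Vu l2fip_er//; exact: unitary_fmem VU _ ek.
Qed.

(** Pairing with the image of a basis vector, the operator being isometric, gives
    the columns of the adjoint, which is the inverse. *)
Lemma unitary_col_cvg v k : fmem (l2 R K) v ->
  partial_sum (fun j => V (l2e R k) j * (V v j)^*%C : R[i]^o) @ totally -->
  ((v k)^*%C : R[i]^o).
Proof.
move=> v2; have ek := l2mem_e R k.
rewrite -(l2fip_el k v2) -(unitary_fip VU ek v2).
exact: l2fip_cvg (unitary_fmem VU ek) (unitary_fmem VU v2).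
Qed.

Lemma unitary_matrix_col (B : J -> K -> R[i]) :
  (forall v, fmem (l2 R K) v -> forall j,
      partial_sum (fun k => B j k * v k : R[i]^o) @ totally --> (V v j : R[i]^o)) ->
  forall j k, V (l2e R k) j = B j k.
Proof.
move=> VB j k; apply/esym; apply: totally_unique (VB _ (l2mem_e R k) j).
have := @partial_sum_single R K (fun k' => B j k' * l2e R k k') k.
rewrite l2eE mulr1; apply => k' /negbTE kk.
by rewrite /l2e kk mulr0.
Qed.

End l2_unitary.

Lemma cmeas_partial_sum (R : realType) (K : choiceType) (F : K -> R -> R[i])
    (A : {fset K}) : (forall k, cmeas (F k)) -> cmeas (fun x => partial_sum (F^~ x) A).
Proof.
move=> mF; rewrite (_ : (fun x => _) = fun x => \sum_(k <- A) F k x); last first.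
  by apply/funext => x; rewrite partial_sumE.
elim: (enum_fset A) => [|k s ih].
  by under eq_fun do rewrite big_nil; exact: cmeas_cst.
by under eq_fun do rewrite big_cons; exact: cmeasD.
Qed.

Section matrix_action.
Variables (R : realType) (J K : countType) (M : K -> J -> R[i]).

Definition initial (n : nat) : {fset J} :=
  [fset j in pmap (@pickle_inv J) (iota 0 n)]%fset.

Lemma initial_cvg : initial @ \oo --> @totally J.
Proof.
move=> P [A0 _ A0P]; pose N := (\max_(j <- A0) choice.pickle j).+1.
exists N => // n /= Nn; apply: A0P => /=; apply/fsubsetP => j jA.
rewrite !inE /= mem_pmap; apply/mapP; exists (choice.pickle j).
  rewrite mem_iota add0n /= (leq_trans _ Nn)// /N ltnS.
  by rewrite (big_fsetD1 j jA)/= leq_maxl.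
by rewrite pickleK_inv.
Qed.

(** Multiplication by M. The upper limit makes the operation total and measurable
    in u; whenever the series converges unconditionally, as it does for u in l2 and M
    unitary, it is the sum. *)
Definition mxapp (u : J -> R[i]) (k : K) : R[i] :=
  Complex
    (fine (limn_esup (fun n => (complex.Re (partial_sum (fun j => M k j * u j) (initial n)))%:E)))
    (fine (limn_esup (fun n => (complex.Im (partial_sum (fun j => M k j * u j) (initial n)))%:E))).

Lemma mxapp_cvg (u : J -> R[i]) k (z : R[i]) :
  partial_sum (fun j => M k j * u j : R[i]^o) @ totally --> (z : R[i]^o) ->
  mxapp u k = z.
Proof.
move=> h; have {}h := cvg_comp _ _ initial_cvg h.
have lims (r : nat -> R) l : r @ \oo --> l -> fine (limn_esup (fun n => (r n)%:E)) = l.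
  move=> rl; have : (fun n => (r n)%:E) @ \oo --> l%:E.
    by apply: cvg_EFin => //; exact: nearW.
  by move=> /cvg_limn_einf_sup[_ ->].
apply: complex_ext => /=; apply: lims.
  exact: (complex_cvg_Re _ h).
exact: (complex_cvg_Im _ h).
Qed.

Lemma cmeas_mxapp (u : J -> R -> R[i]) k : (forall j, cmeas (u j)) ->
  cmeas (fun x => mxapp (u ^~ x) k).
Proof.
move=> mu.
have ms A : cmeas (fun x => partial_sum (fun j => M k j * u j x) A).
  by apply: cmeas_partial_sum => j; exact: cmeasZ.
split => /=; apply: (measurableT_comp (fine_measurable measurableT));
  apply: measurable_fun_limn_esup => n; apply/measurable_EFinP.
  exact: (ms _).1.
exact: (ms _).2.
Qed.

End matrix_action.

(** * Functions on disjoint cells *)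

Lemma mem_itvoo (R : realType) (c d s : R) : (s \in `]c, d[%classic) = (c < s < d).
Proof.
apply/idP/idP => [/set_mem|h]; first by rewrite /= in_itv.
by apply/mem_set; rewrite /= in_itv.
Qed.

Section spread.
Variable R : realType.
Notation mu := (@lebesgue_measure R).
Variables (J : countType) (p : J -> R) (e : R).
Hypothesis layer_triv : trivIset setT (fun j => `]p j, p j + e[%classic).

Lemma en_cut_layer (f : R -> R[i]) : cmeas f ->
  en (cut (layer p e) f) =
  (\int[mu]_(s in `]0%R, e[) l2n (fun j => f (p j + s)%R))%E.
Proof.
move=> mf; rewrite en_cut (integral_layer layer_triv)//.
  exact: emeasurable_csq.
by move=> x; rewrite lee_fin csq_ge0.
Qed.

Lemma ae_layer (P : R -> Prop) :
  (forall j, {ae mu, forall s, 0 < s < e -> P (p j + s)}) ->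
  {ae mu, forall x, layer p e x -> P x}.
Proof.
move=> Pj; have /ae_forall_count : forall j, {ae mu, forall x,
    0 < x - p j < e -> P (p j + (x - p j))}.
  by move=> j; exact: (ae_shift (- p j) (Pj j)).
move=> /ae_imp; apply => x Px /layerP[j [s [s0 se xE]]].
by have := Px j; rewrite xE (addrC (p j) s) addrK s0 se [p j + s]addrC; apply.
Qed.

Lemma ae_cell (P : R -> Prop) j : {ae mu, forall x, P x} ->
  {ae mu, forall s, P (p j + s)}.
Proof. by move=> /(ae_shift (p j)) /ae_imp; apply => s; rewrite addrC. Qed.

Definition spread (h : J -> R -> R[i]) (x : R) : R[i] :=
  if pselect (exists j, `]p j, p j + e[%classic x) is left jx
  then h (projT1 (cid jx)) (x - p (projT1 (cid jx))) else 0.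

Lemma spread_in h j s : 0 < s < e -> spread h (p j + s) = h j s.
Proof.
move=> /andP[s0 se]; rewrite /spread; case: pselect => [jx|]; last first.
  by case; exists j => /=; rewrite in_itv/= ltrDl s0 ltrD2l.
case: (cid jx) => i /=; rewrite in_itv/= => /andP[h1 h2].
have [|||<- _] := @layer_inj _ _ _ _ layer_triv i j (p j + s - p i) s.
- by rewrite subr_gt0 h1 ltrBlDl.
- by rewrite s0.
- by rewrite addrC subrK.
by rewrite addrAC subrr add0r.
Qed.

Lemma spread_out h x : ~ layer p e x -> spread h x = 0.
Proof.
move=> nx; rewrite /spread; case: pselect => // -[j hj]; exfalso; apply: nx.
by exists j.
Qed.

Lemma spread_cell h x : layer p e x -> exists j s,
  [/\ 0 < s, s < e, x = p j + s & spread h x = h j s].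
Proof.
move=> /layerP[j [s [s0 se ->]]]; exists j, s; split=> //.
by rewrite spread_in// s0.
Qed.

Lemma cut_spread h : cut (layer p e) (spread h) = spread h.
Proof.
apply/funext => x; have [lx|lx] := pselect (layer p e x).
  by rewrite cut_in.
by rewrite cut_out// spread_out.
Qed.

Lemma spread_fun2 (G : R[i] -> R[i] -> R[i]) h g x : G 0 0 = 0 ->
  G (spread h x) (spread g x) = spread (fun j s => G (h j s) (g j s)) x.
Proof.
move=> G0; have [/layerP[j [s [s0 se ->]]]|lx] := pselect (layer p e x).
  by rewrite !spread_in ?s0.
by rewrite !spread_out.
Qed.

Lemma cmeas_spread h : (forall j, cmeas (h j)) -> cmeas (spread h).
Proof.
move=> mh.
have pre (G : R[i] -> R) (mG : forall j, measurable_fun [set: R] (fun x => G (h j x))) :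
    measurable_fun [set: R] (fun x => G (spread h x)).
  move=> _ Y mY; rewrite setTI.
  rewrite [X in measurable X](_ : _ =
    (\bigcup_j (`]p j, p j + e[%classic `&` ((fun x => G (h j (x - p j))) @^-1` Y)))
    `|` (~` layer p e `&` [set x | Y (G 0)])); last first.
    apply/seteqP; split => x /=.
      have [lx|lx] := pselect (layer p e x); last by rewrite spread_out//; right.
      have [j [s [s0 se -> ->]]] := spread_cell h lx => Yx; left.
      exists j => //; split; first by rewrite /= in_itv/= ltrDl s0 ltrD2l.
      by rewrite /= addrAC subrr add0r.
    move=> [[j _ [/=]]|[lx Y0]]; last by rewrite spread_out.
    rewrite in_itv/= => /andP[h1 h2]; rewrite -{2}(subrK (p j) x) [X in G (spread h X)]addrC.
    by rewrite spread_in// subr_gt0 h1 ltrBlDl.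
  apply: measurableU.
    apply: measurable_bigcup_count => j; apply: measurableI => //.
    rewrite -[X in measurable X]setTI.
    exact: (measurableT_comp (mG j) (@measurable_shift R (- p j))).
  apply: measurableI; first by apply: measurableC; exact: measurable_layer.
  have [Y0|Y0] := pselect (Y (G 0)).
    by rewrite (_ : [set _ | _] = setT)//; apply/seteqP; split.
  by rewrite (_ : [set _ | _] = set0)//; apply/seteqP; split.
split; first exact: (pre (@complex.Re R) (fun j => (mh j).1)).
exact: (pre (@complex.Im R) (fun j => (mh j).2)).
Qed.

Lemma en_spread h : (forall j, cmeas (h j)) ->
  en (spread h) = (\int[mu]_(s in `]0%R, e[) l2n (h^~ s))%E.
Proof.
move=> mh; rewrite -cut_spread en_cut_layer; last exact: cmeas_spread.
apply: eq_integral => s; rewrite inE/= in_itv/= => se.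
by congr l2n; apply/funext => j; rewrite spread_in.
Qed.

Lemma integral_interval_cst (c d : R) (z : \bar R) : c <= d -> (0 <= z)%E ->
  (\int[mu]_(s in `]c, d[) z = (d - c)%:E * z)%E.
Proof.
move=> cd z0; rewrite integral_cst//= lebesgue_measure_itv/= lte_fin.
case: ltP => [_|dc]; first by rewrite muleC.
have -> : d = c by apply/eqP; rewrite eq_le cd dc.
by rewrite subrr mul0e mule0.
Qed.

Lemma en_spread_step (w : J -> R[i]) (c d : R) : 0 <= c -> c <= d -> d <= e ->
  en (spread (fun j s => if c < s < d then w j else 0)) = ((d - c)%:E * l2n w)%E.
Proof.
move=> c0 cd de.
have meas j : cmeas (fun s => if c < s < d then w j else 0).
  under eq_fun do rewrite -mem_itvoo.
  by apply: cmeas_cut => //; exact: cmeas_cst.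
rewrite en_spread// -(integral_interval_cst cd (l2n_ge0 w)).
rewrite integral_mkcond [RHS]integral_mkcond; apply: eq_integral => s _.
rewrite /patch !mem_itvoo.
have [/andP[cs sd]|csd] := boolP (c < s < d).
  by rewrite (le_lt_trans c0 cs) (lt_le_trans sd de).
case: ifP => // _; rewrite /l2n esum1// => j _; by rewrite csq0.
Qed.

Lemma cmeas_spread_step (w : J -> R[i]) (c d : R) :
  cmeas (spread (fun j s => if c < s < d then w j else 0)).
Proof.
apply: cmeas_spread => j; under eq_fun do rewrite -mem_itvoo.
by apply: cmeas_cut => //; exact: cmeas_cst.
Qed.

End spread.

Section L2sum_layer.
Variable R : realType.
Notation mu := (@lebesgue_measure R).
Variables (K : countType) (q : K -> R) (e : R).
Hypothesis layer_triv : trivIset setT (fun k => `]q k, q k + e[%classic).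

Lemma en_cvg0 (T : Type) (F : set_system T) (FF : Filter F) (f : T -> R -> R[i]) :
  (forall t, en (f t) < +oo)%E ->
  (fun t => fine (en (f t))) @ F --> (0 : R) ->
  (fun t => L2norm (f t)) @ F --> 0%E.
Proof.
move=> ffin h; have -> : (fun t => L2norm (f t)) = EFin \o (fun t => Num.sqrt (fine (en (f t)))).
  apply/funext => t /=; rewrite L2normE -{1}(fineK (x := en (f t))); last first.
    by rewrite ge0_fin_numE// en_ge0.
  by rewrite /= powR12_sqrt// fine_ge0// en_ge0.
apply: cvg_EFin; first exact: nearW.
rewrite -[X in _ --> X](sqrtr0 R).
have : (Num.sqrt (fine (en (f t)))) @[t --> F] --> Num.sqrt (0 : R).
  by apply: cvg_comp h _; exact: sqrt_continuous.
by [].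
Qed.

(** Functions on disjoint cells add up in the mean to the function
    that they form together, because the squared distance is the tail of the
    convergent series of the squared norms. *)
Lemma L2sum_layer (g : R -> R[i]) (F : K -> R -> R[i]) : sqint g ->
  {ae mu, forall x, ~ layer q e x -> g x = 0} ->
  (forall k, cmeas (F k)) ->
  (forall k, {ae mu, forall x, F k x = cut `]q k, q k + e[%classic g x}) ->
  L2sum F g.
Proof.
move=> sg goff mF FE; have [mg eg] := sg.
pose G k := cut `]q k, q k + e[%classic g.
have mG k : cmeas (G k) by exact: cmeas_cut.
have enG : en g = (\esum_(k in [set: K]) en (G k))%E.
  have -> : en g = en (cut (layer q e) g).
    apply: en_ae => //; first by apply: cmeas_cut => //; exact: measurable_layer.
    apply: (ae_imp goff) => x gx; have [lx|lx] := pselect (layer q e x).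
      by rewrite cut_in.
    by rewrite cut_out// gx.
  rewrite -integral_esum//.
    apply: eq_integral => x _; have [lx|lx] := pselect (layer q e x); last first.
      rewrite cut_out// csq0 esum1// => k _; rewrite /G cut_out ?csq0// => h.
      by apply: lx; exists k.
    have [k _ kx] := lx; rewrite cut_in// (@esum_single _ _ _ k).
    - by rewrite /G cut_in.
    - by rewrite lee_fin csq_ge0.
    - move=> k' /eqP kk; rewrite /G cut_out ?csq0// => k'x.
      by apply: kk; have /trivIsetP := layer_triv; apply: contraPP => /eqP kk /(_ k' k I I kk);
        rewrite -subset0 => /(_ x); apply; split.
  - by move=> k x; rewrite lee_fin csq_ge0.
  - by move=> k; exact: emeasurable_csq.
have finG k : en (G k) \is a fin_num.
  rewrite ge0_fin_numE ?en_ge0//; apply: le_lt_trans eg.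
  exact: en_cut_le.
have key A : (en (fun x => partial_sum (F^~ x) A - g x)%R +
    (partial_sum (fun k => fine (en (G k))) A)%:E = en g)%E.
  have -> : (partial_sum (fun k => fine (en (G k))) A)%:E =
      (\int[mu]_x (\sum_(k <- A) csq (G k x))%:E)%E.
    rewrite partial_sumE -sumEFin.
    under [RHS]eq_integral do rewrite -sumEFin.
    rewrite ge0_integral_sum//.
    - by apply: eq_bigr => k _; rewrite fineK.
    - by move=> k; exact: emeasurable_csq.
    - by move=> k x _; rewrite lee_fin csq_ge0.
  have mS := cmeas_partial_sum A mF.
  have mC : measurable_fun [set: R] (fun x => \sum_(k <- A) csq (G k x)).
    by apply: measurable_sum => k; exact: measurable_csq.
  rewrite /en -ge0_integralD//.
  - apply: ge0_ae_eq_integral => //.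
    + apply: emeasurable_funD; first by apply: emeasurable_csq; exact: cmeasB.
      exact/measurable_EFinP.
    + exact: emeasurable_csq.
    + move=> x _; rewrite -EFinD lee_fin addr_ge0 ?csq_ge0// sumr_ge0// => k _.
      exact: csq_ge0.
    + by move=> x _; rewrite lee_fin csq_ge0.
    apply: ae_eq_setT; refine (ae_imp2 (ae_forall_count FE) goff _) => x Fx gx.
    rewrite -EFinD; congr (_%:E); rewrite partial_sumE.
    under eq_bigr do rewrite Fx -/(G _ x).
    have [lx|lx] := pselect (layer q e x); last first.
      have G0 k : G k x = 0 by rewrite /G cut_out// => h; apply: lx; exists k.
      rewrite gx// subr0 !big1 ?csq0 ?addr0//.
      by move=> k _; rewrite G0 csq0.
    have [k _ kx] := lx.
    have Gk : G k x = g x by rewrite /G cut_in.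
    have Gk' k' : k' != k -> G k' x = 0.
      move=> kk; rewrite /G cut_out// => k'x.
      have /trivIsetP/(_ k' k I I kk) := layer_triv.
      by rewrite -subset0 => /(_ x); apply; split.
    have [kA|kA] := boolP (k \in A).
      rewrite !(big_fsetD1 k kA)/= Gk !big_seq !big1 ?addr0 ?subrr ?csq0 ?add0r//.
        by move=> i; rewrite !inE => /andP[/Gk' -> _]; rewrite csq0.
      by move=> i; rewrite !inE => /andP[/Gk' -> _].
    rewrite !big_seq !big1 ?sub0r ?csqN ?addr0//.
      by move=> i iA; rewrite Gk' ?csq0//; apply: contraNneq kA => <-.
    by move=> i iA; rewrite Gk'//; apply: contraNneq kA => <-.
  - by move=> x _; rewrite lee_fin csq_ge0.
  - by apply: emeasurable_csq; exact: cmeasB.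
  - by move=> x _; rewrite lee_fin sumr_ge0// => k _; exact: csq_ge0.
  - exact/measurable_EFinP.
have gfin : en g \is a fin_num by rewrite ge0_fin_numE ?en_ge0.
have en_lt A : (en (fun x => partial_sum (F^~ x) A - g x)%R < +oo)%E.
  apply: le_lt_trans eg; rewrite -(key A) leeDl// lee_fin partial_sumE.
  by rewrite sumr_ge0// => k _; rewrite fine_ge0// en_ge0.
apply: en_cvg0 => //.
have := @partial_sum_cvg R K (fun k => fine (en (G k))).
rewrite (_ : (\esum_(k in _) _)%E = en g); last first.
  by rewrite enG; apply: eq_esum => k _; rewrite fineK.
move=> /(_ (fun k => fine_ge0 (en_ge0 _)) eg) h.
have FT : Filter (@totally K) by apply: filter_filter.
have /(_ FT) := cvgB (@cvg_cst _ (fine (en g)) _ (@totally K) FT) h.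
rewrite subrr; apply: cvg_trans; apply: near_eq_cvg; apply: nearW => A /=.
apply/eqP; rewrite !fctE subr_eq; apply/eqP.
by rewrite -(key A) fineD// ?ge0_fin_numE ?en_ge0.
Qed.

End L2sum_layer.

(** * The geometry of a union of long intervals *)

Section null_sets.
Variable R : realType.
Notation mu := (@lebesgue_measure R).

Lemma ae_neq_count (K : countType) (c : K -> R) :
  {ae mu, forall x, forall k, x <> c k}.
Proof.
apply: ae_forall_count => k; exists [set c k]; split => //.
  exact: lebesgue_measure_set1.
by move=> x /= /contrapT.
Qed.

Lemma ae_neq (c : R) : {ae mu, forall x, x <> c}.
Proof.
exists [set c]; split => //; first exact: lebesgue_measure_set1.
by move=> x /= /contrapT.
Qed.

Lemma Rintegral_shift t (f : R -> R) : measurable_fun [set: R] f ->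
  (\int[mu]_x f (x + t) = \int[mu]_x f x)%R.
Proof.
move=> mf; congr fine; rewrite [LHS]integralE [RHS]integralE.
have mF : measurable_fun [set: R] (EFin \o f) by exact/measurable_EFinP.
congr (_ - _)%E.
  transitivity (\int[mu]_x (EFin \o f)^\+ (x + t)%R)%E; first by apply: eq_integral => x _; rewrite ?funeposE ?funenegE.
  by rewrite (ge0_integral_shift t (measurable_funepos mF)).
transitivity (\int[mu]_x (EFin \o f)^\- (x + t)%R)%E; first by apply: eq_integral => x _; rewrite ?funeposE ?funenegE.
by rewrite (ge0_integral_shift t (measurable_funeneg mF)).
Qed.

Lemma cint_shift t (f : R -> R[i]) : cmeas f -> cint (fun x => f (x + t)) = cint f.
Proof.
move=> [m1 m2]; apply: complex_ext => /=.
  exact: (Rintegral_shift t m1).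
exact: (Rintegral_shift t m2).
Qed.

(** A relation between a function and its image under an operator follows from the
    knowledge of the adjoint operator on steps alone: here psi is the adjoint image of
    the step supported on the part between c and d of the target cell. *)
Lemma adjoint_test (f g : R -> R[i]) (u w e : R) (z : R[i]) :
  sqint f -> sqint g -> supported_on f `[w, w + e]%classic ->
  (forall c d, 0 <= c -> c < d -> d <= e -> exists psi, [/\ cmeas psi,
     cint (cut `]u + c, u + d[%classic g) = cint (fun x => f x * (psi x)^*%C) &
     {ae mu, forall s, 0 < s < e -> psi (w + s) = if c < s < d then z^*%C else 0}]) ->
  {ae mu, forall s, 0 < s < e -> g (u + s) = z * f (w + s)}.
Proof.
move=> sf sg fsupp test.
have h : {ae mu, forall x, u < x < u + e -> g x = z * f (x + (w - u))}.
  apply: interval_test => //; first by apply: sqintZ; exact: sqint_shift.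
  move=> c d uc cd de.
  have [|||psi [mpsi gpsi psiE]] := test (c - u) (d - u).
  - by rewrite subr_ge0.
  - by rewrite ltrD2r.
  - by rewrite lerBlDl.
  rewrite !(addrC u) !subrK in gpsi; rewrite gpsi.
  rewrite -(cint_shift (u - w) (f := cut _ _)); last first.
    by apply: cmeas_cut => //; apply: cmeasZ; apply: cmeas_shift; exact: sf.1.
  apply: cint_ae.
  - by apply: cmeasM; [exact: sf.1|exact: cmeasJ].
  - apply: (@cmeas_shift _ (cut _ _)); apply: cmeas_cut => //.
    by apply: cmeasZ; apply: cmeas_shift; exact: sf.1.
  refine (ae_imp2 (ae_and (ae_neq w) (ae_neq (w + e)))
    (ae_and (ae_shift (- w) psiE) fsupp) _).
  move=> x [xw xwe] [psix fx].
  have [xin|xout] := pselect (`[w, w + e]%classic x); last first.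
    rewrite fx// mul0r /cut; case: ifP => // _.
    by rewrite (_ : x + (u - w) + (w - u) = x) ?fx ?mulr0//; ring.
  move: xin; rewrite /= in_itv/= => /andP[wx xwe'].
  have xs : 0 < x - w < e by rewrite subr_gt0 ltrBlDl !lt_neqAle wx xwe' eq_sym !andbT; apply/andP; split; apply/eqP.
  have := psix xs; rewrite (addrC w) subrK => ->.
  rewrite /cut mem_itvoo (_ : (c < x + (u - w) < d) = (c - u < x - w < d - u)); last first.
    by congr (_ && _); apply/idP/idP => ?; lra.
  case: ifP => _; last by rewrite conjc0 mulr0.
  by rewrite conjcK mulrC (_ : x + (u - w) + (w - u) = x)//; ring.
have {h} := ae_shift u h; move=> /ae_imp; apply => s hs /andP[s0 se].
rewrite addrC hs; last by apply/andP; split; lra.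
by congr (z * f _); ring.
Qed.

End null_sets.

(** What the proof uses of the union of intervals: its finite left and right end
    points, the parts of length less than L next to them, and the alternative that a
    point either may be moved by t inside the union or is at distance at most t from
    an end point. The intervals themselves, bounded or not, then disappear. *)
Record layered (R : realType) (J K : Type) (O : set R) (a : J -> R) (b : K -> R)
    (L : \bar R) : Prop := Layered {
  ly_open : open O ;
  ly_left_notin : forall j, ~ O (a j) ;
  ly_right_notin : forall k, ~ O (b k) ;
  ly_left_inj : injective a ;
  ly_right_inj : injective b ;
  ly_right : forall x t, O x -> 0 <= t ->
    (forall s, 0 <= s <= t -> O (x + s)) \/ exists k, b k - t <= x < b k ;
  ly_left : forall x t, O x -> 0 <= t ->
    (forall s, 0 <= s <= t -> O (x - s)) \/ exists j, a j < x <= a j + t ;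
  ly_left_cell : forall j s, 0 < s -> (s%:E < L)%E -> O (a j + s) ;
  ly_right_cell : forall k s, 0 < s -> (s%:E < L)%E -> O (b k - s) }.

Section geometry.
Variable R : realType.
Notation mu := (@lebesgue_measure R).
Variables (J K : countType) (O : set R) (a : J -> R) (b : K -> R) (L : \bar R).
Hypothesis H : layered O a b L.

Definition path x t := forall s, 0 <= s <= t -> O (x + s).

Lemma lt_trans_L (s t : R) : s <= t -> (t%:E < L)%E -> (s%:E < L)%E.
Proof. by move=> st; apply: le_lt_trans; rewrite lee_fin. Qed.

Lemma left_triv t : (t%:E < L)%E -> trivIset setT (fun j => `]a j, a j + t[%classic).
Proof.
move=> tL; apply/trivIsetP => i j _ _ ij; rewrite -subset0 => x [] /=.
rewrite !in_itv/= => /andP[ix xi] /andP[jx xj].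
wlog ltij : i j ij ix xi jx xj / a i < a j.
  move=> wl; have [aij|aji|aij] := ltgtP (a i) (a j).
  - exact: (wl i j).
  - by apply: (wl j i) => //; rewrite eq_sym.
  - by move/eqP: ij; apply; exact: (ly_left_inj H).
apply: (ly_left_notin H (j := j)); rewrite -[a j](subrK (a i)) addrC.
apply: (ly_left_cell H); first by rewrite subr_gt0.
by apply: lt_trans_L tL; rewrite lerBlDl; apply: ltW (lt_trans jx xi).
Qed.

Lemma right_triv t : (t%:E < L)%E ->
  trivIset setT (fun k => `]b k - t, b k - t + t[%classic).
Proof.
move=> tL; apply/trivIsetP => i j _ _ ij; rewrite -subset0 => x [] /=.
rewrite !in_itv/= !subrK => /andP[ix xi] /andP[jx xj].
wlog ltij : i j ij ix xi jx xj / b i < b j.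
  move=> wl; have [aij|aji|aij] := ltgtP (b i) (b j).
  - exact: (wl i j).
  - by apply: (wl j i) => //; rewrite eq_sym.
  - by move/eqP: ij; apply; exact: (ly_right_inj H).
apply: (ly_right_notin H (k := i)); rewrite -[b i](subKr (b j)).
apply: (ly_right_cell H); first by rewrite subr_gt0.
by apply: lt_trans_L tL; rewrite lerBlDr -lerBlDl; apply: ltW (lt_trans jx xi).
Qed.

(** A function moving to the left during the time t leaves through the left layer of
    width t, and what replaces it appears in the right layer of width t. *)
Definition rlayer t := layer (fun k => b k - t) t.
Definition llayer t := layer a t.

Lemma measurable_O : measurable O.
Proof. exact: open_measurable (ly_open H). Qed.

Lemma measurable_rlayer t : measurable (rlayer t).
Proof. exact: measurable_layer. Qed.

Lemma measurable_llayer t : measurable (llayer t).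
Proof. exact: measurable_layer. Qed.

Lemma path0 x t : 0 <= t -> path x t -> O x.
Proof. by move=> t0 /(_ 0); rewrite addr0 lexx t0; apply. Qed.

Lemma path_end x t : 0 <= t -> path x t -> O (x + t).
Proof. by move=> t0; apply; rewrite t0 lexx. Qed.

Lemma path_le x s t : s <= t -> path x t -> path x s.
Proof. by move=> st pt r /andP[r0 rs]; apply: pt; rewrite r0 (le_trans rs). Qed.

Lemma path_shift x s t : 0 <= s -> path x (s + t) -> path (x + s) t.
Proof.
move=> s0 pt r /andP[r0 rt]; rewrite -addrA; apply: pt.
by rewrite addr_ge0//= lerD2l.
Qed.

Lemma llayer_O t x : (t%:E < L)%E -> llayer t x -> O x.
Proof.
move=> tL /layerP[j [s [s0 st ->]]]; apply: (ly_left_cell H) => //.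
by apply: lt_trans_L tL; exact: ltW.
Qed.

Lemma rlayerP t x : rlayer t x <-> exists k, b k - t < x < b k.
Proof.
split=> [[k _ /=]|[k hk]]; first by rewrite in_itv/= subrK; exists k.
by exists k => //=; rewrite in_itv/= subrK.
Qed.

Lemma right_cell_inj t x k m : (t%:E < L)%E -> b k - t < x < b k ->
  b m - t < x < b m -> k = m.
Proof.
move=> tL kx mx; have/trivIsetP/(_ k m I I) := right_triv tL.
apply: contraPP => /eqP km /(_ km); rewrite -subset0 => /(_ x); apply.
by split; rewrite /= in_itv/= subrK.
Qed.

Lemma rlayer_O t x : (t%:E < L)%E -> rlayer t x -> O x.
Proof.
move=> tL /rlayerP[k /andP[h1 h2]]; rewrite -[x](subKr (b k)).
apply: (ly_right_cell H); first by rewrite subr_gt0.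
by apply: lt_trans_L tL; lra.
Qed.

Lemma path_or_rlayer x t : O x -> 0 <= t ->
  [\/ path x t, rlayer t x | exists k, x = b k - t].
Proof.
move=> Ox t0; have [pt|[k /andP[h1 h2]]] := ly_right H Ox t0.
  exact: Or31.
have [xb|xb] := eqVneq (b k - t) x; first by apply: Or33; exists k.
by apply: Or32; apply/rlayerP; exists k; rewrite lt_neqAle xb h1 h2.
Qed.

Lemma path_notin_rlayer x t : path x t -> ~ rlayer t x.
Proof.
move=> pt /rlayerP[k /andP[h1 h2]]; apply: (ly_right_notin H (k := k)).
by rewrite -[b k](subrK x) addrC; apply: pt; apply/andP; split; lra.
Qed.

Lemma path_notin_llayer x t : path x t -> ~ llayer t (x + t).
Proof.
move=> pt /layerP[j [s [s0 st eqx]]]; apply: (ly_left_notin H (j := j)).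
have -> : a j = x + (t - s) by lra.
by apply: pt; apply/andP; split; lra.
Qed.

Lemma path_or_llayer y t : O y -> 0 <= t ->
  [\/ path (y - t) t, llayer t y | exists j, y = a j + t].
Proof.
move=> Oy t0; have [pt|[j /andP[h1 h2]]] := ly_left H Oy t0.
  apply: Or31 => s /andP[s0 st]; have -> : y - t + s = y - (t - s) by ring.
  by apply: pt; apply/andP; split; lra.
have [xb|xb] := eqVneq y (a j + t); first by apply: Or33; exists j.
apply: Or32; apply/layerP; exists j, (y - a j); split; last by ring.
  by rewrite subr_gt0.
by rewrite ltrBlDl lt_neqAle xb h2.
Qed.

Lemma path_left_cell j s t : 0 < s -> ((s + t)%:E < L)%E -> path (a j + s) t.
Proof.
move=> s0 st r /andP[r0 rt]; rewrite -addrA; apply: (ly_left_cell H).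
  by rewrite ltr_pwDl.
by apply: lt_trans_L st; rewrite lerD2l.
Qed.

Lemma path_right_cell k s t : 0 < s -> ((s + t)%:E < L)%E -> path (b k - (s + t)) t.
Proof.
move=> s0 st r /andP[r0 rt]; have -> : b k - (s + t) + r = b k - (s + t - r) by ring.
apply: (ly_right_cell H); first by lra.
by apply: lt_trans_L st; lra.
Qed.

(** Moving by t identifies the union without its right layer with the union
    without its left layer. *)
Lemma cut_layer_shift (f g : R -> R[i]) t : 0 <= t -> (t%:E < L)%E ->
  (forall x, ~ O x -> f x = 0) -> (forall x, ~ O x -> g x = 0) ->
  {ae mu, forall x, path x t -> g x = f (x + t)} ->
  {ae mu, forall x, cut (~` rlayer t) g x = cut (~` llayer t) f (x + t)}.
Proof.
move=> t0 tL fO gO gf.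
refine (ae_imp2 (ae_and (ae_neq_count (fun k => b k - t)) (ae_neq_count a)) gf _).
move=> x [xb xa] gfx.
have pathE : path x t -> cut (~` rlayer t) g x = cut (~` llayer t) f (x + t).
  move=> pt; rewrite !cut_in ?gfx//; first exact: path_notin_llayer.
  exact: path_notin_rlayer.
have [pt|npt] := pselect (path x t); first exact: pathE.
have -> : cut (~` rlayer t) g x = 0.
  have [Ox|/gO g0] := pselect (O x); last by rewrite /cut; case: ifP.
  have [//|lx|[k /xb//]] := path_or_rlayer Ox t0.
  by rewrite cut_out//; exact.
have [Ox|/fO f0] := pselect (O (x + t)); last by rewrite /cut; case: ifP.
have [|lx|[j /addIr /xa//]] := path_or_llayer Ox t0; first by rewrite addrK.
by rewrite cut_out//; exact.
Qed.

End geometry.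

(** * Operators that move functions, and the boundary relations *)

Section translating_operators.
Variable R : realType.
Notation mu := (@lebesgue_measure R).
Variable O : set R.
Implicit Types V : (R -> R[i]) -> (R -> R[i]).

Definition moves V t := forall f, fmem (L2 O) f ->
  {ae mu, forall x, path O x t -> V f x = f (x + t)}.

Lemma feqP f g : feq (L2 O) f g <-> {ae mu, forall x, f x = g x}.
Proof. exact: ae_eqP. Qed.

Section pointwise.
Variable V : (R -> R[i]) -> (R -> R[i]).
Hypothesis VU : unitary_operator (L2 O) (L2 O) V.

Lemma unitary_ae f g : fmem (L2 O) f -> fmem (L2 O) g ->
  {ae mu, forall x, f x = g x} -> {ae mu, forall x, V f x = V g x}.
Proof. by move=> f2 g2 /feqP fg; apply/feqP; exact: (unitary_feq VU). Qed.

Lemma unitary_aeL z f g : fmem (L2 O) f -> fmem (L2 O) g ->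
  {ae mu, forall x, V (fun x => z * f x + g x) x = z * V f x + V g x}.
Proof. by move=> f2 g2; apply/feqP; exact: (unitary_linear VU). Qed.

Lemma unitary_aeD f g : fmem (L2 O) f -> fmem (L2 O) g ->
  {ae mu, forall x, V (fun x => f x + g x) x = V f x + V g x}.
Proof.
move=> f2 g2; have := unitary_aeL 1 f2 g2.
rewrite (_ : (fun x => 1 * f x + g x) = (fun x => f x + g x)); last first.
  by apply/funext => x; rewrite mul1r.
by move=> /ae_imp; apply => x ->; rewrite mul1r.
Qed.

Lemma unitary_aeB f g : fmem (L2 O) f -> fmem (L2 O) g ->
  {ae mu, forall x, V (fun x => f x - g x) x = V f x - V g x}.
Proof.
move=> f2 g2; have := unitary_aeL (-1) g2 f2.
rewrite (_ : (fun x => -1 * g x + f x) = (fun x => f x - g x)); last first.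
  by apply/funext => x; rewrite mulN1r addrC.
by move=> /ae_imp; apply => x ->; rewrite mulN1r addrC.
Qed.

End pointwise.

Lemma unitary_en V f : unitary_operator (L2 O) (L2 O) V -> fmem (L2 O) f ->
  en (V f) = en f.
Proof.
move=> VU f2; have Vf2 := unitary_fmem VU f2.
have sVf := fmem_sqint Vf2; have sf := fmem_sqint f2.
have := congr1 (@complex.Re R) (unitary_fip VU f2 f2).
rewrite !fip_self// => vv.
rewrite -(fineK (x := en (V f))) ?vv ?fineK// ge0_fin_numE ?en_ge0//.
  exact: sf.2.
exact: sVf.2.
Qed.

Lemma moves_comp V W s t : 0 <= s -> 0 <= t ->
  unitary_operator (L2 O) (L2 O) W -> moves V s -> moves W t ->
  moves (V \o W) (s + t).
Proof.
move=> s0 t0 WU Vs Wt f f2.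
refine (ae_imp2 (Vs _ (unitary_fmem WU f2)) (ae_shift s (Wt _ f2)) _) => x h1 h2 pt.
rewrite /= h1; last by apply: path_le pt; rewrite lerDl.
by rewrite h2 ?addrA//; exact: path_shift.
Qed.

Lemma moves_inv V W t : unitary_operator (L2 O) (L2 O) W -> moves V t ->
  (forall f, fmem (L2 O) f -> {ae mu, forall x, V (W f) x = f x}) ->
  forall f, fmem (L2 O) f ->
  {ae mu, forall x, path O (x - t) t -> W f x = f (x - t)}.
Proof.
move=> WU Vt VW f f2.
refine (ae_imp2 (ae_shift (- t) (Vt _ (unitary_fmem WU f2))) (ae_shift (- t) (VW _ f2)) _).
by move=> x h1 h2 pt; rewrite -h2 h1// subrK.
Qed.

End translating_operators.

Section layer_transfer.
Variable R : realType.
Notation mu := (@lebesgue_measure R).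
Variables (J K : countType) (O : set R) (a : J -> R) (b : K -> R) (L : \bar R).
Hypothesis H : layered O a b L.
Variables (V : (R -> R[i]) -> (R -> R[i])) (t : R).
Hypotheses (t0 : 0 <= t) (tL : (t%:E < L)%E).
Hypothesis VU : unitary_operator (L2 O) (L2 O) V.
Hypothesis Vt : moves O V t.

(** V preserves the norm and only translates the rest, so that the part of the norm
    that leaves through the left layer reappears in the right one. *)
Lemma en_layer_transfer f : fmem (L2 O) f ->
  en (cut (rlayer b t) (V f)) = en (cut (llayer a t) f).
Proof.
move=> f2; have Vf2 := unitary_fmem VU f2.
have mf := fmem_cmeas f2; have mVf := fmem_cmeas Vf2.
have ml := measurable_llayer a t; have mr := measurable_rlayer b t.
have rest : en (cut (~` rlayer b t) (V f)) = en (cut (~` llayer a t) f).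
  rewrite -(en_shift t (f := cut (~` llayer a t) f)).
    apply: en_ae.
    - by apply: cmeas_cut => //; exact: measurableC.
    - by apply: (@cmeas_shift _ (cut _ _)); apply: cmeas_cut => //; exact: measurableC.
    - apply: (cut_layer_shift H) => //; last exact: Vt.
        by move=> x; exact: fmem_off f2.
      by move=> x; exact: fmem_off Vf2.
  by apply: cmeas_cut => //; exact: measurableC.
have := unitary_en VU f2.
rewrite (en_splitC mr mVf) (en_splitC ml mf) rest.
have : en (cut (~` llayer a t) f) \is a fin_num.
  rewrite ge0_fin_numE ?en_ge0//; apply: le_lt_trans (fmem_sqint f2).2.
  by apply: en_cut_le => //; exact: measurableC.
set c := en (cut (~` _) _) => cfin /(congr1 (fun z => z - c)%E).
by rewrite !addeK.
Qed.

Lemma llayer_eq0 f : fmem (L2 O) f ->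
  {ae mu, forall x, rlayer b t x -> V f x = 0} ->
  {ae mu, forall x, llayer a t x -> f x = 0}.
Proof.
move=> f2 f0; have := en_layer_transfer f2.
rewrite [LHS](_ : _ = 0%E) => [h|].
  refine (ae_imp (en_eq0 _ (esym h)) _); last by move=> x + lx; rewrite cut_in.
  apply: cmeas_cut; first exact: measurable_llayer.
  exact: fmem_cmeas f2.
have Vf2 := unitary_fmem VU f2.
rewrite -(en0 R); apply: en_ae.
- by apply: cmeas_cut; [exact: measurable_rlayer|exact: fmem_cmeas Vf2].
- exact: cmeas_cst.
- refine (ae_imp f0 _) => x fx; have [lx|lx] := pselect (rlayer b t x).
    by rewrite cut_in// fx.
  by rewrite cut_out.
Qed.

(** A point off the right layer receives its value along a path, which does not end
    in the left layer. *)
Lemma off_rlayer_eq0 f : fmem (L2 O) f ->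
  {ae mu, forall x, ~ llayer a t x -> f x = 0} ->
  {ae mu, forall x, ~ rlayer b t x -> V f x = 0}.
Proof.
move=> f2 f0; have Vf2 := unitary_fmem VU f2.
refine (ae_imp2 (ae_and (ae_neq_count (fun k => b k - t)) (Vt f2)) (ae_shift t f0) _).
move=> x [xb Vfx] fx nx; have [Ox|nOx] := pselect (O x); last exact: fmem_off Vf2 nOx.
have [pt|//|[k /xb//]] := path_or_rlayer H Ox t0.
by rewrite Vfx// fx//; exact: (path_notin_llayer H pt).
Qed.

Lemma off_llayer_eq0 f : fmem (L2 O) f ->
  {ae mu, forall x, ~ rlayer b t x -> V f x = 0} ->
  {ae mu, forall x, ~ llayer a t x -> f x = 0}.
Proof.
move=> f2 f0; have Vf2 := unitary_fmem VU f2.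
refine (ae_imp2 (ae_neq_count (fun j => a j + t))
  (ae_and (ae_shift (- t) (Vt f2)) (ae_shift (- t) f0)) _).
move=> y ya [+ fy] ny; have [Oy|nOy] := pselect (O y); last first.
  by move=> _; exact: fmem_off f2 nOy.
have [pt|//|[j /ya//]] := path_or_llayer H Oy t0.
rewrite subrK => <-//; apply: fy.
exact: (path_notin_rlayer H pt).
Qed.

End layer_transfer.

Section boundary_relations.
Variable R : realType.
Notation mu := (@lebesgue_measure R).
Variables (J K : countType) (O : set R) (a : J -> R) (b : K -> R) (L : \bar R).
Hypothesis H : layered O a b L.
Variable U : R -> (R -> R[i]) -> (R -> R[i]).
Hypothesis UG : strongly_continuous_unitary_group O U.
Hypothesis Umoves : forall t, 0 <= t -> moves O (U t) t.

Let UU t := group_unitary UG t.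

Lemma groupK t f : fmem (L2 O) f -> {ae mu, forall x, U t (U (- t) f) x = f x}.
Proof.
move=> f2; have /feqP h1 := group_add UG t (- t) f2; have /feqP h2 := group_id UG f2.
by refine (ae_imp2 h1 h2 _) => x <-; rewrite subrr.
Qed.

Lemma groupNK t f : fmem (L2 O) f -> {ae mu, forall x, U (- t) (U t f) x = f x}.
Proof. by move=> f2; have := groupK (- t) f2; rewrite opprK. Qed.

Lemma group_adjoint t f g : fmem (L2 O) f -> fmem (L2 O) g ->
  fip (L2 O) (U t f) g = fip (L2 O) f (U (- t) g).
Proof.
move=> f2 g2; have Ug := unitary_fmem (UU (- t)) g2.
have Uf := unitary_fmem (UU t) f2; have UUg := unitary_fmem (UU t) Ug.
rewrite -[RHS](unitary_fip (UU t) f2 Ug) !fipE; apply: cint_ae.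
- by apply: cmeasM; [exact: fmem_cmeas Uf|apply: cmeasJ; exact: fmem_cmeas g2].
- by apply: cmeasM; [exact: fmem_cmeas Uf|apply: cmeasJ; exact: fmem_cmeas UUg].
- by refine (ae_imp (groupK t g2) _) => x ->.
Qed.

Lemma moves_back t f : 0 <= t -> fmem (L2 O) f ->
  {ae mu, forall x, path O (x - t) t -> U (- t) f x = f (x - t)}.
Proof.
move=> t0; apply: (moves_inv (UU _) (Umoves t0)) => g; exact: groupK.
Qed.

Lemma fmem_step (u c d : R) (z : R[i]) : (forall x, c < x < d -> O (u + x)) ->
  fmem (L2 O) (cut `]u + c, u + d[%classic (fun=> z)).
Proof.
move=> cdO; apply/fmemP; split; first exact: sqint_cst_itv.
move=> x nOx; rewrite cut_out//= in_itv/= => /andP[h1 h2]; apply: nOx.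
by rewrite -[x](subrK u) addrC; apply: cdO; rewrite ltrBrDl ltrBlDl h1 h2.
Qed.

Lemma fip_step f (c d : R) : fip (L2 O) f (cut `]c, d[%classic (fun=> 1)) =
  cint (cut `]c, d[%classic f).
Proof. by rewrite fipE; congr cint; apply/funext => x; rewrite -cut_mulJ. Qed.

Variable B : J -> K -> R[i].

(** The boundary relations cell by cell: each cell of the target layer carries a
    multiple of the function on the source cell. This form, free of sums, passes to the
    adjoint and is what the evolution satisfies by construction. *)
Definition cell_relation1 := forall (e : R) (i : J) (f : R -> R[i]),
  0 < e -> (e%:E < L)%E -> fmem (L2 O) f ->
  supported_on f `[a i, a i + e]%classic ->
  forall k, {ae mu, forall s, 0 < s < e -> U e f (b k - e + s) = B i k * f (a i + s)}.

Definition cell_relation2 := forall (e : R) (k : K) (f : R -> R[i]),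
  0 < e -> (e%:E < L)%E -> fmem (L2 O) f ->
  supported_on f `[b k - e, b k]%classic ->
  forall j, {ae mu, forall s, 0 < s < e ->
    U (- e) f (a j + s) = (B j k)^*%C * f (b k - e + s)}.

(** The inverse of U e is its adjoint, and the first relation gives U e on the steps
    of a left cell. *)
Lemma cell_relation_adjoint : cell_relation1 -> cell_relation2.
Proof.
move=> rel1 e k f e0 eL f2 fsupp j; have Uf2 := unitary_fmem (UU (- e)) f2.
apply: (adjoint_test (fmem_sqint f2) (fmem_sqint Uf2)); first by rewrite subrK.
move=> c d c0 cd de; pose chi := cut `]a j + c, a j + d[%classic (fun=> 1 : R[i]).
have chi2 : fmem (L2 O) chi.
  apply: fmem_step => x /andP[cx xd]; apply: (ly_left_cell H).
    exact: le_lt_trans cx.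
  by apply: lt_trans_L eL; exact: ltW (lt_le_trans xd de).
exists (U e chi); split.
- exact: fmem_cmeas (unitary_fmem (UU e) chi2).
- by rewrite -fip_step group_adjoint// opprK fipE.
have chisupp : supported_on chi `[a j, a j + e]%classic.
  apply/aeW => x nx; rewrite /chi cut_out//= in_itv/= => /andP[h1 h2]; apply: nx.
  rewrite /= in_itv/=; apply/andP; split; lra.
refine (ae_imp (rel1 e j chi e0 eL chi2 chisupp k) _) => s + se => ->//.
rewrite conjcK /chi /cut mem_itvoo !ltrD2l.
by case: ifP => _; rewrite ?mulr1 ?mulr0.
Qed.

(** Since the cells are disjoint, the values on the cells are all that there is to
    the sum over the cells. *)
Lemma L2sum_of_cells (T : countType) (q : T -> R) (e w : R) (c : T -> R[i])
    (f g : R -> R[i]) : trivIset setT (fun k => `]q k, q k + e[%classic) ->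
  layer q e `<=` O -> cmeas f -> sqint g -> supported_on f `[w, w + e]%classic ->
  {ae mu, forall x, ~ layer q e x -> g x = 0} ->
  (forall k, {ae mu, forall s, 0 < s < e -> g (q k + s) = c k * f (w + s)}) ->
  supported_on g (\bigcup_k `[q k, q k + e]%classic) /\
  L2sum (fun k x => c k * translate O (w - q k) f x) g.
Proof.
move=> qtriv qO mf sg fsupp goff cells; split.
  refine (ae_imp goff _) => x gx nx; apply: gx => -[k _ /=]; rewrite in_itv/= => /andP[h1 h2].
  by apply: nx; exists k => //=; rewrite in_itv/= !ltW.
have mT k : cmeas (fun x => c k * translate O (w - q k) f x).
  apply: cmeasZ; apply: cmeas_cut; first exact: measurable_O H.
  exact: cmeas_shift.
apply: (L2sum_layer qtriv sg goff mT) => k.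
refine (ae_imp2 (ae_and (ae_neq (q k)) (ae_neq (q k + e)))
  (ae_and (ae_shift (- q k) (cells k)) (ae_shift (w - q k) fsupp)) _).
move=> x [x1 x2] [gx fx].
have [xk|xk] := boolP (q k < x < q k + e).
  have xk' : `]q k, q k + e[%classic x by rewrite /= in_itv.
  rewrite cut_in// /translate mem_set; last by apply: qO; exists k.
  have -> : x + (w - q k) = w + (x - q k) by ring.
  by rewrite -gx ?subr_gt0 ?ltrBlDl// addrC subrK.
rewrite cut_out; last by rewrite /= in_itv/=; exact/negP.
rewrite /translate; case: ifP => _; last by rewrite mulr0.
rewrite fx ?mulr0// => /=; rewrite in_itv/= => /andP[h1 h2].
move/negP: xk; apply; rewrite !lt_neqAle; apply/andP; split; apply/andP; split.
- by apply/eqP => /esym.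
- by lra.
- exact/eqP.
- by lra.
Qed.

Lemma supported_layer (f : R -> R[i]) (w e : R) (x : R) :
  x <> w -> x <> w + e -> (~ `[w, w + e]%classic x -> f x = 0) ->
  ~ `]w, w + e[%classic x -> f x = 0.
Proof.
move=> x1 x2 fx nx; apply: fx; rewrite /= in_itv/= => /andP[h1 h2].
apply: nx; rewrite /= in_itv/= !lt_neqAle h1 h2 !andbT eq_sym.
by apply/andP; split; exact/eqP.
Qed.

Hypothesis rel1 : cell_relation1.

Lemma boundary_relation1_of_cells (e : R) (i : J) (f : R -> R[i]) :
  0 < e -> (e%:E < L)%E -> fmem (L2 O) f ->
  supported_on f `[a i, a i + e]%classic ->
  supported_on (U e f) (\bigcup_k `[b k - e, b k]%classic) /\
  L2sum (fun k x => B i k * translate O (a i + e - b k) f x) (U e f).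
Proof.
move=> e0 eL f2 fsupp; have Uf2 := unitary_fmem (UU e) f2.
have fsupp' : {ae mu, forall x, ~ llayer a e x -> f x = 0}.
  refine (ae_imp2 (ae_and (ae_neq (a i)) (ae_neq (a i + e))) fsupp _).
  move=> x [x1 x2] fx nx; apply: (supported_layer x1 x2 fx) => xi.
  by apply: nx; exists i.
have := L2sum_of_cells (right_triv H eL) (fun x => @rlayer_O _ _ _ _ _ _ _ H e x eL)
  (fmem_cmeas f2) (fmem_sqint Uf2) fsupp
  (off_rlayer_eq0 H (ltW e0) (UU e) (Umoves (ltW e0)) f2 fsupp') (rel1 e0 eL f2 fsupp).
have cellE k : b k - e + e = b k by rewrite subrK.
have shiftE k : a i - (b k - e) = a i + e - b k by ring.
under eq_bigcupr do rewrite cellE.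
by under [X in L2sum X _]funext do under eq_fun do rewrite shiftE.
Qed.

Lemma boundary_relation2_of_cells (e : R) (k : K) (f : R -> R[i]) :
  0 < e -> (e%:E < L)%E -> fmem (L2 O) f ->
  supported_on f `[b k - e, b k]%classic ->
  supported_on (U (- e) f) (\bigcup_j `[a j, a j + e]%classic) /\
  L2sum (fun j x => (B j k)^*%C * translate O (b k - a j - e) f x) (U (- e) f).
Proof.
move=> e0 eL f2 fsupp; have Uf2 := unitary_fmem (UU (- e)) f2.
have rel2 := cell_relation_adjoint rel1 e0 eL f2 fsupp.
have fsupp2 : supported_on f `[b k - e, b k - e + e]%classic by rewrite subrK.
have fsupp' : {ae mu, forall x, ~ rlayer b e x -> U e (U (- e) f) x = 0}.
  refine (ae_imp2 (ae_and (ae_neq (b k - e)) (ae_neq (b k - e + e)))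
    (ae_and (groupK e f2) fsupp2) _).
  move=> x [x1 x2] [-> fx] nx; apply: (supported_layer x1 x2 fx) => xk.
  by apply: nx; exists k.
have := L2sum_of_cells (left_triv H eL) (fun x => @llayer_O _ _ _ _ _ _ _ H e x eL)
  (fmem_cmeas f2) (fmem_sqint Uf2) fsupp2
  (off_llayer_eq0 H (ltW e0) (UU e) (Umoves (ltW e0)) Uf2 fsupp') rel2.
have shiftE j : b k - e - a j = b k - a j - e by ring.
by under [X in L2sum X _]funext do under eq_fun do rewrite shiftE.
Qed.

End boundary_relations.

(** * Shift-invariant functions and the integrability property *)

Section shift_invariant_functions.
Variable R : realType.
Notation mu := (@lebesgue_measure R).

Lemma ae_exists (P : R -> Prop) (u v : R) : {ae mu, forall x, P x} -> u < v ->
  exists x, u < x < v /\ P x.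
Proof.
move=> [N [mN N0 PN]] uv; apply: contrapT => nP.
have sub : `]u, v[%classic `<=` N.
  move=> x /=; rewrite in_itv/= => uxv; apply: PN => /= Px; apply: nP.
  by exists x.
have : (mu `]u, v[%classic <= mu N)%E by apply: le_measure; rewrite ?inE.
by rewrite N0 lebesgue_measure_itv/= lte_fin uv -EFinD lee_fin leNgt subr_gt0 uv.
Qed.

Notation TR := (measurableTypeR R).

(** By Tonelli, since f is nonnegative. *)
Lemma ae_ae_swap (f : TR * TR -> \bar R) : measurable_fun setT f ->
  (forall z, (0 <= f z)%E) ->
  (forall y, {ae mu, forall x, f (x, y) = 0%E}) ->
  {ae mu, forall x, {ae mu, forall y, f (x, y) = 0%E}}.
Proof.
move=> mf f0 fy.
have mF := measurable_fun_fubini_tonelli_F (m2 := mu) f mf f0.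
have : (\int[mu]_x fubini_F mu f x = 0)%E.
  rewrite /fubini_F (fubini_tonelli f mf f0)/= integral0_eq// => y _.
  rewrite /fubini_G (ge0_ae_eq_integral measurableT (g := cst 0%E))//.
  - exact: integral0.
  - exact: (measurable_fun_pair1 y mf).
  - by apply: ae_eq_setT; exact: fy.
have F0 x : (0 <= fubini_F mu f x)%E by apply: integral_ge0 => y _; exact: f0.
move=> intF0.
have : (\int[mu]_x `|fubini_F mu f x| = 0)%E.
  by rewrite -[RHS]intF0; apply: eq_integral => x _; rewrite gee0_abs.
move=> /(ae_eq_integral_abs mu measurableT mF).1 /ae_imp; apply => x /(_ I) Fx.
have : (\int[mu]_y `|f (x, y)| = 0)%E.
  by rewrite -[RHS]Fx; apply: eq_integral => y _; rewrite gee0_abs.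
move=> /(ae_eq_integral_abs mu measurableT (measurable_fun_pair2 x mf)).1 /ae_imp.
by apply => y /(_ I).
Qed.

(** A measurable function on an interval that agrees almost everywhere with each
    of its translates is constant: by Tonelli almost every point sees almost all
    later points with its own value, and any two such points see a common one. *)
Lemma constant_of_shift (h : R -> R[i]) (e : R) : 0 < e -> cmeas h ->
  (forall c, 0 < c -> c < e -> {ae mu, forall s, c < s < e -> h s = h (s - c)}) ->
  exists w, {ae mu, forall s, 0 < s < e -> h s = w}.
Proof.
move=> e0 mh hc.
pose ind (x : R) : R := \1_(`]0, e[%classic) x.
have mind : measurable_fun [set: R] ind by exact: measurable_indic.
have indE x : ind x = if 0 < x < e then 1 else 0.
  by rewrite /ind indicE mem_itvoo; case: ifP.
pose f (z : TR * TR) : \bar R :=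
  (ind z.1 * ind z.2 * ind (z.1 + z.2) * csq (h (z.1 + z.2) - h z.1))%:E.
have madd : measurable_fun [set: TR * TR] (fun z : TR * TR => z.1 + z.2 : TR).
  by apply: measurable_funD; [exact: measurable_fst|exact: measurable_snd].
have mf : measurable_fun setT f.
  apply/measurable_EFinP; apply: measurable_funM.
    apply: measurable_funM; last exact: (measurableT_comp mind madd).
    apply: measurable_funM; first exact: (measurableT_comp mind measurable_fst).
    exact: (measurableT_comp mind measurable_snd).
  apply: measurable_funD; apply: measurable_funX.
    under eq_fun do rewrite ReD ReN.
    apply: measurable_funB; first exact: (measurableT_comp mh.1 madd).
    exact: (measurableT_comp mh.1 measurable_fst).
  under eq_fun do rewrite ImD ImN.
  apply: measurable_funB; first exact: (measurableT_comp mh.2 madd).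
  exact: (measurableT_comp mh.2 measurable_fst).
have f0 z : (0 <= f z)%E.
  by rewrite lee_fin !mulr_ge0 ?csq_ge0 ?indE//; case: ifP.
have fy y : {ae mu, forall x, f (x, y) = 0%E}.
  rewrite /f /=; have [/andP[y0 ye]|ny] := boolP (0 < y < e); last first.
    by apply/aeW => x; rewrite [ind y]indE (negbTE ny) mulr0 !mul0r.
  refine (ae_imp (ae_shift y (hc y y0 ye)) _) => x hx.
  rewrite [ind x]indE; case: ifP => [/andP[x0 xe]|_]; last by rewrite !mul0r.
  rewrite [ind (x + y)]indE; case: ifP => [/andP[_ xye]|_]; last by rewrite mulr0 !mul0r.
  rewrite hx ?addrK ?subrr ?csq0 ?mulr0//.
  by rewrite xye andbT ltrDr.
have good : {ae mu, forall r, 0 < r < e -> {ae mu, forall s, r < s < e -> h s = h r}}.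
  refine (ae_imp (ae_ae_swap mf f0 fy) _) => r hr /andP[r0 re].
  refine (ae_imp (ae_shift (- r) hr) _) => s; rewrite /f /= => + /andP[rs se].
  rewrite !indE (addrC r) subrK r0 re se (lt_trans r0 rs)/=.
  rewrite (_ : 0 < s - r < e); last by apply/andP; split; lra.
  by rewrite !mul1r => -[] /csq_eq0/eqP; rewrite subr_eq0 => /eqP.
have [r1 [/andP[r10 r1e] hr1]] := ae_exists good e0.
exists (h r1); have {}hr1 := hr1 _; rewrite r10 r1e in hr1.
refine (ae_imp2 (ae_and (hr1 isT) good) (ae_neq r1) _).
move=> s [h1 hs] sr1 /andP[s0 se].
have [r1s|sr|sr] := ltgtP r1 s; [by apply: h1; rewrite r1s| |by case: sr1].
have hs' := hs _; rewrite s0 se in hs'.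
have both : {ae mu, forall x, (r1 < x < e -> h x = h r1) /\ (s < x < e -> h x = h s)}.
  by refine (ae_imp2 (hr1 isT) (hs' isT) _).
have [x [/andP[rx xe] [e1 e2]]] := ae_exists both r1e.
by rewrite -e2 ?e1 ?rx// xe (lt_trans sr rx).
Qed.

End shift_invariant_functions.

Section integrability.
Variable R : realType.
Notation mu := (@lebesgue_measure R).
Variables (O : set R) (U : R -> (R -> R[i]) -> (R -> R[i])).
Hypothesis oO : open O.
Hypothesis UG : strongly_continuous_unitary_group O U.
Hypothesis UI : integrability_property O U.

(** Short moves are those on which the integrability property speaks directly, with
    all points having room around them as the neighbourhood. *)
Lemma integrability_small (e t : R) f : 0 < e -> `|t| < e -> fmem (L2 O) f ->
  {ae mu, forall x, (forall s, `|s| < 2 * e -> O (x + s)) -> U t f x = f (x + t)}.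
Proof.
move=> e0 te f2; pose V := [set y : R | forall s, `|s| < e -> O (y + s)].
have [[x0 hx0]|nx] := pselect (exists x, forall s, `|s| < 2 * e -> O (x + s)); last first.
  by apply/aeW => x hx; exfalso; apply: nx; exists x.
have sub r : `|r| < e -> `|r| < 2 * e by move=> h; apply: lt_trans h _; lra.
have VO : V `<=` O by move=> y /(_ 0); rewrite normr0 addr0; apply.
have OV : nbhs x0 V.
  apply/nbhs_ballP; exists e => //= y; rewrite /ball/= => xy s se.
  have -> : y + s = x0 + (y - x0 + s) by ring.
  apply: hx0; apply: le_lt_trans (ler_normD _ _) _.
  by rewrite distrC (_ : 2 * e = e + e) ?ltrD//; ring.
have := UI (VO _ (nbhs_singleton OV)) OV VO e0 _ te f2.
move=> h; refine (ae_imp (h _) _).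
  by move=> s y se; apply.
by move=> x hx hx'; apply: hx => s /sub /hx'.
Qed.

(** Thickened ways: the integrability property needs a neighbourhood of each point
    on the way, of a size that bounds the length of the single move. *)
Let wide (d x t : R) := forall s, - d < s -> s < t + d -> O (x + s).

Lemma integrability_iter (d e t : R) (n : nat) f : 0 < e -> 2 * e <= d ->
  0 <= t -> t < e -> fmem (L2 O) f ->
  {ae mu, forall x, wide d x (n%:R * t) -> U (n%:R * t) f x = f (x + n%:R * t)}.
Proof.
move=> e0 ed t0 te; elim: n => [|n ih] in f * => f2.
  rewrite mul0r; have /feqP h := group_id UG f2.
  by refine (ae_imp h _) => x ->; rewrite addr0.
have -> : n.+1%:R * t = t + n%:R * t by rewrite -natr1; ring.
have /feqP h := group_add UG t (n%:R * t) f2.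
have Uf2 := unitary_fmem (group_unitary UG (n%:R * t)) f2.
have ht : `|t| < e by rewrite ger0_norm.
have nt : 0 <= n%:R * t by rewrite mulr_ge0.
refine (ae_imp2 (ae_and h (integrability_small e0 ht Uf2))
  (ae_shift t (ih f f2)) _) => x [-> h1] h2 w.
rewrite h1; last first.
  by move=> s; rewrite ltr_norml => /andP[s1 s2]; apply: w; lra.
by rewrite h2 ?addrA// => s s1 s2; rewrite -addrA; apply: w; lra.
Qed.

(** Since O is open there is room at the two ends of a path, and the points between
    lie in O already: every path is wide for some width, and countably many widths
    suffice. *)
Lemma integrability_moves t : 0 <= t -> moves O (U t) t.
Proof.
move=> t0 f f2.
have /ae_foralln : forall m : nat, {ae mu, forall x, wide m.+1%:R^-1 x t -> U t f x = f (x + t)}.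
  move=> m; pose d : R := m.+1%:R^-1; have d0 : 0 < d by rewrite invr_gt0.
  pose e := d / 2; have e0 : 0 < e by rewrite divr_gt0.
  pose n := (Num.truncn (t / e)).+1.
  have n0 : (n%:R : R) != 0 by rewrite pnatr_eq0.
  have te : t / n%:R < e.
    rewrite ltr_pdivrMr ?ltr0n// mulrC -ltr_pdivrMr//.
    by rewrite /n truncnS_gt// divr_ge0// ltW.
  have E : n%:R * (t / n%:R) = t by rewrite mulrC divfK.
  have := @integrability_iter d e (t / n%:R) n f e0; rewrite E; apply => //.
    by rewrite /e; lra.
  by rewrite divr_ge0.
move=> /ae_imp; apply => x hx pt.
have ball_in y : O y -> exists m : nat, forall s, `|s| < m.+1%:R^-1 -> O (y + s).
  move=> Oy; have /nbhs_ballP[r /= r0 yr] := open_nbhs_nbhs (conj oO Oy).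
  exists (Num.truncn r^-1) => s sr; apply: yr; rewrite /ball/= opprD addNKr normrN.
  apply: lt_trans sr _; rewrite invf_plt ?posrE//.
  by rewrite truncnS_gt.
have [m1 h1] := ball_in _ (path0 t0 pt); have [m2 h2] := ball_in _ (path_end t0 pt).
have le1 m m' : (m <= m')%N -> (m'.+1%:R^-1 : R) <= m.+1%:R^-1.
  by move=> mm; rewrite lef_pV2 ?posrE// ler_nat.
apply: (hx (maxn m1 m2)) => s s1 s2.
have [s0|s0] := ltP s 0.
  apply: h1; rewrite ltr0_norm// ltrNl.
  by apply: le_lt_trans s1; rewrite lerN2 le1// leq_maxl.
have [st|ts] := leP s t; first by apply: pt; rewrite s0 st.
have -> : x + s = x + t + (s - t) by ring.
apply: h2; rewrite gtr0_norm ?subr_gt0// ltrBlDl.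
by apply: lt_le_trans s2 _; rewrite lerD2l le1// leq_maxr.
Qed.

End integrability.

(** * Boundary values of a step *)

Section boundary_matrix.
Variable R : realType.
Notation mu := (@lebesgue_measure R).
Variables (J K : countType) (O : set R) (a : J -> R) (b : K -> R) (L : \bar R).
Hypothesis H : layered O a b L.
Variable U : R -> (R -> R[i]) -> (R -> R[i]).
Hypothesis UG : strongly_continuous_unitary_group O U.
Hypothesis Umoves : forall t, 0 <= t -> moves O (U t) t.

Let UU t := group_unitary UG t.
Let mUU t f (f2 : fmem (L2 O) f) : fmem (L2 O) (U t f) := unitary_fmem (UU t) f2.

Lemma disjoint_layers s t x : 0 <= s -> 0 <= t -> ((s + t)%:E < L)%E ->
  llayer a s x -> rlayer b t x -> False.
Proof.
move=> s0 t0 stL /layerP[j [r [r0 rs ->]]] /rlayerP[k /andP[h1 h2]].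
apply: (ly_right_notin H (k := k)); rewrite -[b k](subrK (a j)) addrC.
apply: (ly_left_cell H); first by lra.
by apply: lt_trans_L stL; lra.
Qed.

Lemma llayer_nested s t j x : s <= t -> (t%:E < L)%E -> a j + s < x -> x < a j + t ->
  0 <= s -> ~ llayer a s x.
Proof.
move=> st tL jx xj s0 /layerP[i [r [r0 rs xE]]].
have [|||ij] := @layer_inj _ _ _ _ (left_triv H tL) j i (x - a j) r.
- by apply/andP; split; lra.
- by rewrite r0 (lt_le_trans rs st).
- by rewrite -xE; ring.
by lra.
Qed.

Definition rconst e (v : K -> R[i]) := spread (fun k => b k - e) e (fun k _ => v k).
Definition lconst e (w : J -> R[i]) := spread a e (fun j _ => w j).

Lemma en_rconst e v : 0 <= e -> (e%:E < L)%E -> en (rconst e v) = (e%:E * l2n v)%E.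
Proof.
move=> e0 eL; rewrite /rconst en_spread; last by move=> k; exact: cmeas_cst.
  by rewrite integral_interval_cst ?l2n_ge0// subr0.
exact: (right_triv H eL).
Qed.

Lemma en_lconst e w : 0 <= e -> (e%:E < L)%E -> en (lconst e w) = (e%:E * l2n w)%E.
Proof.
move=> e0 eL; rewrite /lconst en_spread; last by move=> k; exact: cmeas_cst.
  by rewrite integral_interval_cst ?l2n_ge0// subr0.
exact: (left_triv H eL).
Qed.

Lemma cmeas_rconst e v : (e%:E < L)%E -> cmeas (rconst e v).
Proof. by move=> eL; apply: cmeas_spread => [|k]; [exact: (right_triv H eL)|exact: cmeas_cst]. Qed.

Lemma cmeas_lconst e w : (e%:E < L)%E -> cmeas (lconst e w).
Proof. by move=> eL; apply: cmeas_spread => [|k]; [exact: (left_triv H eL)|exact: cmeas_cst]. Qed.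

Lemma fmem_rconst e v : 0 <= e -> (e%:E < L)%E -> fmem (l2 R K) v ->
  fmem (L2 O) (rconst e v).
Proof.
move=> e0 eL /l2memE v2; apply/fmemP; split.
  split; first exact: cmeas_rconst.
  by rewrite en_rconst// lte_mul_pinfty.
by move=> x nx; rewrite /rconst spread_out// => /(rlayer_O H eL).
Qed.

Lemma fmem_lconst e w : 0 <= e -> (e%:E < L)%E -> fmem (l2 R J) w ->
  fmem (L2 O) (lconst e w).
Proof.
move=> e0 eL /l2memE v2; apply/fmemP; split.
  split; first exact: cmeas_lconst.
  by rewrite en_lconst// lte_mul_pinfty.
by move=> x nx; rewrite /lconst spread_out// => /(llayer_O H eL).
Qed.

Lemma rconst_in e v k s : (e%:E < L)%E -> b k - e < s < b k -> rconst e v s = v k.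
Proof.
move=> eL ks; have -> : s = (fun k => b k - e) k + (s - (b k - e)) by rewrite /=; ring.
rewrite /rconst spread_in//; first exact: (right_triv H eL).
by case/andP: ks => *; apply/andP; split; lra.
Qed.

Lemma rconst_out e v x : ~ rlayer b e x -> rconst e v x = 0.
Proof. exact: spread_out. Qed.

Lemma lconst_in e w j s : (e%:E < L)%E -> 0 < s < e -> lconst e w (a j + s) = w j.
Proof. by move=> eL se; rewrite /lconst spread_in//; exact: (left_triv H eL). Qed.

Lemma lconst_out e w x : ~ llayer a e x -> lconst e w x = 0.
Proof. exact: spread_out. Qed.

Lemma lconst_out_cell e c w j s : 0 <= c -> c < s -> s < e -> (e%:E < L)%E ->
  lconst c w (a j + s) = 0.
Proof.
move=> c0 cs se eL; apply: lconst_out.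
by apply: (@llayer_nested c e j) => //; [exact: ltW (lt_trans cs se)|rewrite ltrD2l..].
Qed.

(** A path of length d does not start within d of a right end, so that of a step of
    width c + d it carries only the part further than d from the ends. *)
Lemma rconst_shift c d v y : 0 <= c -> 0 <= d -> ((c + d)%:E < L)%E ->
  path O (y - d) d -> rconst (c + d) v (y - d) - rconst d v (y - d) = rconst c v y.
Proof.
move=> c0 d0 cdL pt; have cL : (c%:E < L)%E by apply: lt_trans_L cdL; rewrite lerDl.
rewrite [rconst d v _]rconst_out ?subr0; last exact: (path_notin_rlayer H pt).
have [/rlayerP[k /andP[h1 h2]]|ny] := pselect (rlayer b c y).
  by rewrite !(@rconst_in _ _ k)//; apply/andP; split; lra.
rewrite [RHS]rconst_out// rconst_out// => /rlayerP[k /andP[h1 h2]].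
have [yb|yb] := ltP y (b k).
  by apply: ny; apply/rlayerP; exists k; apply/andP; split; lra.
apply: (ly_right_notin H (k := k)).
have -> : b k = y - d + (b k - (y - d)) by ring.
by apply: pt; apply/andP; split; lra.
Qed.

Section steps.
Variable v : K -> R[i].
Hypothesis v2 : fmem (l2 R K) v.

Let P e := U (- e) (rconst e v).

Let P2 e : 0 <= e -> (e%:E < L)%E -> fmem (L2 O) (P e).
Proof. by move=> e0 eL; apply: mUU; exact: fmem_rconst. Qed.

Let P_out e : 0 <= e -> (e%:E < L)%E ->
  {ae mu, forall x, ~ llayer a e x -> P e x = 0}.
Proof.
move=> e0 eL; have r2 := fmem_rconst e0 eL v2.
apply: (off_llayer_eq0 H e0 (UU e) (Umoves e0) (P2 e0 eL)).
by refine (ae_imp (groupK UG e r2) _) => x -> nx; rewrite rconst_out.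
Qed.

(** Going back by d, the part of the step within d of the right ends crosses to the
    left layer, whereas the rest has room and is translated. *)
Lemma back_rconst c d : 0 <= c -> 0 <= d -> ((c + d)%:E < L)%E ->
  {ae mu, forall x, U (- d) (rconst (c + d) v) x = rconst c v x + P d x}.
Proof.
move=> c0 d0 cdL.
have cL : (c%:E < L)%E by apply: lt_trans_L cdL; rewrite lerDl.
have dL : (d%:E < L)%E by apply: lt_trans_L cdL; rewrite lerDr.
have r2 := fmem_rconst (addr_ge0 c0 d0) cdL v2; have d2 := fmem_rconst d0 dL v2.
pose rest x := rconst (c + d) v x - rconst d v x.
have rest2 : fmem (L2 O) rest by exact: fmemB.
have rest_r : {ae mu, forall x, llayer a d x -> U (- d) rest x = 0}.
  apply: (llayer_eq0 H d0 dL (UU d) (Umoves d0) (mUU _ rest2)).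
  refine (ae_imp (groupK UG d rest2) _) => x -> /rlayerP[k /andP[h1 h2]].
  rewrite /rest !(@rconst_in _ _ k) ?subrr//; apply/andP; split; lra.
have restE : {ae mu, forall x, U (- d) rest x = rconst c v x}.
  refine (ae_imp2 (ae_and rest_r (moves_back UG Umoves d0 rest2))
    (ae_neq_count (fun j => a j + d)) _) => x [h1 h2] xa.
  have [Ox|nOx] := pselect (O x); last first.
    rewrite (fmem_off (mUU _ rest2) nOx) rconst_out// => /(rlayer_O H cL).
    by [].
  have [pt|lx|[j /xa//]] := path_or_llayer H Ox d0.
    by rewrite h2//; exact: rconst_shift.
  rewrite h1// rconst_out// => rx.
  by apply: (disjoint_layers d0 c0 _ lx rx); rewrite addrC.
refine (ae_imp2 (unitary_aeB (UU (- d)) r2 d2) restE _) => x h1 h2.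
by rewrite -h2 /rest h1 subrK.
Qed.

Let P_rec c d : 0 <= c -> 0 <= d -> ((c + d)%:E < L)%E ->
  {ae mu, forall x, P (c + d) x = P c x + U (- c) (P d) x}.
Proof.
move=> c0 d0 cdL.
have cL : (c%:E < L)%E by apply: lt_trans_L cdL; rewrite lerDl.
have dL : (d%:E < L)%E by apply: lt_trans_L cdL; rewrite lerDr.
have r2 := fmem_rconst (addr_ge0 c0 d0) cdL v2.
have c2 := fmem_rconst c0 cL v2.
have /feqP h1 := group_add UG (- c) (- d) r2.
rewrite -opprD in h1.
have h2 := unitary_ae (UU (- c)) (mUU _ r2) (fmemD c2 (P2 d0 dL)) (back_rconst c0 d0 cdL).
refine (ae_imp2 h1 (ae_and h2 (unitary_aeD (UU (- c)) c2 (P2 d0 dL))) _).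
by move=> x; rewrite /P => -> [-> ->].
Qed.

Let P_back c d : 0 <= c -> 0 <= d -> ((c + d)%:E < L)%E ->
  {ae mu, forall x, (llayer a c x -> U (- c) (P d) x = 0) /\
    (path O (x - c) c -> U (- c) (P d) x = P d (x - c))}.
Proof.
move=> c0 d0 cdL.
have cL : (c%:E < L)%E by apply: lt_trans_L cdL; rewrite lerDl.
have dL : (d%:E < L)%E by apply: lt_trans_L cdL; rewrite lerDr.
have Pd := P2 d0 dL.
refine (ae_and (llayer_eq0 H c0 cL (UU c) (Umoves c0) (mUU _ Pd) _)
  (moves_back UG Umoves c0 Pd)).
refine (ae_imp2 (groupK UG c Pd) (P_out d0 dL) _) => x -> Px rx; apply: Px => lx.
by apply: (disjoint_layers d0 c0 _ lx rx); rewrite addrC.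
Qed.

Let P_cell c d j : 0 <= c -> 0 <= d -> ((c + d)%:E < L)%E ->
  {ae mu, forall s, (0 < s < c -> P (c + d) (a j + s) = P c (a j + s)) /\
    (c < s < c + d -> P (c + d) (a j + s) = P d (a j + (s - c)))}.
Proof.
move=> c0 d0 cdL.
have cL : (c%:E < L)%E by apply: lt_trans_L cdL; rewrite lerDl.
have dL : (d%:E < L)%E by apply: lt_trans_L cdL; rewrite lerDr.
have h1 := ae_cell a j (P_rec c0 d0 cdL).
have h2 := ae_cell a j (P_back c0 d0 cdL).
have h3 := ae_cell a j (P_out c0 cL).
refine (ae_imp2 h1 (ae_and h2 h3) _) => s e1 [[e2 e3] e4].
split=> [/andP[s0 sc]|/andP[cs sd]].
  by rewrite e1 e2 ?addr0//; apply/layerP; exists j, s.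
rewrite e1 e3 ?e4 ?add0r ?addrA//.
  apply: (@llayer_nested c (c + d) j) => //; last by rewrite ltrD2l.
    by rewrite lerDl.
  by rewrite ltrD2l.
rewrite -addrA; apply: (path_left_cell H); first by rewrite subr_gt0.
by rewrite subrK; apply: lt_trans_L cdL; exact: ltW.
Qed.

(** For 0 < c < e, cutting the step of width e into two pieces in both orders shows
    that P e agrees with P (e - c) close to the left end and with its translate by c
    further away. Hence the values on a left cell are invariant under shifts. *)
Lemma back_rconst_cst e j : 0 < e -> (e%:E < L)%E ->
  exists w, {ae mu, forall s, 0 < s < e -> P e (a j + s) = w}.
Proof.
move=> e0 eL; pose h s := P e (a j + s).
apply: (@constant_of_shift R h e e0).
  rewrite /h; under eq_fun do rewrite addrC; apply: cmeas_shift.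
  exact: fmem_cmeas (P2 (ltW e0) eL).
move=> c c0 ce; have d0 : 0 < e - c by rewrite subr_gt0.
have cdE : c + (e - c) = e by ring.
have dcE : e - c + c = e by ring.
have h1 : {ae mu, forall s, (0 < s < c -> P e (a j + s) = P c (a j + s)) /\
    (c < s < e -> P e (a j + s) = P (e - c) (a j + (s - c)))}.
  by have := @P_cell c (e - c) j (ltW c0) (ltW d0); rewrite cdE; apply.
have h2 : {ae mu, forall s, (0 < s < e - c -> P e (a j + s) = P (e - c) (a j + s))}.
  have := @P_cell (e - c) c j (ltW d0) (ltW c0); rewrite dcE => /(_ eL) /ae_imp; apply.
  by move=> s [].
refine (ae_imp2 h1 (ae_shift (- c) h2) _) => s [_ e1] e2 /andP[cs se].
rewrite /h e1 ?cs// e2//; apply/andP; split; lra.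
Qed.

Lemma back_rconst_lconst e : 0 < e -> (e%:E < L)%E ->
  exists2 w, fmem (l2 R J) w & {ae mu, forall x, P e x = lconst e w x}.
Proof.
move=> e0 eL; have [w wE] := choice (fun j => back_rconst_cst j e0 eL).
have PE : {ae mu, forall x, P e x = lconst e w x}.
  have lay : {ae mu, forall x, llayer a e x -> P e x = lconst e w x}.
    apply: ae_layer => j; refine (ae_imp (wE j) _) => s hs se.
    by rewrite hs// lconst_in.
  refine (ae_imp2 lay (P_out (ltW e0) eL) _) => x h1 h2.
  by have [lx|nx] := pselect (llayer a e x); [exact: h1|rewrite h2// lconst_out].
exists w => //.
have := unitary_en (UU (- e)) (fmem_rconst (ltW e0) eL v2).
rewrite (en_ae _ _ PE); last 2 first.
- exact: fmem_cmeas (P2 (ltW e0) eL).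
- exact: cmeas_lconst.
rewrite en_lconst ?ltW// en_rconst ?ltW// => ew.
apply/l2memE; move/l2memE : v2; rewrite !ltNge; apply: contra => woo.
have := ew; rewrite (_ : l2n w = +oo%E); last by apply/eqP; rewrite eq_le leey.
rewrite gt0_muley ?lte_fin// => /esym.
case E : (l2n v) => [r| |] //.
by have := l2n_ge0 v; rewrite E.
Qed.

Lemma back_rconst_l2n e w : 0 < e -> (e%:E < L)%E ->
  {ae mu, forall x, P e x = lconst e w x} -> l2n w = l2n v.
Proof.
move=> e0 eL PE; have := unitary_en (UU (- e)) (fmem_rconst (ltW e0) eL v2).
rewrite (en_ae _ _ PE); last 2 first.
- exact: fmem_cmeas (P2 (ltW e0) eL).
- exact: cmeas_lconst.
rewrite en_lconst ?ltW// en_rconst ?ltW// => ew.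
have := congr1 (fun z => (e^-1)%:E * z)%E ew.
by rewrite !muleA -!EFinM mulVf ?gt_eqF// !mul1e.
Qed.

Lemma lconst_inj e w w' : 0 < e -> (e%:E < L)%E ->
  {ae mu, forall x, lconst e w x = lconst e w' x} -> w = w'.
Proof.
move=> e0 eL ww; apply/funext => j.
have [s [se]] := ae_exists (ae_cell a j ww) e0.
by rewrite !lconst_in.
Qed.

(** Otherwise the matrix would depend on the duration. *)
Lemma back_rconst_indep e e' w : 0 < e -> (e%:E < L)%E -> 0 < e' -> (e'%:E < L)%E ->
  {ae mu, forall x, P e x = lconst e w x} ->
  {ae mu, forall x, P e' x = lconst e' w x}.
Proof.
move=> e0 eL e'0 e'L PE.
have [w' _ PE'] := back_rconst_lconst e'0 e'L.
have small c d u u' : 0 < c -> c < d -> (d%:E < L)%E ->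
    {ae mu, forall x, P c x = lconst c u x} ->
    {ae mu, forall x, P d x = lconst d u' x} -> u = u'.
  move=> c0 cd dL Pc Pd; apply/funext => j.
  have cL := lt_trans_L (ltW cd) dL.
  have := @P_cell c (d - c) j (ltW c0); rewrite (_ : c + (d - c) = d); last by ring.
  move=> h; have {}h := h _ dL; rewrite subr_ge0 (ltW cd) in h.
  have [s [se [[e1 _] [e2 e3]]]] := ae_exists (ae_and (h isT)
    (ae_and (ae_cell a j Pc) (ae_cell a j Pd))) c0.
  case/andP: (se) => s0 sc; have := e1 se; rewrite e2 e3 !lconst_in// ?s0//=.
  exact: lt_trans cd.
suff -> : w = w' by [].
have [ee'|e'e|ee'] := ltgtP e e'.
- exact: small PE PE'.
- by apply/esym; exact: small PE' PE.
- move: PE' PE; rewrite ee' => PE' PE; apply: (lconst_inj e'0 e'L).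
  by refine (ae_imp2 PE PE' _) => x <-.
Qed.

(** Cutting the step of width e after the time c leaves the step of width e - c as
    one of the two pieces, so that its image is the difference of P e and P c. *)
Lemma back_step e c w : 0 <= c -> c <= e -> 0 < e -> (e%:E < L)%E ->
  {ae mu, forall x, P e x = lconst e w x} ->
  {ae mu, forall x, U (- e) (rconst (e - c) v) x = lconst e w x - lconst c w x}.
Proof.
move=> c0 ce e0 eL PE; have d0 : 0 <= e - c by rewrite subr_ge0.
have cL := lt_trans_L ce eL.
have dL : ((e - c)%:E < L)%E by apply: lt_trans_L eL; rewrite gerBl.
have d2 := fmem_rconst d0 dL v2.
have Pc : {ae mu, forall x, P c x = lconst c w x}.
  have [c00|c00] := eqVneq c 0; last first.
    by apply: back_rconst_indep PE => //; rewrite lt_neqAle eq_sym c00.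
  subst c; have h := P_out (lexx 0) cL.
  have out u x : ~ layer u 0 x by move=> /layerP[j [s [s0 s0']]]; move: (lt_trans s0 s0'); rewrite ltxx.
  refine (ae_imp h _) => x ->; last exact: out.
  by rewrite lconst_out//; exact: out.
have := @P_rec c (e - c) c0 d0; rewrite (_ : c + (e - c) = e); last by ring.
move=> /(_ eL) h.
have /feqP h2 := group_add UG (- c) (- (e - c)) d2.
rewrite (_ : - c + - (e - c) = - e) in h2; last by ring.
refine (ae_imp2 (ae_and h h2) (ae_and PE Pc) _).
by move=> x [h3 ->] [<- <-]; rewrite h3 addrAC subrr add0r.
Qed.

End steps.
End boundary_matrix.

(** * The boundary matrix of a group *)

Section boundary_matrix_exists.
Variable R : realType.
Notation mu := (@lebesgue_measure R).
Variables (J K : countType) (O : set R) (a : J -> R) (b : K -> R) (L : \bar R).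
Hypothesis H : layered O a b L.
Variable U : R -> (R -> R[i]) -> (R -> R[i]).
Hypothesis UG : strongly_continuous_unitary_group O U.
Hypothesis Umoves : forall t, 0 <= t -> moves O (U t) t.

Let UU t := group_unitary UG t.
Notation rconst := (rconst b).
Notation lconst := (lconst a).

Let lpart e c d (w : J -> R[i]) := spread a e (fun j s => if c < s < d then w j else 0).

Lemma lconstB_lpart e c d w : 0 <= c -> c < d -> d <= e -> (e%:E < L)%E ->
  {ae mu, forall x, lconst d w x - lconst c w x = lpart e c d w x}.
Proof.
move=> c0 cd de eL; have tr := left_triv H eL.
have dL := lt_trans_L de eL; have cL := lt_trans_L (ltW cd) dL.
refine (ae_imp2 (ae_neq_count (fun j => a j + c)) (ae_neq_count (fun j => a j + d)) _).
move=> x xc xd; have [/layerP[j [s [s0 se xE]]]|nx] := pselect (llayer a e x).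
  rewrite xE /lpart spread_in ?s0//.
  have [sc|cs|sc] := ltgtP s c.
  - by rewrite !(lconst_in H) ?s0 ?sc ?(lt_trans sc)//= subrr.
  - have [sd|ds|sd] := ltgtP s d.
    + by rewrite (lconst_in H) ?s0 ?sd// (lconst_out_cell H w j c0 cs se eL) subr0.
    + rewrite (lconst_out_cell H w j (le_trans c0 (ltW cd)) ds se eL).
      by rewrite (lconst_out_cell H w j c0 cs se eL) subr0.
    + by case: (xd j); rewrite xE sd.
  - by case: (xc j); rewrite xE sc.
have out r : r <= e -> ~ llayer a r x.
  move=> re /layerP[j [s [s0 sr xE]]]; apply: nx; apply/layerP; exists j, s.
  by split => //; exact: lt_le_trans re.
rewrite /lpart spread_out// !lconst_out ?subrr//; apply: out => //.
exact: le_trans (ltW cd) de.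
Qed.

Lemma fmem_lpart e c d w : 0 <= c -> c < d -> d <= e -> (e%:E < L)%E ->
  fmem (l2 R J) w -> fmem (L2 O) (lpart e c d w).
Proof.
move=> c0 cd de eL /l2memE w2; have tr := left_triv H eL.
apply/fmemP; split; first split.
- exact: cmeas_spread_step.
- rewrite /lpart en_spread_step//; last exact: ltW.
  by rewrite lte_mul_pinfty// lee_fin subr_ge0 ltW.
- by move=> x nx; rewrite /lpart spread_out// => /(llayer_O H eL).
Qed.

(** The product with a part of a step is proportional to the length of this part;
    its integrand being constant along the cells, polarization reduces it to the norm
    of a step. *)
Lemma fip_lpart e c d w u : 0 <= c -> c < d -> d <= e -> (e%:E < L)%E ->
  fmem (l2 R J) w -> fmem (l2 R J) u ->
  cint (fun x => lconst e w x * (lpart e c d u x)^*%C) =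
  Complex (d - c) 0 * fip (l2 R J) w u.
Proof.
move=> c0 cd de eL w2 u2; have tr := left_triv H eL.
have -> : cint (fun x => lconst e w x * (lpart e c d u x)^*%C) =
    fip (L2 O) (lpart e c d w) (lpart e c d u).
  rewrite fipE; congr cint; apply/funext => x.
  rewrite /lpart /lconst (spread_fun2 tr (G := fun x y => x * y^*%C)) ?mul0r//.
  rewrite (spread_fun2 tr (G := fun x y => x * y^*%C)) ?mul0r//.
  congr (spread _ _ _ x); apply/funext => j; apply/funext => s.
  by case: ifP => // _; rewrite conjc0 !mulr0.
have re v : fmem (l2 R J) v -> complex.Re (fip (L2 O) (lpart e c d w) (lpart e c d v)) =
    (d - c) * l2polar w v.
  move=> v2; rewrite Re_fip; [|exact: fmem_sqint (fmem_lpart c0 cd de eL w2)|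
                               exact: fmem_sqint (fmem_lpart c0 cd de eL v2)].
  rewrite (_ : (fun x => _ + _) = lpart e c d (fun j => w j + v j)); last first.
    apply/funext => x; rewrite /lpart (spread_fun2 tr (G := fun x y => x + y)) ?addr0//.
    congr (spread _ _ _ x); apply/funext => j; apply/funext => s.
    by case: ifP => // _; rewrite addr0.
  rewrite /lpart !en_spread_step//; [|exact: ltW..].
  rewrite !fineM// ?l2n_fin//; last exact: l2memD.
  by rewrite /l2polar /=; field.
have im : complex.Im (fip (L2 O) (lpart e c d w) (lpart e c d u)) =
    (d - c) * l2polar w (fun k => 'i%C * u k).
  rewrite Im_fip -re; last exact: l2memZ.
  congr (complex.Re (fip _ _ _)); apply/funext => x.
  rewrite /lpart; have [/layerP[j [s [s0 se ->]]]|nx] := pselect (llayer a e x).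
    by rewrite !spread_in ?s0//; case: ifP => // _; rewrite mulr0.
  by rewrite !spread_out// mulr0.
rewrite l2fipE//; apply: complex_ext.
  by rewrite re// ReM /= mul0r subr0.
by rewrite im ImM /= mul0r addr0.
Qed.

(** In this form the group is known on the step, by the study of the steps that
    reach up to the right ends. *)
Lemma rcell_step e c d k : 0 <= c -> c < d -> d <= e -> (e%:E < L)%E ->
  {ae mu, forall x, cut `]b k - e + c, b k - e + d[%classic (fun=> 1) x =
    rconst (e - c) (l2e R k) x - rconst (e - d) (l2e R k) x}.
Proof.
move=> c0 cd de eL.
have ecL : ((e - c)%:E < L)%E by apply: lt_trans_L eL; rewrite gerBl.
have edL : ((e - d)%:E < L)%E.
  by apply: lt_trans_L eL; rewrite gerBl; exact: le_trans (ltW cd).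
refine (ae_imp (ae_neq_count (fun k => b k - e + d)) _) => x xd.
have [[m /andP[m1 m2]]|nx] := pselect (exists m, b m - (e - c) < x < b m).
  rewrite (rconst_in H _ (k := m))//; last by rewrite m1.
  have [xm|xm] := ltP (b m - (e - d)) x.
    rewrite (rconst_in H _ (k := m))// ?xm// subrr cut_out//= in_itv/= => /andP[h1 h2].
    have mk : m = k by apply: (right_cell_inj H (t := e) (x := x)) => //; lra.
    by move: h2; rewrite -mk; lra.
  rewrite [rconst (e - d) _ _]rconst_out ?subr0; last first.
    move=> /rlayerP[n /andP[n1 n2]].
    have mn : m = n by apply: (right_cell_inj H (t := e) (x := x)) => //; lra.
    by move: n1; rewrite -mn; lra.
  rewrite /l2e; case: eqVneq => [<-|mk].
    rewrite cut_in//= in_itv/=; apply/andP; split; first by lra.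
    rewrite lt_neqAle; apply/andP; split; first exact/eqP.
    by lra.
  rewrite cut_out//= in_itv/= => /andP[h1 h2].
  by move/eqP: mk; apply; apply: (right_cell_inj H (t := e) (x := x)) => //; lra.
rewrite !rconst_out ?subrr.
- rewrite cut_out//= in_itv/= => /andP[h1 h2]; apply: nx; exists k.
  by apply/andP; split; lra.
- move=> /rlayerP[m /andP[m1 m2]]; apply: nx; exists m.
  by apply/andP; split; lra.
- move=> /rlayerP[m /andP[m1 m2]]; apply: nx; exists m.
  by apply/andP; split; lra.
Qed.

Lemma fmem_rcell e c d k : 0 <= c -> c < d -> d <= e -> (e%:E < L)%E ->
  fmem (L2 O) (cut `]b k - e + c, b k - e + d[%classic (fun=> 1)).
Proof.
move=> c0 cd de eL; apply: fmem_step => x /andP[cx xd].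
rewrite (_ : b k - e + x = b k - (e - x)); last by ring.
apply: (ly_right_cell H); first by lra.
by apply: lt_trans_L eL; lra.
Qed.

Section fixed_width.
Variable e0 : R.
Hypotheses (e0_gt0 : 0 < e0) (e0L : (e0%:E < L)%E).

Let col v : exists w, fmem (l2 R K) v -> fmem (l2 R J) w /\
  {ae mu, forall x, U (- e0) (rconst e0 v) x = lconst e0 w x}.
Proof.
have [v2|nv] := pselect (fmem (l2 R K) v); last by exists (fun=> 0).
have [w w2 wE] := back_rconst_lconst H UG Umoves v2 e0_gt0 e0L.
by exists w.
Qed.

(** The left boundary values of the state with right boundary values v. This
    turns out to be multiplication by the entrywise conjugate of the boundary matrix:
    the group is run backwards here. *)
Definition leftvec v := projT1 (cid (col v)).

Lemma leftvec_l2 v : fmem (l2 R K) v -> fmem (l2 R J) (leftvec v).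
Proof. by move=> v2; rewrite /leftvec; case: cid => w /= /(_ v2)[]. Qed.

Lemma leftvecE v : fmem (l2 R K) v ->
  {ae mu, forall x, U (- e0) (rconst e0 v) x = lconst e0 (leftvec v) x}.
Proof. by move=> v2; rewrite /leftvec; case: cid => w /= /(_ v2)[]. Qed.

Lemma leftvec_unique v w : fmem (l2 R K) v ->
  {ae mu, forall x, U (- e0) (rconst e0 v) x = lconst e0 w x} -> leftvec v = w.
Proof.
move=> v2 vw; apply: (lconst_inj H e0_gt0 e0L).
by refine (ae_imp2 (leftvecE v2) vw _) => x <-.
Qed.

Lemma leftvec_l2n v : fmem (l2 R K) v -> l2n (leftvec v) = l2n v.
Proof.
by move=> v2; exact: (back_rconst_l2n H UG v2 e0_gt0 e0L (leftvecE v2)).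
Qed.

Lemma leftvec_lin z v v' : fmem (l2 R K) v -> fmem (l2 R K) v' ->
  leftvec (fun k => z * v k + v' k) = (fun j => z * leftvec v j + leftvec v' j).
Proof.
move=> v2 v2'; apply: leftvec_unique; first exact: l2mem_lin.
have r2 := fmem_rconst H (ltW e0_gt0) e0L v2.
have r2' := fmem_rconst H (ltW e0_gt0) e0L v2'.
have := unitary_aeL (UU (- e0)) z r2 r2'.
rewrite (_ : (fun x => z * rconst e0 v x + _) = rconst e0 (fun k => z * v k + v' k)).
  move=> h; refine (ae_imp2 h (ae_and (leftvecE v2) (leftvecE v2')) _).
  move=> x -> [-> ->]; rewrite /lconst.
  by rewrite (spread_fun2 (left_triv H e0L) (G := fun x y => z * x + y)) ?mulr0 ?addr0.
apply/funext => x.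
by rewrite (spread_fun2 (right_triv H e0L) (G := fun x y => z * x + y)) ?mulr0 ?addr0.
Qed.

Lemma leftvec_width e v : 0 < e -> (e%:E < L)%E -> fmem (l2 R K) v ->
  {ae mu, forall x, U (- e) (rconst e v) x = lconst e (leftvec v) x}.
Proof.
move=> e0' eL v2.
exact: (back_rconst_indep H UG Umoves v2 e0_gt0 e0L e0' eL (leftvecE v2)).
Qed.

Lemma back_rcell e c d k : 0 <= c -> c < d -> d <= e -> (e%:E < L)%E ->
  {ae mu, forall x, U (- e) (cut `]b k - e + c, b k - e + d[%classic (fun=> 1)) x =
    lpart e c d (leftvec (l2e R k)) x}.
Proof.
move=> c0 cd de eL; have ek := l2mem_e R k.
have egt0 : 0 < e by apply: lt_le_trans de; exact: le_lt_trans cd.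
have ecL : ((e - c)%:E < L)%E by apply: lt_trans_L eL; rewrite gerBl.
have edL : ((e - d)%:E < L)%E.
  by apply: lt_trans_L eL; rewrite gerBl; exact: le_trans (ltW cd).
have r2 : fmem (L2 O) (rconst (e - c) (l2e R k)).
  by apply: (fmem_rconst H) => //; rewrite subr_ge0; exact: le_trans (ltW cd) de.
have r2' : fmem (L2 O) (rconst (e - d) (l2e R k)).
  by apply: (fmem_rconst H) => //; rewrite subr_ge0.
have h1 := unitary_ae (UU (- e)) (fmem_rcell k c0 cd de eL) (fmemB r2 r2') (rcell_step k c0 cd de eL).
have h2 := unitary_aeB (UU (- e)) r2 r2'.
have W := leftvec_width egt0 eL ek.
have h3 := back_step H UG Umoves ek c0 (le_trans (ltW cd) de) egt0 eL W.
have h4 := back_step H UG Umoves ek (le_trans c0 (ltW cd)) de egt0 eL W.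
have h5 := lconstB_lpart (leftvec (l2e R k)) c0 cd de eL.
refine (ae_imp2 (ae_and h1 h2)
  (ae_and (ae_and h3 h4) h5) _).
by move=> x [-> ->] [[-> ->] <-]; rewrite opprB addrC addrA subrK.
Qed.

(** The right boundary values of a forward step at the left ends are
    constant because their integral over a part of a cell is a multiple of its length. *)
Lemma leftvec_onto w : fmem (l2 R J) w -> exists2 v, fmem (l2 R K) v & leftvec v = w.
Proof.
move=> w2; have f2 := fmem_lconst H (ltW e0_gt0) e0L w2.
pose g := U e0 (lconst e0 w); have g2 : fmem (L2 O) g := unitary_fmem (UU e0) f2.
pose v k := fip (l2 R J) w (leftvec (l2e R k)).
have cell k : {ae mu, forall x, b k - e0 < x < b k -> g x = v k}.
  have : {ae mu, forall x, b k - e0 < x < b k ->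
      g x = cut `]b k - e0, b k[%classic (fun=> v k) x}.
    apply: interval_test; [exact: fmem_sqint g2|exact: sqint_cst_itv|].
    move=> c d bc cd db.
    have c0 : 0 <= c - (b k - e0) by rewrite subr_ge0.
    have cd' : c - (b k - e0) < d - (b k - e0) by rewrite ltrD2r.
    have de : d - (b k - e0) <= e0 by lra.
    have ek2 := leftvec_l2 (l2mem_e R k).
    have back := back_rcell k c0 cd' de e0L.
    have chi2 := fmem_rcell k c0 cd' de e0L.
    rewrite !(addrC (b k - e0)) !subrK in back chi2.
    rewrite -(fip_step O) (group_adjoint UG)// fipE.
    have lp2 := fmem_lpart c0 cd' de e0L ek2.
    rewrite (cint_ae (g := fun x => lconst e0 w x *
      (lpart e0 (c - (b k - e0)) (d - (b k - e0)) (leftvec (l2e R k)) x)^*%C)).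
    - rewrite fip_lpart// -/(v k).
      have -> : cut `]c, d[%classic (cut `]b k - e0, b k[%classic (fun=> v k)) =
          cut `]c, d[%classic (fun=> v k).
        apply/funext => x; rewrite /cut; case: ifP => //; rewrite mem_itvoo => /andP[cx xd].
        by rewrite mem_itvoo (le_lt_trans bc cx) (lt_le_trans xd db).
      rewrite /cint (_ : d - (b k - e0) - (c - (b k - e0)) = d - c); last by ring.
      have cst (r : R) : (\int[mu]_x (if x \in `]c, d[%classic then r else 0))%R = (d - c) * r.
        rewrite -[LHS]/(\int[mu]_x ((cst r) \_ `]c, d[%classic) x)%R -Rintegral_mkcond.
        rewrite Rintegral_cst//= lebesgue_measure_itv/= lte_fin cd /=.
        by rewrite mulrC.
      apply: complex_ext => /=.
        rewrite ReM /= mul0r subr0 -cst; congr fine; apply: eq_integral => x _.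
        by rewrite /cut; case: ifP.
      rewrite ImM /= mul0r addr0 -cst; congr fine; apply: eq_integral => x _.
      by rewrite /cut; case: ifP.
    - by apply: cmeasM; [exact: fmem_cmeas f2|apply: cmeasJ; exact: fmem_cmeas (unitary_fmem (UU _) chi2)].
    - by apply: cmeasM; [exact: fmem_cmeas f2|apply: cmeasJ; exact: fmem_cmeas lp2].
    - by refine (ae_imp back _) => x ->.
  move=> /ae_imp; apply => x h xb.
  have xb' : `]b k - e0, b k[%classic x by rewrite /= in_itv.
  by rewrite h// cut_in.
have gE : {ae mu, forall x, g x = rconst e0 v x}.
  have goff : {ae mu, forall x, ~ rlayer b e0 x -> g x = 0}.
    apply: (off_rlayer_eq0 H (ltW e0_gt0) (UU e0) (Umoves (ltW e0_gt0)) f2).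
    by apply/aeW => x nx; rewrite lconst_out.
  refine (ae_imp2 (ae_forall_count cell) goff _) => x h1 h2.
  have [/rlayerP[k hk]|nx] := pselect (rlayer b e0 x).
    by rewrite (h1 k)// (rconst_in H _ (k := k)).
  by rewrite h2// rconst_out.
have v2 : fmem (l2 R K) v.
  apply/l2memE; have := (fmem_sqint g2).2.
  rewrite (en_ae (fmem_cmeas g2) (cmeas_rconst H v e0L) gE) (en_rconst H)//; last exact: ltW.
  case E : (l2n v) => [r| |] // h; first by rewrite ltry.
  by move: h; rewrite gt0_muley ?lte_fin.
exists v => //; apply: leftvec_unique => //.
have r2 := fmem_rconst H (ltW e0_gt0) e0L v2.
refine (ae_imp2 (unitary_ae (UU (- e0)) g2 r2 gE) (groupNK UG e0 f2) _) => x <-.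
exact.
Qed.

(* The conjugations undo the one in leftvec, whose matrix is the conjugate one. *)
Let V (v : K -> R[i]) : J -> R[i] := fun j => (leftvec (fun k => (v k)^*%C) j)^*%C.

Lemma boundary_unitary : unitary_operator (l2 R K) (l2 R J) V.
Proof.
have Vm v : fmem (l2 R K) v -> fmem (l2 R J) (V v).
  by move=> v2; apply: l2memJ; apply: leftvec_l2; exact: l2memJ.
have Vl z v w : fmem (l2 R K) v -> fmem (l2 R K) w ->
    V (fun k => z * v k + w k) = (fun j => z * V v j + V w j).
  move=> v2 w2; apply/funext => j; rewrite /V.
  rewrite (_ : (fun k => (z * v k + w k)^*%C) = (fun k => z^*%C * (v k)^*%C + (w k)^*%C)).
    by rewrite leftvec_lin; [rewrite rmorphD rmorphM/= conjcK|exact: l2memJ..].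
  by apply/funext => k; rewrite rmorphD rmorphM.
have Vn v : fmem (l2 R K) v -> l2n (V v) = l2n v.
  by move=> v2; rewrite /V l2nJ leftvec_l2n ?l2nJ//; exact: l2memJ.
split => //.
- by move=> f g _ _ /= ->.
- exact: l2_isometry_fip.
- move=> h h2; have [v v2 vh] := leftvec_onto (l2memJ h2).
  exists (fun k => (v k)^*%C); first exact: l2memJ.
  rewrite /= /V; apply/funext => j.
  rewrite (_ : (fun k => _) = v); first by rewrite vh conjcK.
  by apply/funext => k; rewrite conjcK.
Qed.

Definition boundary_coef (j : J) (k : K) : R[i] := V (l2e R k) j.

Lemma leftvec_e j k : leftvec (l2e R k) j = (boundary_coef j k)^*%C.
Proof.
rewrite /boundary_coef /V conjcK; congr (leftvec _ j); apply/funext => m.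
by rewrite /l2e; case: ifP => _; rewrite ?conjc0 ?conjc1.
Qed.

Lemma boundary_coef_unitary : unitary_matrix boundary_coef.
Proof.
exists V; split; first exact: boundary_unitary.
by move=> v v2 j; exact: (unitary_row_cvg boundary_unitary).
Qed.

Lemma boundary_coef_cells : cell_relation1 O a b L U boundary_coef.
Proof.
move=> e i f egt0 eL f2 fsupp k; have Uf2 := unitary_fmem (UU e) f2.
apply: (adjoint_test (fmem_sqint f2) (fmem_sqint Uf2)) => //.
move=> c d c0 cd de; have chi2 := fmem_rcell k c0 cd de eL.
exists (U (- e) (cut `]b k - e + c, b k - e + d[%classic (fun=> 1))); split.
- exact: fmem_cmeas (unitary_fmem (UU _) chi2).
- by rewrite -(fip_step O) (group_adjoint UG)// fipE.
refine (ae_imp (ae_cell a i (back_rcell k c0 cd de eL)) _) => s -> se.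
by rewrite /lpart (spread_in (left_triv H eL))// leftvec_e.
Qed.

End fixed_width.

End boundary_matrix_exists.

(** * Transfer through the end points *)

(** Measurability in a parameter lets Phi act on the functions over a layer, by acting
    at each distance from the ends; isometry has to hold for vectors of l2 only, as
    almost all of the stacked vectors are. *)
Record l2_transfer (R : realType) (J K : countType)
    (Phi : (J -> R[i]) -> (K -> R[i])) : Prop := L2Transfer {
  transfer_l2n : forall u, fmem (l2 R J) u -> l2n (Phi u) = l2n u ;
  transfer_lin : forall z u w, fmem (l2 R J) u -> fmem (l2 R J) w ->
    Phi (fun j => z * u j + w j) = (fun k => z * Phi u k + Phi w k) ;
  transfer_meas : forall u : J -> R -> R[i], (forall j, cmeas (u j)) ->
    forall k, cmeas (fun s => Phi (u^~ s) k) }.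

Section matrix_transfer.
Variables (R : realType) (J K : countType) (B : J -> K -> R[i]).
Variable V : (K -> R[i]) -> (J -> R[i]).
Hypothesis VU : unitary_operator (l2 R K) (l2 R J) V.
Hypothesis VB : forall v, fmem (l2 R K) v -> forall j,
  partial_sum (fun k => B j k * v k : R[i]^o) @ totally --> (V v j : R[i]^o).

(** Boundary values are transported by the transpose of B, whose inverse is the
    entrywise conjugate of B. *)
Definition mxtr : (J -> R[i]) -> (K -> R[i]) := mxapp (fun k j => B j k).
Definition mxconj : (K -> R[i]) -> (J -> R[i]) := mxapp (fun j k => (B j k)^*%C).

Lemma partial_sumJ (T : choiceType) (F : T -> R[i]) (z : R[i]) :
  partial_sum (F : T -> R[i]^o) @ totally --> (z : R[i]^o) ->
  partial_sum (fun k => (F k)^*%C : R[i]^o) @ totally --> (z^*%C : R[i]^o).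
Proof.
move=> h; have FT : Filter (@totally T) by apply: filter_filter.
have E A : partial_sum (fun k => (F k)^*%C) A = (partial_sum F A)^*%C.
  by rewrite !partial_sumE rmorph_sum.
apply: complex_cvg.
  rewrite ReJ; under eq_fun do rewrite E ReJ.
  exact: complex_cvg_Re h.
rewrite ImJ; under eq_fun do rewrite E ImJ.
by apply: cvgN; exact: complex_cvg_Im h.
Qed.

Lemma mxconjE x : fmem (l2 R K) x -> mxconj x = fun j => (V (fun k => (x k)^*%C) j)^*%C.
Proof.
move=> x2; apply/funext => j; apply: mxapp_cvg.
have := partial_sumJ (@VB _ (l2memJ x2) j).
rewrite (_ : (fun k => (B j k * (x k)^*%C)^*%C) = (fun k => (B j k)^*%C * x k))//.
by apply/funext => k; rewrite rmorphM/= conjcK.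
Qed.

Lemma mxtrE v : fmem (l2 R K) v -> mxtr (fun j => (V v j)^*%C) = fun k => (v k)^*%C.
Proof.
move=> v2; apply/funext => k; apply: mxapp_cvg.
have := unitary_col_cvg VU (k := k) v2.
rewrite (_ : (fun j => V (l2e R k) j * (V v j)^*%C) = (fun j => B j k * (V v j)^*%C))//.
by apply/funext => j; rewrite (unitary_matrix_col VB).
Qed.

Lemma mxtr_preimage u : fmem (l2 R J) u -> exists v,
  [/\ fmem (l2 R K) v, u = (fun j => (V v j)^*%C) & mxtr u = fun k => (v k)^*%C].
Proof.
move=> u2; have [v v2 Vv] := unitary_onto VU (l2memJ u2).
have uE : u = fun j => (V v j)^*%C by rewrite Vv; apply/funext => j; rewrite conjcK.
by exists v; split => //; rewrite {1}uE mxtrE.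
Qed.

Lemma mxconjK x : fmem (l2 R K) x -> mxtr (mxconj x) = x.
Proof.
move=> x2; rewrite mxconjE// mxtrE; last exact: l2memJ.
by apply/funext => k; rewrite conjcK.
Qed.

Lemma V_lin z v w : fmem (l2 R K) v -> fmem (l2 R K) w ->
  V (fun k => z * v k + w k) = fun j => z * V v j + V w j.
Proof. exact: (unitary_linear VU). Qed.

Lemma mxtr_transfer : l2_transfer mxtr.
Proof.
split.
- move=> u u2; have [v [v2 uE ->]] := mxtr_preimage u2.
  by rewrite l2nJ {1}uE l2nJ (unitary_l2n VU).
- move=> z u w u2 w2; have [v [v2 uE ->]] := mxtr_preimage u2.
  have [x [x2 wE ->]] := mxtr_preimage w2.
  have -> : (fun j => z * u j + w j) = fun j => (V (fun k => z^*%C * v k + x k) j)^*%C.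
    by rewrite V_lin// uE wE; apply/funext => j; rewrite rmorphD rmorphM/= conjcK.
  rewrite mxtrE; last exact: l2mem_lin.
  by apply/funext => k; rewrite rmorphD rmorphM/= conjcK.
- by move=> u mu k; exact: cmeas_mxapp.
Qed.

Lemma mxconj_transfer : l2_transfer mxconj.
Proof.
split.
- move=> x x2; rewrite mxconjE// l2nJ (unitary_l2n VU) ?l2nJ//.
  exact: l2memJ.
- move=> z x w x2 w2; rewrite !mxconjE//; last exact: l2mem_lin.
  apply/funext => j.
  rewrite (_ : (fun k => (z * x k + w k)^*%C) = (fun k => z^*%C * (x k)^*%C + (w k)^*%C)).
    by rewrite V_lin; [rewrite rmorphD rmorphM/= conjcK|exact: l2memJ..].
  by apply/funext => k; rewrite rmorphD rmorphM.
- by move=> u mu k; exact: cmeas_mxapp.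
Qed.

Lemma mxtr_single i z k : mxtr (fun j => if j == i then z else 0) k = B i k * z.
Proof.
apply: mxapp_cvg.
have := @partial_sum_single R J (fun j => B j k * (if j == i then z else 0)) i.
by rewrite eqxx; apply => j /negbTE ->; rewrite mulr0.
Qed.

End matrix_transfer.

Section L2_isometry.
Variables (R : realType) (O : set R).
Notation mu := (@lebesgue_measure R).
Variable V : (R -> R[i]) -> (R -> R[i]).
Hypothesis Vmem : forall f, fmem (L2 O) f -> fmem (L2 O) (V f).
Hypothesis Vae : forall f g, fmem (L2 O) f -> fmem (L2 O) g ->
  {ae mu, forall x, f x = g x} -> {ae mu, forall x, V f x = V g x}.
Hypothesis Vlin : forall z f g, fmem (L2 O) f -> fmem (L2 O) g ->
  {ae mu, forall x, V (fun x => z * f x + g x) x = z * V f x + V g x}.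
Hypothesis Ven : forall f, fmem (L2 O) f -> en (V f) = en f.

Lemma isometry_fip f g : fmem (L2 O) f -> fmem (L2 O) g ->
  fip (L2 O) (V f) (V g) = fip (L2 O) f g.
Proof.
move=> f2 g2.
have z2 : fmem (L2 O) (fun=> 0).
  apply/fmemP; split => //; split; first exact: cmeas_cst.
  by rewrite en0.
have re h : fmem (L2 O) h ->
    complex.Re (fip (L2 O) (V f) (V h)) = complex.Re (fip (L2 O) f h).
  move=> h2; rewrite !Re_fip; [|exact: fmem_sqint f2|exact: fmem_sqint h2|
    exact: fmem_sqint (Vmem f2)|exact: fmem_sqint (Vmem h2)].
  rewrite !Ven//; congr ((fine _ - _ - _) / 2).
  have fh2 := fmem_lin 1 f2 h2.
  rewrite (en_ae (g := V (fun x => 1 * f x + h x))).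
  - rewrite Ven//; congr en; apply/funext => x; by rewrite mul1r.
  - by apply: cmeasD; [exact: fmem_cmeas (Vmem f2)|exact: fmem_cmeas (Vmem h2)].
  - exact: fmem_cmeas (Vmem fh2).
  - by refine (ae_imp (Vlin 1 f2 h2) _) => x ->; rewrite mul1r.
apply: complex_ext; first exact: re.
have ig2 := fmem_lin 'i%C g2 z2.
have igE : (fun x => 'i%C * g x + 0) = (fun x => 'i%C * g x).
  by apply/funext => x; rewrite addr0.
rewrite !Im_fip -[in RHS]igE -re//.
have V0 : {ae mu, forall x, V (fun=> 0) x = 0}.
  apply: en_eq0; first exact: fmem_cmeas (Vmem z2).
  by rewrite Ven// en0.
rewrite !fipE; congr (complex.Re _); apply: cint_ae.
- apply: cmeasM; first exact: fmem_cmeas (Vmem f2).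
  by apply: cmeasJ; apply: cmeasZ; exact: fmem_cmeas (Vmem g2).
- apply: cmeasM; first exact: fmem_cmeas (Vmem f2).
  by apply: cmeasJ; exact: fmem_cmeas (Vmem ig2).
- by refine (ae_imp2 (Vlin 'i%C g2 z2) V0 _) => x -> ->; rewrite addr0.
Qed.

Lemma isometry_unitary :
  (forall h, fmem (L2 O) h -> exists2 f, fmem (L2 O) f & {ae mu, forall x, V f x = h x}) ->
  unitary_operator (L2 O) (L2 O) V.
Proof.
move=> Vonto; split => //.
- by move=> f g f2 g2 /feqP fg; apply/feqP; exact: Vae.
- by move=> z f g f2 g2; apply/feqP; exact: Vlin.
- exact: isometry_fip.
- by move=> h h2; have [f f2 fh] := Vonto h h2; exists f => //; exact/feqP.
Qed.

End L2_isometry.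

Section transfer_operator.
Variable R : realType.
Notation mu := (@lebesgue_measure R).
Variables (J K : countType) (O : set R) (p : J -> R) (q : K -> R) (t d : R).
Hypothesis mO : measurable O.
Hypothesis ptriv : trivIset setT (fun j => `]p j, p j + t[%classic).
Hypothesis qtriv : trivIset setT (fun k => `]q k, q k + t[%classic).
Hypothesis qO : layer q t `<=` O.
Hypothesis rest : {ae mu, forall x, (O x /\ ~ layer q t x) <->
  (O (x + d) /\ ~ layer p t (x + d))}.
Variable Phi : (J -> R[i]) -> (K -> R[i]).
Hypothesis PhiT : l2_transfer Phi.

(** The common form of the evolution and of its inverse: translation by d away from
    the layers, and Phi from the layer at p to the layer at q. *)
Definition transfer_op (f : R -> R[i]) (x : R) : R[i] :=
  if x \in layer q t then spread q t (fun k s => Phi (fun j => f (p j + s)) k) x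
  else cut O (fun y => f (y + d)) x.

Lemma transfer_op_layer f k s : 0 < s < t ->
  transfer_op f (q k + s) = Phi (fun j => f (p j + s)) k.
Proof.
move=> /andP[s0 st]; rewrite /transfer_op mem_set; last exact: layer_in.
by rewrite spread_in// s0.
Qed.

Lemma transfer_op_rest f x : ~ layer q t x -> O x -> transfer_op f x = f (x + d).
Proof. by move=> nx Ox; rewrite /transfer_op memNset// cut_in. Qed.

Lemma transfer_op_out f x : ~ O x -> transfer_op f x = 0.
Proof.
by move=> nO; rewrite /transfer_op memNset ?cut_out// => /qO.
Qed.

Lemma cmeas_transfer_op f : cmeas f -> cmeas (transfer_op f).
Proof.
move=> mf; apply: cmeas_if; first exact: measurable_layer.
  apply: cmeas_spread => // k; apply: (transfer_meas PhiT) => j.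
  by under eq_fun do rewrite addrC; exact: cmeas_shift.
by apply: cmeas_cut => //; exact: cmeas_shift.
Qed.

Let stack (f : R -> R[i]) s := fun j => f (p j + s).

(** The squared norms of the stacked vectors have a finite integral. *)
Lemma stack_l2 f : sqint f -> {ae mu, forall s, 0 < s < t -> fmem (l2 R J) (stack f s)}.
Proof.
move=> [mf ef].
have mst : measurable_fun `]0, t[%classic (fun s => l2n (stack f s)).
  apply: measurable_esum => [j s|j]; first by rewrite lee_fin csq_ge0.
  apply: (emeasurable_csq (f := fun s => f (p j + s))).
  by under eq_fun do rewrite addrC; exact: cmeas_shift.
have int : mu.-integrable `]0, t[%classic (fun s => l2n (stack f s)).
  apply/integrableP; split => //.
  under eq_integral do rewrite gee0_abs ?l2n_ge0//.
  rewrite -(en_cut_layer ptriv)//; apply: le_lt_trans ef.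
  by apply: en_cut_le => //; exact: measurable_layer.
have : {ae mu, forall s, `]0, t[%classic s -> l2n (stack f s) \is a fin_num}.
  by apply: integrable_ae int.
move=> /ae_imp; apply => s h st; apply/l2memE.
have : l2n (stack f s) \is a fin_num by apply: h; rewrite /= in_itv.
by rewrite ge0_fin_numE// l2n_ge0.
Qed.

Lemma en_transfer_op f : fmem (L2 O) f -> en (transfer_op f) = en f.
Proof.
move=> f2; have mf := fmem_cmeas f2; have sf := fmem_sqint f2.
have mq := measurable_layer q t; have mp := measurable_layer p t.
rewrite (en_splitC mq (cmeas_transfer_op mf)) (en_splitC mp mf); congr (_ + _)%E.
  rewrite !en_cut_layer//; last exact: cmeas_transfer_op.
  apply: ge0_ae_eq_integral => //.
  - apply: measurable_esum => [j s|j]; first by rewrite lee_fin csq_ge0.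
    apply: (emeasurable_csq (f := fun s => transfer_op f (q j + s))).
    under eq_fun do rewrite addrC; apply: cmeas_shift.
    exact: cmeas_transfer_op.
  - apply: measurable_esum => [j s|j]; first by rewrite lee_fin csq_ge0.
    apply: (emeasurable_csq (f := fun s => f (p j + s))).
    by under eq_fun do rewrite addrC; exact: cmeas_shift.
  - by move=> s _; exact: l2n_ge0.
  - by move=> s _; exact: l2n_ge0.
  - move: (stack_l2 sf) => /ae_imp; apply => s h; rewrite /= in_itv/= => st.
    rewrite -[RHS](transfer_l2n PhiT (h st)); congr l2n; apply/funext => k.
    by rewrite transfer_op_layer.
rewrite -(en_shift d (f := cut (~` layer p t) f)); last first.
  by apply: cmeas_cut => //; exact: measurableC.
apply: en_ae.
- by apply: cmeas_cut; [exact: measurableC|exact: cmeas_transfer_op].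
- by apply: (@cmeas_shift _ (cut _ _)); apply: cmeas_cut => //; exact: measurableC.
refine (ae_imp rest _) => x [h1 h2].
have [[Ox nx]|nOx] := pselect (O x /\ ~ layer q t x).
  have [_ px] := h1 (conj Ox nx).
  by rewrite cut_in// cut_in// transfer_op_rest.
have nOx' : ~ (O (x + d) /\ ~ layer p t (x + d)) by move=> /h2.
have -> : cut (~` layer q t) (transfer_op f) x = 0.
  have [lx|lx] := pselect (layer q t x); first by rewrite cut_out//; exact.
  by rewrite cut_in// transfer_op_out// => Ox; exact: nOx.
have [lx|lx] := pselect (layer p t (x + d)); first by rewrite cut_out//; exact.
by rewrite cut_in// (fmem_off f2)// => Ox; exact: nOx'.
Qed.

Lemma fmem_transfer_op f : fmem (L2 O) f -> fmem (L2 O) (transfer_op f).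
Proof.
move=> f2; apply/fmemP; split; last by move=> x; exact: transfer_op_out.
split; first by apply: cmeas_transfer_op; exact: fmem_cmeas f2.
by rewrite en_transfer_op//; exact: (fmem_sqint f2).2.
Qed.

Lemma ae_transfer_op f g : cmeas f -> cmeas g -> {ae mu, forall x, f x = g x} ->
  {ae mu, forall x, transfer_op f x = transfer_op g x}.
Proof.
move=> mf mg fg.
have lay : {ae mu, forall x, layer q t x -> transfer_op f x = transfer_op g x}.
  apply: ae_layer => k.
  have /ae_forall_count : forall j, {ae mu, forall s, f (p j + s) = g (p j + s)}.
    by move=> j; exact: (ae_cell p j fg).
  move=> /ae_imp; apply => s h st; rewrite !transfer_op_layer//.
  by congr (Phi _ k); apply/funext => j.
refine (ae_imp2 lay (ae_shift d fg) _) => x h1 h2.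
have [lx|lx] := pselect (layer q t x); first exact: h1.
rewrite /transfer_op memNset// /cut.
by rewrite h2.
Qed.

Lemma lin_transfer_op z f g : fmem (L2 O) f -> fmem (L2 O) g ->
  {ae mu, forall x, transfer_op (fun x => z * f x + g x) x =
    z * transfer_op f x + transfer_op g x}.
Proof.
move=> f2 g2.
have lay : {ae mu, forall x, layer q t x -> transfer_op (fun x => z * f x + g x) x =
    z * transfer_op f x + transfer_op g x}.
  apply: ae_layer => k.
  refine (ae_imp2 (stack_l2 (fmem_sqint f2)) (stack_l2 (fmem_sqint g2)) _) => s h1 h2 st.
  by rewrite !transfer_op_layer// (transfer_lin PhiT z (h1 st) (h2 st)).
refine (ae_imp lay _) => x h1.
have [lx|lx] := pselect (layer q t x); first exact: h1.
rewrite /transfer_op memNset// /cut; case: ifP => // _.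
by rewrite mulr0 addr0.
Qed.

End transfer_operator.

Section transfer_inverse.
Variable R : realType.
Notation mu := (@lebesgue_measure R).
Variables (J K : countType) (O : set R) (p : J -> R) (q : K -> R) (t d : R).
Hypothesis mO : measurable O.
Hypothesis ptriv : trivIset setT (fun j => `]p j, p j + t[%classic).
Hypothesis qtriv : trivIset setT (fun k => `]q k, q k + t[%classic).
Hypothesis pO : layer p t `<=` O.
Hypothesis rest : {ae mu, forall x, (O x /\ ~ layer p t x) <->
  (O (x - d) /\ ~ layer q t (x - d))}.
Variables (Phi : (J -> R[i]) -> (K -> R[i])) (Psi : (K -> R[i]) -> (J -> R[i])).
Hypothesis PhiK : forall u, fmem (l2 R J) u -> Psi (Phi u) = u.

Lemma transfer_opK f : fmem (L2 O) f ->
  {ae mu, forall x, transfer_op O q p t (- d) Psi (transfer_op O p q t d Phi f) x = f x}.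
Proof.
move=> f2; set g := transfer_op O p q t d Phi f.
have lay : {ae mu, forall x, layer p t x -> transfer_op O q p t (- d) Psi g x = f x}.
  apply: ae_layer => j.
  refine (ae_imp (stack_l2 ptriv (fmem_sqint f2)) _) => s h st.
  rewrite transfer_op_layer// -[RHS](congr1 (@^~ j) (PhiK (h st))).
  by congr (Psi _ j); apply/funext => k; rewrite /g transfer_op_layer.
refine (ae_imp2 lay rest _) => x h1 [h2 _].
have [lx|lx] := pselect (layer p t x); first exact: h1.
have [Ox|nOx] := pselect (O x); last first.
  by rewrite transfer_op_out// (fmem_off f2).
have [Oy ny] := h2 (conj Ox lx).
by rewrite transfer_op_rest// /g transfer_op_rest// subrK.
Qed.

End transfer_inverse.

(** * Extension of a local one-parameter semigroup *)

Lemma max0B (R : realDomainType) (x : R) : x = Num.max x 0 - Num.max (- x) 0.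
Proof.
have [x0|] := boolP (0 <= x); last rewrite -ltNge => x0.
  by rewrite max_l// max_r ?oppr_le0// subr0.
by rewrite max_r ?(ltW x0)// max_l ?oppr_ge0 ?(ltW x0)// opprK add0r.
Qed.

(** A local one-parameter semigroup of invertible elements extends to a
    one-parameter group; everything is up to an equivalence, since operators on
    representatives compose up to almost everywhere equality. *)
Section one_parameter_extension.
Variables (R : realType) (M : Type) (eqv : M -> M -> Prop).
Context {eqvE : RelationClasses.Equivalence eqv}.
Variables (mul : M -> M -> M) (one : M).
Context {mulP : Morphisms.Proper
  (Morphisms.respectful eqv (Morphisms.respectful eqv eqv)) mul}.
Local Notation "x == y" := (eqv x y) : type_scope.
Local Open Scope type_scope.
Local Notation "x * y" := (mul x y).
Hypothesis mulA : forall x y z, x * (y * z) == (x * y) * z.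
Hypothesis mul1 : forall x, one * x == x.
Hypothesis mulx1 : forall x, x * one == x.
Variable inv : M -> M.
Hypothesis mulV : forall x, x * inv x == one.
Hypothesis mulVx : forall x, inv x * x == one.
Variables (S : R -> M) (e : R).
Hypothesis e0 : (0 < e)%R.
Hypothesis S0 : S 0 == one.
Hypothesis SD : forall s t : R, (0 <= s)%R -> (0 <= t)%R -> (s + t <= e)%R ->
  S s * S t == S (s + t)%R.

Let E := S e.

Fixpoint mpow (x : M) (n : nat) : M := if n is n'.+1 then x * mpow x n' else one.

Lemma mpowD x m n : mpow x m * mpow x n == mpow x (m + n)%N.
Proof.
elim: m => [|m ih] /=; first by rewrite mul1; reflexivity.
by rewrite -mulA ih; reflexivity.
Qed.

Lemma mpow_comm x y n : x * y == y * x -> mpow x n * y == y * mpow x n.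
Proof.
move=> xy; elim: n => [|n ih] /=; first by rewrite mul1 mulx1; reflexivity.
by rewrite -mulA ih mulA xy -mulA; reflexivity.
Qed.

Lemma local_comm r : (0 <= r)%R -> (r <= e)%R -> E * S r == S r * E.
Proof.
move=> r0 re.
have er : E == S r * S (e - r)%R.
  by rewrite SD ?subr_ge0//; [rewrite addrC subrK; reflexivity|rewrite addrC subrK].
have re' : E == S (e - r)%R * S r.
  by rewrite SD ?subr_ge0 ?subrK//; reflexivity.
by transitivity (S r * S (e - r)%R * S r); [rewrite er|rewrite re' mulA]; reflexivity.
Qed.

(* Number of units e in t, and the rest. *)
Let n_ (t : R) := Num.truncn (t / e)%R.
Let r_ (t : R) : R := (t - (n_ t)%:R * e)%R.
Let P t := S (r_ t) * mpow E (n_ t).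

Let nr (t : R) : (0 <= t)%R -> (0 <= r_ t)%R /\ (r_ t < e)%R.
Proof.
move=> t0; have /andP[h1 h2] := truncn_itv (divr_ge0 t0 (ltW e0)).
move: h1 h2; rewrite ler_pdivlMr// ltr_pdivrMr// -/(n_ t) -natr1 /r_ => h1 h2.
by split; lra.
Qed.

Let n_eq (t r : R) n : (0 <= r)%R -> (r < e)%R -> t = (r + n%:R * e)%R -> n_ t = n /\ r_ t = r.
Proof.
move=> r0 re tE.
have nE : n_ t = n.
  apply: truncn_def; apply/andP; split.
    by rewrite ler_pdivlMr// tE; lra.
  by rewrite ltr_pdivrMr// tE -natr1; lra.
by split => //; rewrite /r_ nE tE; ring.
Qed.

Lemma semigroup_local t : (0 <= t)%R -> (t <= e)%R -> P t == S t.
Proof.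
move=> t0 te; have [teq|tne] := eqVneq t e.
  have [n1 r1] : n_ t = 1%N /\ r_ t = 0%R by apply: n_eq => //; rewrite teq; ring.
  by rewrite /P n1 r1 S0 mul1 /= mulx1 teq; reflexivity.
have [n1 r1] : n_ t = 0%N /\ r_ t = t.
  by apply: n_eq => //; [rewrite lt_neqAle tne|ring].
by rewrite /P n1 r1 /= mulx1; reflexivity.
Qed.

(** When the rests of s and t add up to more than e, one unit S e splits off from the
    product of their values, and it commutes with the values at all shorter times. *)
Lemma semigroupD s t : (0 <= s)%R -> (0 <= t)%R -> P s * P t == P (s + t)%R.
Proof.
move=> s0 t0; have [rs0 rse] := nr s0; have [rt0 rte] := nr t0.
have sE : s = (r_ s + (n_ s)%:R * e)%R by rewrite /r_; ring.
have tE : t = (r_ t + (n_ t)%:R * e)%R by rewrite /r_; ring.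
have prod : P s * P t == S (r_ s) * S (r_ t) * mpow E (n_ s + n_ t)%N.
  rewrite /P -mulA [mpow E (n_ s) * _]mulA.
  rewrite (mpow_comm (n_ s) (local_comm rt0 (ltW rte))) -!mulA mpowD.
  reflexivity.
rewrite prod; have [small|big] := ltP (r_ s + r_ t)%R e.
  have [n1 r1] : n_ (s + t)%R = (n_ s + n_ t)%N /\ r_ (s + t)%R = (r_ s + r_ t)%R.
    by apply: n_eq => //; [exact: addr_ge0|rewrite {1}sE {1}tE natrD; ring].
  by rewrite (SD rs0 rt0 (ltW small)) /P n1 r1; reflexivity.
pose w := (r_ s + r_ t - e)%R.
have [n1 r1] : n_ (s + t)%R = (n_ s + n_ t).+1 /\ r_ (s + t)%R = w.
  apply: n_eq; [by rewrite /w subr_ge0|by rewrite /w; lra|].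
  by rewrite {1}sE {1}tE /w -natr1 natrD; ring.
have w0 : (0 <= w)%R by rewrite /w subr_ge0.
have we : (w <= e)%R by rewrite /w; lra.
have rtE : S (r_ t) == S (e - r_ s)%R * S w.
  rewrite SD// ?subr_ge0 ?(ltW rse)//; last by rewrite /w; lra.
  by rewrite (_ : (e - r_ s + w = r_ t)%R); [reflexivity|rewrite /w; ring].
have rsE : S (r_ s) * S (e - r_ s)%R == E.
  rewrite SD// ?subr_ge0 ?(ltW rse)//; last by rewrite addrC subrK.
  by rewrite addrC subrK; reflexivity.
rewrite rtE mulA rsE (local_comm w0 we) /P n1 r1 /= -mulA.
reflexivity.
Qed.

Definition one_parameter (t : R) : M := P (Num.max t 0) * inv (P (Num.max (- t) 0)).

Lemma one_parameter_local t : (0 <= t)%R -> (t <= e)%R -> one_parameter t == S t.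
Proof.
move=> t0 te; rewrite /one_parameter max_l// max_r ?oppr_le0//.
have z : P 0 == one by rewrite semigroup_local// ?ltW// S0; reflexivity.
have -> : inv (P 0) == one by rewrite -[inv _]mul1 -{1}z mulV; reflexivity.
by rewrite mulx1 semigroup_local//; reflexivity.
Qed.

Lemma one_parameter_diff u v : (0 <= u)%R -> (0 <= v)%R ->
  one_parameter (u - v)%R * P v == P u.
Proof.
move=> u0 v0; rewrite /one_parameter opprB.
have [uv|vu] := leP u v.
  rewrite max_r ?subr_le0// max_l ?subr_ge0//.
  have {2}-> : v = (v - u + u)%R by ring.
  rewrite -semigroupD// ?subr_ge0// -mulA [inv _ * _]mulA mulVx mul1 semigroupD//.
  by rewrite add0r; reflexivity.
rewrite max_l ?subr_ge0 ?(ltW vu)// max_r ?subr_le0 ?(ltW vu)//.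
have z : P 0 == one by rewrite semigroup_local// ?ltW// S0; reflexivity.
have -> : inv (P 0) == one by rewrite -[inv _]mul1 -{1}z mulV; reflexivity.
rewrite mulx1 semigroupD ?subr_ge0 ?(ltW vu)//.
by rewrite subrK; reflexivity.
Qed.

Lemma mul_cancel x y z : x * z == y * z -> x == y.
Proof.
by move=> h; rewrite -[x]mulx1 -[y]mulx1 -(mulV z) !mulA h; reflexivity.
Qed.

Lemma one_parameterD s t : one_parameter (s + t)%R == one_parameter s * one_parameter t.
Proof.
pose a := Num.max s 0; pose b := Num.max (- s) 0.
pose c := Num.max t 0; pose d := Num.max (- t) 0.
have [a0 b0 c0 d0] : [/\ 0 <= a, 0 <= b, 0 <= c & 0 <= d]%R.
  by rewrite !le_max lexx !orbT.
have sE : s = (a - b)%R := max0B s; have tE : t = (c - d)%R := max0B t.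
apply: (@mul_cancel _ _ (P (b + d)%R)).
have {1}-> : (s + t = (a + c) - (b + d))%R by rewrite sE tE; ring.
rewrite one_parameter_diff ?addr_ge0//.
rewrite [(b + d)%R]addrC -(semigroupD d0 b0) -mulA [one_parameter t * _]mulA tE.
rewrite one_parameter_diff// semigroupD// [(c + b)%R]addrC -(semigroupD b0 c0) mulA sE.
rewrite one_parameter_diff// semigroupD//.
reflexivity.
Qed.

Lemma one_parameter0 : one_parameter 0 == one.
Proof. by rewrite one_parameter_local// ?ltW//; exact: S0. Qed.

End one_parameter_extension.

(** * Continuity of translations in the mean *)

Section small_integrals.
Variable R : realType.
Notation mu := (@lebesgue_measure R).

Lemma mem_itvcc (c d s : R) : (s \in `[c, d]%classic) = (c <= s <= d).
Proof.
apply/idP/idP => [/set_mem|h]; first by rewrite /= in_itv.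
by apply/mem_set; rewrite /= in_itv.
Qed.

(** The parameter t is real: dominated convergence is applied to a sequence of
    counterexamples tending to 0. *)
Lemma small_integral (G : R -> R -> R) (g : R -> R) :
  (forall t, measurable_fun [set: R] (G t)) ->
  (forall t x, `|t| < 1 -> 0 <= G t x <= g x) ->
  mu.-integrable setT (EFin \o g) ->
  {ae mu, forall x, forall e : R, 0 < e -> exists2 d : R, 0 < d &
    forall t, `|t| < d -> G t x < e} ->
  forall e : R, 0 < e -> exists2 d : R, 0 < d &
    forall t, `|t| < d -> (\int[mu]_x (G t x)%:E < e%:E)%E.
Proof.
move=> mG Gg intg G0 e e0; apply: contrapT => nd.
have ex (n : nat) : exists t : R, `|t| < n.+1%:R^-1 /\ (e%:E <= \int[mu]_x (G t x)%:E)%E.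
  apply: contrapT => nt; apply: nd; exists n.+1%:R^-1; first by rewrite invr_gt0.
  by move=> t tn; rewrite ltNge; apply/negP => et; apply: nt; exists t.
have [t tP] := choice ex.
have t1 n : `|t n| < 1.
  by apply: lt_le_trans (tP n).1 _; rewrite invf_le1// ler1n.
have harm (d : R) : 0 < d -> \forall n \near \oo, `|t n| < d.
  move=> d0; exists (Num.truncn d^-1) => // n /= dn.
  apply: lt_trans (tP n).1 _; rewrite invf_plt ?posrE//.
  by apply: lt_le_trans (truncnS_gt _) _; rewrite ler_nat.
have [] := @dominated_convergence _ _ R mu setT measurableT
  (fun n x => (G (t n) x)%:E) (cst 0%E) (EFin \o g).
- by move=> n; apply/measurable_EFinP; exact: mG.
- exact: measurable_cst.
- refine (ae_imp G0 _) => x h _.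
  suff hG : (fun n => G (t n) x) @ \oo --> (0 : R).
    by apply: cvg_EFin => //; exact: nearW.
  apply/cvgrPdist_lt => r r0; have [d d0 hd] := h _ r0.
  near=> n; rewrite sub0r normrN /= ger0_norm.
    by apply: hd; near: n; exact: harm.
  by have /andP[] := Gg (t n) x (t1 n).
- exact: intg.
- apply/aeW => x n _ /=; rewrite lee_fin; have /andP[h1 h2] := Gg (t n) x (t1 n).
  by rewrite ger0_norm.
move=> _ _; rewrite integral0 => /fine_cvgP[fin /cvgrPdist_lt/(_ e e0) lt].
have [N _ hN] := fin; have [N' _ hN'] := lt.
have := hN (maxn N N') (leq_maxl _ _); have := hN' (maxn N N') (leq_maxr _ _).
rewrite /= sub0r normrN; set m := maxn _ _; have := (tP m).2.
case: (\int[mu]_x _)%E => [r| |]//=.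
rewrite lee_fin => er /(le_lt_trans (ler_norm _)) re _.
by move: (le_lt_trans er re); rewrite ltxx.
Unshelve. all: by end_near. Qed.

Lemma en_cut_small (A : R -> set R) (f : R -> R[i]) : sqint f ->
  (forall t, measurable (A t)) ->
  (forall x, exists2 s : R, 0 < s & forall t, 0 < t < s -> ~ A t x) ->
  forall e : R, 0 < e -> exists2 d : R, 0 < d &
    forall t, 0 < t < d -> (en (cut (A t) f) < e%:E)%E.
Proof.
move=> sf mA sA e e0.
pose G (t x : R) : R := if 0 < t then csq (cut (A t) f x) else 0.
have [||||d d0 hd] := @small_integral G (fun x => csq (f x)) _ _ _ _ e e0.
- move=> t; rewrite /G; case: (0 < t); last exact: measurable_cst.
  by apply: measurable_csq; apply: cmeas_cut => //; exact: sf.1.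
- move=> t x _; rewrite /G; case: ifP => _; last by rewrite lexx csq_ge0.
  by rewrite csq_ge0/= /cut; case: ifP => // _; rewrite csq0 csq_ge0.
- exact: integrable_csq.
- apply/aeW => x r r0; have [s s0 hs] := sA x; exists s => // t ts.
  rewrite /G; case: ifP => // t0; rewrite cut_out ?csq0//; apply: hs.
  by rewrite t0 -[t]gtr0_norm.
exists d => // t /andP[t0 td].
have := hd t; rewrite gtr0_norm// => /(_ td).
by under eq_integral do rewrite /G t0.
Qed.

(** Translations are continuous in the mean for integrable functions: up to a small
    error k is a continuous function g cut off outside of an interval, and for g cut off
    dominated convergence applies. *)
Lemma L1_shift (k : R -> R) : (forall x, 0 <= k x) ->
  mu.-integrable setT (EFin \o k) ->
  forall e : R, 0 < e -> exists2 d : R, 0 < d &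
    forall t, `|t| < d -> (\int[mu]_x `|k (x + t) - k x|%:E < e%:E)%E.
Proof.
move=> k0 intk e e0.
have mk : measurable_fun [set: R] k by case/integrableP : intk => /measurable_EFinP.
have e9 : 0 < e / 9 by rewrite divr_gt0.
have [M M0 hM] : exists2 M : R, 0 < M &
    (\int[mu]_x (if `|x| <= M then 0 else k x)%:E < (e / 9)%:E)%E.
  pose G (t x : R) : R := if (t != 0) && (`|t|^-1 < `|x|) then k x else 0.
  have mG t : measurable_fun [set: R] (G t).
    rewrite /G; case: (t != 0) => /=; last exact: measurable_cst.
    apply: measurable_fun_ifT => //.
    by apply: measurable_fun_ltr; [exact: measurable_cst|exact: normr_measurable].
  have [||d d0 hd] := @small_integral G k mG _ intk _ _ e9.
  - by move=> t x _; rewrite /G; case: ifP => _; rewrite ?k0 lexx ?k0.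
  - apply/aeW => x r r0; exists (`|x| + 1)^-1; first by rewrite invr_gt0 ltr_wpDl.
    move=> t tx; rewrite /G; case: ifP => // /andP[tn0 h].
    have t0 : 0 < `|t| by rewrite normr_gt0.
    exfalso; move: tx; rewrite ltNge => /negP; apply.
    rewrite -[leRHS]invrK lef_pV2 ?posrE ?invr_gt0 ?ltr_wpDl//.
    by rewrite (le_trans (ltW h))// lerDl.
  exists (d / 2)^-1; first by rewrite invr_gt0 divr_gt0.
  have d20 : 0 < d / 2 by rewrite divr_gt0.
  have := hd (d / 2); rewrite gtr0_norm// => /(_ _); rewrite gtr_pMr// invf_lt1 ?ltr1n// => /(_ isT).
  under [X in (X < _)%E -> _]eq_integral do rewrite /G gt_eqF//= gtr0_norm//.
  by under [X in _ -> (X < _)%E]eq_integral do rewrite leNgt if_neg.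
pose E := `[- M, M]%classic : set R.
have mE : measurable E by exact: measurable_itv.
have Efin : (mu E < +oo)%E.
  by rewrite lebesgue_measure_itv/=; case: ifP => // _; rewrite -EFinB ltry.
have intkE : mu.-integrable E (EFin \o k) by apply: integrableS intk.
have [g_ [cg intg gk]] := approximation_continuous_integrable mE Efin intkE.
have [n hn] : exists n, (\int[mu]_(z in E) `|(k z - g_ n z)%:E| < (e / 9)%:E)%E.
  have /fine_cvgP[fin /cvgrPdist_lt/(_ _ e9) lt] := gk.
  have [N _ hN] := fin; have [N' _ hN'] := lt; exists (maxn N N').
  have := hN (maxn N N') (leq_maxl _ _); have := hN' (maxn N N') (leq_maxr _ _).
  rewrite /= sub0r normrN; case: (\int[mu]_(z in E) _)%E => [r| |]//=.
  by rewrite lte_fin => /(le_lt_trans (ler_norm _)).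
pose g := g_ n; pose h x := if x \in E then g x else 0.
have cgn : continuous g := cg n.
have mg : measurable_fun [set: R] g by exact: continuous_measurable_fun.
have mh : measurable_fun [set: R] h.
  apply: measurable_fun_ifT => //; apply: (@measurable_fun_bool _ _ _ _ true).
  by rewrite setTI (_ : _ @^-1` _ = E)//; apply/seteqP; split => x /= => [/set_mem|/mem_set].
have [C hC] : exists C, forall x, `|h x| <= C.
  have : compact (g @` E).
    apply: continuous_compact; last exact: segment_compact.
    exact: continuous_subspaceT.
  move=> /compact_bounded[C [_ hC]]; exists (`|C| + 1) => x; rewrite /h.
  case: ifP => [xE|_]; last by rewrite normr0 addr_ge0.
  apply: (hC (`|C| + 1)); first by rewrite ltr_pwDr// ler_norm.
  by exists x => //; exact: set_mem.
have C0 : 0 <= C by apply: le_trans (hC 0).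
have kh : (\int[mu]_x `|k x - h x|%:E < (e / 9 + e / 9)%:E)%E.
  have -> : (\int[mu]_x `|k x - h x|%:E =
     \int[mu]_x (if `|x| <= M then 0 else k x)%:E + \int[mu]_(z in E) `|(k z - g z)%:E|)%E.
    rewrite [X in (_ + X)%E]integral_mkcond -ge0_integralD//.
    - apply: eq_integral => x _; rewrite /patch /h.
      rewrite (_ : (x \in E) = (`|x| <= M)); last first.
        by rewrite ler_norml mem_itvcc.
      case: ifP => _; first by rewrite add0e.
      by rewrite subr0 adde0 ger0_norm.
    - by move=> x _; rewrite lee_fin; case: ifP.
    - apply/measurable_EFinP; apply: measurable_fun_ifT => //.
      by apply: measurable_fun_ler => //; exact: normr_measurable.
    - by move=> x _; rewrite /patch; case: ifP.
    - apply/(measurable_restrictT _ _).1 => //; apply: measurable_funTS.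
      by apply: measurableT_comp => //; apply/measurable_EFinP; exact: measurable_funB.
  by rewrite EFinD lteD.
pose G (t x : R) : R := `|h (x + t) - h x|.
have [||||d d0 hd] := @small_integral G
  (fun x => 2 * C * \1_(`[- M - 1, M + 1]%classic : set R) x) _ _ _ _ _ e9.
- move=> t; apply: measurableT_comp => //; apply: measurable_funB => //.
  exact: measurable_fun_shift.
- move=> t x t1; rewrite /G normr_ge0/= indicE.
  have [xin|xout] := boolP (x \in _); rewrite ?mulr1 ?mulr0.
    by rewrite (le_trans (ler_normB _ _))// mulr_natl mulr2n lerD.
  have out y : `|y - x| < 1 -> h y = 0.
    move=> yx; rewrite /h memNset// /E /= in_itv/= => /andP[y1 y2].
    move/negP: xout; apply; apply/mem_set; rewrite /= in_itv/=.
    by move: yx; rewrite ltr_norml => /andP[? ?]; apply/andP; split; lra.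
  by rewrite !out ?subrr ?normr0// addrAC subrr add0r.
- apply: (@eq_integrable _ _ _ mu setT measurableT
    (fun x => ((2 * C)%:E * (\1_(`[- M - 1, M + 1]%classic : set R) x)%:E)%E)) => //.
  by apply: integrableZl => //; exact: integrable_indic_itv.
- refine (ae_imp2 (ae_neq M) (ae_neq (- M)) _) => x xM xM' r r0.
  have [xlt|xgt|//] := ltgtP `|x| M; last first.
  + by move=> /eqP; rewrite eqr_norml ?(ltW M0)// => /andP[/orP[]/eqP].
  + exists (`|x| - M); first by rewrite subr_gt0.
    move=> t tx; rewrite /G /h !memNset ?subrr ?normr0//.
      by rewrite /E /= in_itv/= -ler_norml => h1; move: xgt; rewrite ltNge h1.
    rewrite /E /= in_itv/= -ler_norml => h1.
    have := ler_normB (x + t) t; rewrite addrK => h2.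
    by move: tx; rewrite ltNge => /negP; apply; rewrite lerBlDr (le_trans h2)// addrC lerD2l.
  + have /cvgrPdist_lt/(_ _ r0)/nbhs_ballP[d /= d0 hd] := cgn x.
    exists (Num.min d (M - `|x|)); first by rewrite lt_min d0 subr_gt0.
    move=> t; rewrite lt_min => /andP[td tM].
    have inE_ y : `|y| <= M -> y \in E.
      by rewrite ler_norml => yM; apply/mem_set; rewrite /E /= in_itv.
    rewrite /G /h !inE_ ?(ltW xlt)//; last first.
      by rewrite (le_trans (ler_normD _ _))// -lerBrDl ltW.
    by rewrite distrC; apply: hd; rewrite /ball/= opprD addNKr normrN.
exists d => // t td.
have m1 : measurable_fun [set: R] (fun x => `|k x - h x|).
  by apply: measurableT_comp => //; exact: measurable_funB.
have mG : measurable_fun [set: R] (G t).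
  by apply: measurableT_comp => //; apply: measurable_funB => //; exact: measurable_fun_shift.
have split3 x : `|k (x + t) - k x| <= `|k (x + t) - h (x + t)| + (G t x + `|k x - h x|).
  have -> : k (x + t) - k x = k (x + t) - h (x + t) + (h (x + t) - h x - (k x - h x)) by ring.
  by rewrite (le_trans (ler_normD _ _))// lerD2l (le_trans (ler_normB _ _)).
apply: (@le_lt_trans _ _ (\int[mu]_x (`|k (x + t) - h (x + t)|%:E +
    ((G t x)%:E + `|k x - h x|%:E)))%E).
  apply: ge0_le_integral => //.
  - apply/measurable_EFinP; apply: measurableT_comp => //.
    by apply: measurable_funB => //; exact: measurable_fun_shift.
  - apply: emeasurable_funD; first by apply/measurable_EFinP; exact: (measurable_fun_shift t m1).
    by apply: emeasurable_funD; apply/measurable_EFinP.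
  - by move=> x _; rewrite -!EFinD lee_fin; exact: split3.
rewrite ge0_integralD//; last 3 first.
- by apply/measurable_EFinP; exact: (measurable_fun_shift t m1).
- by move=> x _; rewrite -EFinD lee_fin addr_ge0// /G normr_ge0.
- by apply: emeasurable_funD; apply/measurable_EFinP.
rewrite ge0_integralD//; last 3 first.
- by move=> x _; rewrite lee_fin /G normr_ge0.
- exact/measurable_EFinP.
- exact/measurable_EFinP.
rewrite (ge0_integral_shift t (f := fun x => `|k x - h x|%:E))//; last exact/measurable_EFinP.
have -> : e%:E = ((e / 9 + e / 9)%:E + ((e / 9 + e / 9 + e / 9 + e / 9 + e / 9)%:E + (e / 9 + e / 9)%:E))%E.
  by rewrite -!EFinD; congr (_%:E); field.
apply: lteD => //; apply: lteD => //.
apply: lt_trans (hd t td) _; rewrite lte_fin; lra.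
Qed.

Lemma sqr_posneg (u v : R) : (u - v) ^+ 2 <=
  2 * `|Num.max u 0 ^+ 2 - Num.max v 0 ^+ 2| + 2 * `|Num.max (- u) 0 ^+ 2 - Num.max (- v) 0 ^+ 2|.
Proof.
have key (x y : R) : 0 <= x -> 0 <= y -> (x - y) ^+ 2 <= `|x ^+ 2 - y ^+ 2|.
  move=> x0 y0; rewrite subr_sqr normrM -[(x - y) ^+ 2]real_normK ?num_real// expr2 ler_wpM2l//.
  by rewrite (ger0_norm (addr_ge0 x0 y0)) ler_norml; apply/andP; split; lra.
have p0 x : 0 <= Num.max x (0 : R) by rewrite le_max lexx orbT.
rewrite {1}(max0B u) {1}(max0B v).
have k1 := key _ _ (p0 u) (p0 v); have k2 := key _ _ (p0 (- u)) (p0 (- v)).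
apply: (@le_trans _ _ (2 * (Num.max u 0 - Num.max v 0) ^+ 2 +
  2 * (Num.max (- u) 0 - Num.max (- v) 0) ^+ 2)); last by lra.
move: (Num.max u 0) (Num.max v 0) (Num.max (- u) 0) (Num.max (- v) 0) => a b c d.
have : 0 <= (a - b + (c - d)) ^+ 2 by exact: sqr_ge0.
by move=> h; rewrite -subr_ge0; apply: le_trans h _; rewrite le_eqVlt; apply/orP; left; apply/eqP; ring.
Qed.

(** Translations are continuous in the mean. It is reduced to the L1 case by
    splitting into positive functions, since (u - v)^2 <= |u^2 - v^2| for u, v >= 0. *)
Lemma L2_shift (f : R -> R[i]) : sqint f ->
  forall e : R, 0 < e -> exists2 d : R, 0 < d &
    forall t, `|t| < d -> (en (fun x => f (x + t) - f x)%R < e%:E)%E.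
Proof.
move=> sf; have [mf ef] := sf.
have real (phi : R -> R) : measurable_fun [set: R] phi ->
    (forall x, phi x ^+ 2 <= csq (f x)) ->
    forall e : R, 0 < e -> exists2 d : R, 0 < d &
    forall t, `|t| < d -> (\int[mu]_x ((phi (x + t) - phi x) ^+ 2)%:E < e%:E)%E.
  move=> mphi phif e e0.
  have part (psi : R -> R) : measurable_fun [set: R] psi ->
      (forall x, psi x ^+ 2 <= csq (f x)) -> exists2 d : R, 0 < d &
      forall t, `|t| < d -> (\int[mu]_x `|Num.max (psi (x + t)) 0 ^+ 2 -
        Num.max (psi x) 0 ^+ 2|%:E < (e / 4)%:E)%E.
    move=> mpsi psif; apply: (@L1_shift (fun x => Num.max (psi x) 0 ^+ 2)) => //.
    - by move=> x; exact: sqr_ge0.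
    - apply: le_integrable (integrable_csq sf) => //.
        apply/measurable_EFinP; apply: measurable_funX.
        by apply: measurable_maxr => //; exact: measurable_cst.
      move=> x _; rewrite /= lee_fin !ger0_norm ?csq_ge0 ?sqr_ge0//.
      apply: le_trans (psif x); have [h|h] := leP (psi x) 0; last by [].
      by rewrite expr0n/= sqr_ge0.
    - by rewrite divr_gt0.
  have [d1 d10 h1] := part phi mphi phif.
  have [||d2 d20 h2] := part (fun x => - phi x).
  - exact: measurable_funN.
  - by move=> x; rewrite sqrrN.
  exists (Num.min d1 d2); first by rewrite lt_min d10.
  move=> t; rewrite lt_min => /andP[/h1 {}h1 /h2 {}h2].
  have mp (u : R -> R) : measurable_fun [set: R] u ->
      measurable_fun [set: R] (fun x => `|Num.max (u (x + t)) 0 ^+ 2 - Num.max (u x) 0 ^+ 2|).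
    move=> mu_; apply: measurableT_comp => //.
    by apply: measurable_funB; apply: measurable_funX; apply: measurable_maxr => //;
      [exact: measurable_fun_shift|exact: measurable_cst..].
  have mN : measurable_fun [set: R] (fun x => - phi x) by exact: measurable_funN.
  apply: (@le_lt_trans _ _ (\int[mu]_x (
     2%:E * `|Num.max (phi (x + t)) 0 ^+ 2 - Num.max (phi x) 0 ^+ 2|%:E +
     2%:E * `|Num.max (- phi (x + t)) 0 ^+ 2 - Num.max (- phi x) 0 ^+ 2|%:E))%E).
    apply: ge0_le_integral => //.
    - by move=> x _; rewrite lee_fin sqr_ge0.
    - apply/measurable_EFinP; apply: measurable_funX; apply: measurable_funB => //.
      exact: measurable_fun_shift.
    - by apply: emeasurable_funD; apply: measurable_funeM; apply/measurable_EFinP;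
        [exact: mp|exact: (mp _ mN)].
    - by move=> x _; rewrite -!EFinM -EFinD lee_fin sqr_posneg.
  rewrite ge0_integralD//; last 2 first.
  - by apply: measurable_funeM; apply/measurable_EFinP; exact: mp.
  - by apply: measurable_funeM; apply/measurable_EFinP; exact: (mp _ mN).
  rewrite !ge0_integralZl//; last 2 first.
  - by apply/measurable_EFinP; exact: (mp _ mN).
  - by apply/measurable_EFinP; exact: mp.
  have -> : e%:E = (2%:E * (e / 4)%:E + 2%:E * (e / 4)%:E)%E.
    by rewrite -!EFinM -EFinD; congr (_%:E); field.
  by apply: lteD; rewrite lte_pmul2l// lte_fin.
move=> e e0; have e20 : 0 < e / 2 by rewrite divr_gt0.
have [|d1 d10 h1] := real _ mf.1 _ _ e20; first by move=> x; rewrite lerDl sqr_ge0.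
have [|d2 d20 h2] := real _ mf.2 _ _ e20; first by move=> x; rewrite lerDr sqr_ge0.
exists (Num.min d1 d2); first by rewrite lt_min d10.
move=> t; rewrite lt_min => /andP[/h1 {}h1 /h2 {}h2].
have ms (u : R -> R) : measurable_fun [set: R] u ->
    measurable_fun [set: R] (fun x => ((u (x + t) - u x) ^+ 2)%:E).
  move=> mu_; apply/measurable_EFinP; apply: measurable_funX; apply: measurable_funB => //.
  exact: measurable_fun_shift.
rewrite (_ : en _ = (\int[mu]_x (((complex.Re (f (x + t)) - complex.Re (f x)) ^+ 2)%:E +
  ((complex.Im (f (x + t)) - complex.Im (f x)) ^+ 2)%:E))%E); last first.
  by apply: eq_integral => x _; rewrite -EFinD /csq !ReImE.
rewrite ge0_integralD//; last 4 first.
- by move=> x _; rewrite lee_fin sqr_ge0.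
- exact: (ms _ mf.1).
- by move=> x _; rewrite lee_fin sqr_ge0.
- exact: (ms _ mf.2).
by rewrite [e]splitr EFinD; exact: lteD.
Qed.

End small_integrals.

(** * The evolution with a given transfer *)

Section unitary_operators.
Variables (R : realType) (O : set R).
Notation mu := (@lebesgue_measure R).

Definition uop := {V : (R -> R[i]) -> (R -> R[i]) | unitary_operator (L2 O) (L2 O) V}.

(** The group laws hold up to this relation only: an inverse has to pick
    representatives. *)
Definition uop_eq (V W : uop) := forall f, fmem (L2 O) f ->
  {ae mu, forall x, sval V f x = sval W f x}.

Lemma uop_mem (V : uop) f : fmem (L2 O) f -> fmem (L2 O) (sval V f).
Proof. by move=> f2; exact: (unitary_fmem (svalP V)). Qed.

Lemma uop_enB (V : uop) f g : fmem (L2 O) f -> fmem (L2 O) g ->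
  en (fun x => sval V f x - sval V g x) = en (fun x => f x - g x).
Proof.
move=> f2 g2; have fg2 := fmemB f2 g2.
rewrite -(unitary_en (svalP V) fg2); apply: en_ae.
- by apply: cmeasB; [exact: fmem_cmeas (uop_mem V f2)|exact: fmem_cmeas (uop_mem V g2)].
- exact: fmem_cmeas (uop_mem V fg2).
- by refine (ae_imp (unitary_aeB (svalP V) f2 g2) _) => x ->.
Qed.

Lemma uop_inj (V : uop) f g : fmem (L2 O) f -> fmem (L2 O) g ->
  {ae mu, forall x, sval V f x = sval V g x} -> {ae mu, forall x, f x = g x}.
Proof.
move=> f2 g2 fg; have fg2 := fmemB f2 g2.
have : en (fun x => f x - g x) = 0%E.
  rewrite -(uop_enB V f2 g2) -(en0 R); apply: en_ae.
  - by apply: cmeasB; [exact: fmem_cmeas (uop_mem V f2)|exact: fmem_cmeas (uop_mem V g2)].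
  - exact: cmeas_cst.
  - by refine (ae_imp fg _) => x ->; rewrite subrr.
move=> /(en_eq0 (fmem_cmeas fg2)) /ae_imp; apply => x /eqP.
by rewrite subr_eq0 => /eqP.
Qed.

Lemma uop_en (V : uop) f : fmem (L2 O) f -> en (sval V f) = en f.
Proof. exact: (unitary_en (svalP V)). Qed.

Lemma uop_comp_unitary (V W : uop) :
  unitary_operator (L2 O) (L2 O) (sval V \o sval W).
Proof.
apply: isometry_unitary => /=.
- by move=> f f2; apply: uop_mem; exact: uop_mem.
- by move=> f g f2 g2 fg; apply: (unitary_ae (svalP V));
    [exact: uop_mem..|exact: (unitary_ae (svalP W))].
- move=> z f g f2 g2; have fg2 := fmem_lin z f2 g2.
  have Wf := uop_mem W f2; have Wg := uop_mem W g2.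
  have h := unitary_ae (svalP V) (uop_mem W fg2) (fmem_lin z Wf Wg) (unitary_aeL (svalP W) z f2 g2).
  by refine (ae_imp2 h (unitary_aeL (svalP V) z Wf Wg) _) => x -> ->.
- by move=> f f2; rewrite !uop_en//; exact: uop_mem.
- move=> h h2; have [g g2 /feqP gh] := unitary_onto (svalP V) h2.
  have [f f2 /feqP fg] := unitary_onto (svalP W) g2.
  exists f => //.
  by refine (ae_imp2 (unitary_ae (svalP V) (uop_mem W f2) g2 fg) gh _) => x ->.
Qed.

Definition uop_mul (V W : uop) : uop := exist _ _ (uop_comp_unitary V W).

Lemma uop_one_unitary : unitary_operator (L2 O) (L2 O) id.
Proof.
apply: isometry_unitary => //.
- by move=> z f g _ _; exact/aeW.
- by move=> h h2; exists h => //; exact/aeW.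
Qed.

Definition uop_one : uop := exist _ _ uop_one_unitary.

Let preim (V : uop) h : exists f, fmem (L2 O) h ->
  fmem (L2 O) f /\ {ae mu, forall x, sval V f x = h x}.
Proof.
have [h2|nh] := pselect (fmem (L2 O) h); last by exists h.
by have [f f2 /feqP fh] := unitary_onto (svalP V) h2; exists f.
Qed.

Let invf (V : uop) h := projT1 (cid (preim V h)).

Let invf_mem V h : fmem (L2 O) h -> fmem (L2 O) (invf V h).
Proof. by rewrite /invf; case: cid => f /= hf /hf[]. Qed.

Let invfK V h : fmem (L2 O) h -> {ae mu, forall x, sval V (invf V h) x = h x}.
Proof. by rewrite /invf; case: cid => f /= hf /hf[]. Qed.

Lemma uop_inv_unitary (V : uop) : unitary_operator (L2 O) (L2 O) (invf V).
Proof.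
apply: isometry_unitary.
- by move=> f; exact: invf_mem.
- move=> f g f2 g2 fg; apply: (uop_inj (V := V)); [exact: invf_mem..|].
  by refine (ae_imp2 (ae_and (invfK V f2) (invfK V g2)) fg _) => x [-> ->].
- move=> z f g f2 g2; have fg2 := fmem_lin z f2 g2.
  have If := invf_mem V f2; have Ig := invf_mem V g2.
  apply: (uop_inj (V := V)); [exact: invf_mem|exact: fmem_lin|].
  refine (ae_imp2 (ae_and (invfK V f2) (invfK V g2))
    (ae_and (invfK V fg2) (unitary_aeL (svalP V) z If Ig)) _).
  by move=> x [h1 h2] [-> ->]; rewrite h1 h2.
- move=> f f2; rewrite -(uop_en V (invf_mem V f2)); apply: en_ae.
  + exact: fmem_cmeas (uop_mem V (invf_mem V f2)).
  + exact: fmem_cmeas f2.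
  + exact: invfK.
- move=> h h2; exists (sval V h); first exact: uop_mem.
  apply: (uop_inj (V := V)) => //; first by apply: invf_mem; exact: uop_mem.
  by apply: invfK; exact: uop_mem.
Qed.

Definition uop_inv (V : uop) : uop := exist _ _ (uop_inv_unitary V).

Global Instance uop_eq_equivalence : RelationClasses.Equivalence uop_eq.
Proof.
split.
- by move=> V f f2; exact/aeW.
- by move=> V W VW f f2; refine (ae_imp (VW f f2) _).
- by move=> V W Z VW WZ f f2; refine (ae_imp2 (VW f f2) (WZ f f2) _) => x -> ->.
Qed.

Global Instance uop_mul_proper : Morphisms.Proper
  (Morphisms.respectful uop_eq (Morphisms.respectful uop_eq uop_eq)) uop_mul.
Proof.
move=> V V' VV W W' WW f f2 /=.
refine (ae_imp2 (VV _ (uop_mem W f2)) (unitary_ae (svalP V') (uop_mem W f2) (uop_mem W' f2) (WW f f2)) _).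
by move=> x -> ->.
Qed.

Lemma uop_mulV V : uop_eq (uop_mul V (uop_inv V)) uop_one.
Proof. by move=> f f2 /=; exact: invfK. Qed.

Lemma uop_mulVx V : uop_eq (uop_mul (uop_inv V) V) uop_one.
Proof.
move=> f f2 /=; apply: (uop_inj (V := V)) => //.
  by apply: invf_mem; exact: uop_mem.
by apply: invfK; exact: uop_mem.
Qed.

End unitary_operators.

Lemma short_width (R : realType) (L : \bar R) : (0 < L)%E ->
  exists2 l : R, 0 < l & (l%:E < L)%E.
Proof.
case: L => [r|_|//]; last by exists 1; rewrite ?ltry.
by rewrite lte_fin => r0; exists (r / 2); rewrite ?divr_gt0// lte_fin ltr_pdivrMr//; lra.
Qed.

Section converse.
Variable R : realType.
Notation mu := (@lebesgue_measure R).
Variables (J K : countType) (O : set R) (a : J -> R) (b : K -> R) (L : \bar R).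
Hypothesis H : layered O a b L.
Hypothesis L0 : (0 < L)%E.
Variables (Phi : (J -> R[i]) -> (K -> R[i])) (Psi : (K -> R[i]) -> (J -> R[i])).
Hypothesis PhiT : l2_transfer Phi.
Hypothesis PsiT : l2_transfer Psi.
Hypothesis PsiK : forall u, fmem (l2 R K) u -> Phi (Psi u) = u.

(** The evolution during a time less than the length of all intervals: at most one
    end point is passed, and Phi tells what happens there. *)
Definition local_op (t : R) := transfer_op O a (fun k => b k - t) t t Phi.
Definition local_inv (t : R) := transfer_op O (fun k => b k - t) a t (- t) Psi.

Lemma rest_right t : 0 <= t -> {ae mu, forall x,
  (O x /\ ~ rlayer b t x) <-> (O (x + t) /\ ~ llayer a t (x + t))}.
Proof.
move=> t0; refine (ae_imp2 (ae_neq_count (fun k => b k - t)) (ae_neq_count a) _).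
move=> x xb xa; split=> -[Ox nx].
  have [pt|//|[k /xb//]] := path_or_rlayer H Ox t0.
  by split; [exact: path_end|exact: (path_notin_llayer H pt)].
have [|//|[j /addIr /xa//]] := path_or_llayer H Ox t0; rewrite addrK => pt.
by split; [exact: (path0 t0 pt)|exact: (path_notin_rlayer H pt)].
Qed.

Lemma rest_left t : 0 <= t -> {ae mu, forall x,
  (O x /\ ~ llayer a t x) <-> (O (x - t) /\ ~ rlayer b t (x - t))}.
Proof.
move=> t0; refine (ae_imp (ae_shift (- t) (rest_right t0)) _) => x.
by rewrite subrK => h; split => /h.
Qed.

Let mO : measurable O := measurable_O H.

Lemma local_op_unitary t : 0 <= t -> (t%:E < L)%E ->
  unitary_operator (L2 O) (L2 O) (local_op t).
Proof.
move=> t0 tL; have lt := left_triv H tL; have rt := right_triv H tL.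
have rO : rlayer b t `<=` O by move=> x; exact: (rlayer_O H).
have lO : llayer a t `<=` O by move=> x; exact: (llayer_O H).
have rr := rest_right t0; have rl := rest_left t0.
apply: isometry_unitary.
- by move=> f; exact: fmem_transfer_op.
- by move=> f g f2 g2; apply: ae_transfer_op => //; [exact: fmem_cmeas f2|exact: fmem_cmeas g2].
- by move=> z f g; exact: lin_transfer_op.
- by move=> f; exact: en_transfer_op.
- move=> h h2; exists (local_inv t h).
    by apply: fmem_transfer_op => //; exact: rl.
  have := @transfer_opK R K J O (fun k => b k - t) a t (- t) rt lt rO _ Psi Phi PsiK h h2.
  rewrite opprK; apply.
  exact: rr.
Qed.

Lemma local_op_path t f x : 0 <= t -> path O x t -> local_op t f x = f (x + t).
Proof.
move=> t0 pt; rewrite /local_op transfer_op_rest//; last exact: (path0 t0 pt).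
exact: (path_notin_rlayer H pt).
Qed.

Lemma local_op_cell t f k s : (t%:E < L)%E -> 0 < s -> s < t ->
  local_op t f (b k - t + s) = Phi (fun j => f (a j + s)) k.
Proof.
move=> tL s0 st; rewrite /local_op.
apply: (@transfer_op_layer R J K O a (fun k => b k - t) t t (right_triv H tL) Phi f k s).
by rewrite s0.
Qed.

Lemma local_op_out t f x : (t%:E < L)%E -> ~ O x -> local_op t f x = 0.
Proof.
move=> tL nx; apply: transfer_op_out => //.
by move=> y; exact: (rlayer_O H).
Qed.

(** During the time s + t < L a point passes at most one end, in one of the two
    parts of the time: the other part only shifts its distance from the ends, with
    which Phi commutes. *)
Lemma local_opD s t f : 0 <= s -> 0 <= t -> ((s + t)%:E < L)%E -> fmem (L2 O) f ->
  {ae mu, forall x, local_op s (local_op t f) x = local_op (s + t) f x}.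
Proof.
move=> s0 t0 stL f2.
have sL : (s%:E < L)%E by apply: lt_trans_L stL; rewrite lerDl.
have tL : (t%:E < L)%E by apply: lt_trans_L stL; rewrite lerDr.
refine (ae_imp2 (ae_neq_count (fun k => b k - s)) (ae_neq_count (fun k => b k - (s + t))) _).
move=> x xs xst; have [Ox|nOx] := pselect (O x); last by rewrite !local_op_out.
have [pt|/layerP[k [r [r0 rst xE]]]|[k /xst//]] := path_or_rlayer H Ox (addr_ge0 s0 t0).
  rewrite [RHS]local_op_path ?addr_ge0// local_op_path//; last first.
    by apply: path_le pt; rewrite lerDl.
  by rewrite local_op_path ?addrA//; exact: path_shift.
rewrite [in RHS]xE local_op_cell//.
have [rt|tr|rt] := ltgtP r t.
- have xE' : x = b k - ((t - r) + s) by rewrite xE; ring.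
  rewrite local_op_path//; last first.
    rewrite xE'; apply: (path_right_cell H); first by rewrite subr_gt0.
    by apply: lt_trans_L stL; lra.
  by rewrite (_ : x + s = b k - t + r) ?local_op_cell// xE; ring.
- have -> : x = b k - s + (r - t) by rewrite xE; ring.
  rewrite local_op_cell//; [|by rewrite subr_gt0|by lra].
  congr (Phi _ k); apply/funext => j; rewrite local_op_path//; last first.
    by apply: (path_left_cell H); [rewrite subr_gt0|rewrite subrK; apply: lt_trans_L stL; exact: ltW].
  by congr (f _); ring.
- by case: (xs k); rewrite xE rt; ring.
Qed.

Lemma local_op0 f : fmem (L2 O) f -> {ae mu, forall x, local_op 0 f x = f x}.
Proof.
move=> f2; apply/aeW => x; have [Ox|nOx] := pselect (O x); last first.
  by rewrite local_op_out// (fmem_off f2).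
rewrite local_op_path ?addr0// => s s0.
have -> : s = 0 by apply/eqP; rewrite eq_le andbC.
by rewrite addr0.
Qed.

(** Off the right layer local_op t is a translation, which is continuous in the mean.
    On the right layer, f is small because the layer shrinks to nothing, and so is its
    image, whose norm there is that of f on the left layer. *)
Lemma local_op_continuous f : fmem (L2 O) f -> forall e : R, 0 < e ->
  exists2 d : R, 0 < d & forall t, 0 <= t < d -> (t%:E < L)%E ->
    (en (fun x => local_op t f x - f x)%R < e%:E)%E.
Proof.
move=> f2 e e0; have sf := fmem_sqint f2; have mf := fmem_cmeas f2.
have e50 : 0 < e / 5 by rewrite divr_gt0.
have [l l0 lL] := short_width L0.
have [||d1 d10 h1] := en_cut_small (A := llayer a) sf _ _ e50.
- by move=> t; exact: measurable_llayer.
- move=> x; have [/layerP[j [s [s0 sl xE]]]|nx] := pselect (llayer a l x).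
    exists s => // t /andP[t0 ts].
    apply: (@llayer_nested _ _ _ _ _ _ _ H t l j) => //; last exact: ltW.
    - exact: ltW (lt_trans ts sl).
    - by rewrite xE ltrD2l.
    - by rewrite xE ltrD2l.
  exists l => // t /andP[t0 tl] /layerP[j [s [s0 st xE]]].
  by apply: nx; apply/layerP; exists j, s; split => //; exact: lt_trans tl.
have [||d2 d20 h2] := en_cut_small (A := rlayer b) sf _ _ e50.
- by move=> t; exact: measurable_rlayer.
- move=> x; have [/rlayerP[k /andP[k1 k2]]|nx] := pselect (rlayer b l x).
    exists (b k - x); first by rewrite subr_gt0.
    move=> t /andP[t0 tb]; apply: (path_notin_rlayer H).
    have -> : x = b k - ((b k - x - t) + t) by ring.
    apply: (path_right_cell H); first by rewrite subr_gt0.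
    by apply: lt_trans_L lL; lra.
  exists l => // t /andP[t0 tl] /rlayerP[k /andP[k1 k2]].
  by apply: nx; apply/rlayerP; exists k; apply/andP; split; lra.
have [d3 d30 h3] := L2_shift sf e50.
exists (Num.min d1 (Num.min d2 d3)); first by rewrite !lt_min d10 d20.
move=> t; rewrite !lt_min => /andP[t0 /and3P[t1 t2 t3]] tL.
have SU := local_op_unitary t0 tL; have S2 := unitary_fmem SU f2.
have mS := fmem_cmeas S2.
have [t00|tn0] := eqVneq t 0.
  rewrite t00 (_ : en _ = 0%E) ?lte_fin// -(en0 R); apply: en_ae.
  - by apply: cmeasB => //; rewrite -t00.
  - exact: cmeas_cst.
  - by refine (ae_imp (local_op0 f2) _) => x ->; rewrite subrr.
have tgt : 0 < t by rewrite lt_neqAle eq_sym tn0.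
have {}h1 := h1 t; rewrite tgt t1 in h1.
have {}h2 := h2 t; rewrite tgt t2 in h2.
have {}h3 := h3 t; rewrite gtr0_norm// in h3.
have mr := measurable_rlayer b t.
have mshift : cmeas (fun x => f (x + t) - f x) by apply: cmeasB => //; exact: cmeas_shift.
have tr : en (cut (rlayer b t) (local_op t f)) = en (cut (llayer a t) f).
  apply: (en_layer_transfer H t0 tL SU) => // g g2.
  by apply/aeW => x; exact: local_op_path.
pose g x := (f (x + t) - f x) .
pose h x := cut (rlayer b t) (local_op t f) x - cut (rlayer b t) f x.
have mh : cmeas h by apply: cmeasB; exact: cmeas_cut.
have bound : {ae mu, forall x, csq (local_op t f x - f x) <= csq (g x) + csq (h x)}.
  refine (ae_imp (ae_neq_count (fun k => b k - t)) _) => x xb.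
  have [rx|nx] := pselect (rlayer b t x).
    by rewrite /h !cut_in// lerDr csq_ge0.
  have [Ox|nOx] := pselect (O x); last first.
    by rewrite local_op_out// (fmem_off f2 nOx) subrr csq0 addr_ge0 ?csq_ge0.
  have [pt|//|[k /xb//]] := path_or_rlayer H Ox t0.
  by rewrite local_op_path// lerDl csq_ge0.
have hle : (en h <= 2%:E * en (cut (rlayer b t) (local_op t f)) + 2%:E * en (cut (rlayer b t) f))%E.
  rewrite -(enN (cut (rlayer b t) f)); apply: enD_le; first exact: cmeas_cut.
  by apply: cmeasN; exact: cmeas_cut.
apply: (@le_lt_trans _ _ (en g + en h)%E).
  rewrite /en -ge0_integralD//.
  - apply: ae_ge0_le_integral => //.
    + by move=> x _; rewrite lee_fin csq_ge0.
    + by apply: emeasurable_csq; exact: cmeasB.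
    + by move=> x _; rewrite -EFinD lee_fin addr_ge0 ?csq_ge0.
    + by apply: emeasurable_funD; exact: emeasurable_csq.
    + by refine (ae_imp bound _) => x hx _; rewrite -EFinD lee_fin.
  - by move=> x _; rewrite lee_fin csq_ge0.
  - exact: emeasurable_csq.
  - by move=> x _; rewrite lee_fin csq_ge0.
  - exact: emeasurable_csq.
have -> : e%:E = ((e / 5)%:E + (2%:E * (e / 5)%:E + 2%:E * (e / 5)%:E))%E.
  by rewrite -!EFinM -!EFinD; congr (_%:E); field.
apply: lteD; first exact: h3.
apply: le_lt_trans hle _; rewrite tr.
by apply: lteD; rewrite lte_pmul2l ?lte_fin//; [exact: h1|exact: h2].
Qed.

(* The value at the other times is arbitrary; it makes the family total. *)
Let local (t : R) : uop O :=
  if pselect (0 <= t /\ (t%:E < L)%E) is left tP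
  then exist _ _ (local_op_unitary tP.1 tP.2) else uop_one O.

Let localE t : 0 <= t -> (t%:E < L)%E -> sval (local t) = local_op t.
Proof. by move=> t0 tL; rewrite /local; case: pselect => // -[]. Qed.

Lemma local_group : exists U : R -> uop O,
  [/\ uop_eq (U 0) (uop_one O),
      forall s t, uop_eq (U (s + t)) (uop_mul (U s) (U t)) &
      forall t f, 0 <= t -> (t%:E < L)%E -> fmem (L2 O) f ->
        {ae mu, forall x, sval (U t) f x = local_op t f x}].
Proof.
have [l l0 lL] := short_width L0.
have S0 : uop_eq (local 0) (uop_one O).
  by move=> f f2; rewrite localE//; exact: local_op0.
have SDL s t : 0 <= s -> 0 <= t -> ((s + t)%:E < L)%E ->
    uop_eq (uop_mul (local s) (local t)) (local (s + t)).
  move=> s0 t0 stL f f2 /=; rewrite !localE ?addr_ge0//.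
  - exact: local_opD.
  - by apply: lt_trans_L stL; rewrite lerDr.
  - by apply: lt_trans_L stL; rewrite lerDl.
have SD s t : 0 <= s -> 0 <= t -> s + t <= l ->
    uop_eq (uop_mul (local s) (local t)) (local (s + t)).
  by move=> s0 t0 stl; apply: SDL => //; exact: lt_trans_L lL.
pose U := one_parameter (@uop_mul R O) (uop_one O) (@uop_inv R O) local l.
have mulA (V W Z : uop O) : uop_eq (uop_mul V (uop_mul W Z)) (uop_mul (uop_mul V W) Z).
  by move=> f f2; exact/aeW.
have mul1 (V : uop O) : uop_eq (uop_mul (uop_one O) V) V by move=> f f2; exact/aeW.
have mulx1 (V : uop O) : uop_eq (uop_mul V (uop_one O)) V by move=> f f2; exact/aeW.
have Uadd s t : uop_eq (U (s + t)) (uop_mul (U s) (U t)) :=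
  one_parameterD (eqvE := @uop_eq_equivalence R O) (mulP := @uop_mul_proper R O)
    mulA mul1 mulx1 (@uop_mulV R O) (@uop_mulVx R O) l0 S0 SD s t.
have Ul t : 0 <= t -> t <= l -> uop_eq (U t) (local t).
  exact: (one_parameter_local (eqvE := @uop_eq_equivalence R O) (mulP := @uop_mul_proper R O)
    mul1 mulx1 (@uop_mulV R O) l0 S0).
exists U; split => //.
  exact: (one_parameter0 (eqvE := @uop_eq_equivalence R O) (mulP := @uop_mul_proper R O)
    mul1 mulx1 (@uop_mulV R O) l0 S0).
have UL (n : nat) t : 0 <= t -> t <= n%:R * l -> (t%:E < L)%E -> uop_eq (U t) (local t).
  elim: n t => [|n ih] t t0 tn tL.
    by apply: Ul => //; apply: le_trans tn _; rewrite mul0r ltW.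
  have [tl|lt] := leP t l; first exact: Ul.
  have tE : t = l + (t - l) by ring.
  have tl0 : 0 <= t - l by rewrite subr_ge0 ltW.
  have h1 := Uadd l (t - l); have h2 := SDL l (t - l); rewrite -tE in h1 h2.
  have h3 := ih (t - l) tl0; rewrite lerBlDr in h3.
  have h4 : uop_eq (U (t - l)) (local (t - l)).
    apply: h3; first by rewrite (le_trans tn)// -natr1 mulrDl mul1r.
    by apply: lt_trans_L tL; rewrite gerBl ltW.
  have h5 := Ul l (ltW l0) (lexx l).
  rewrite h1 h5 h4 h2//; first by reflexivity.
  exact: ltW.
move=> t f t0 tL f2; rewrite -(localE t0 tL).
apply: (UL (Num.truncn (t / l)).+1 t t0 _ tL f f2).
by rewrite -ler_pdivrMr// ltW// truncnS_gt.
Qed.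

End converse.

(** * The group of a unitary matrix, and the intervals *)

Section group_of_matrix.
Variable R : realType.
Notation mu := (@lebesgue_measure R).
Variables (J K : countType) (O : set R) (a : J -> R) (b : K -> R) (L : \bar R).
Hypothesis H : layered O a b L.
Hypothesis L0 : (0 < L)%E.

Section local.
Variable Phi : (J -> R[i]) -> (K -> R[i]).
Hypothesis PhiT : l2_transfer Phi.
Variable U : R -> uop O.
Hypothesis U0 : uop_eq (U 0) (uop_one O).
Hypothesis UD : forall s t, uop_eq (U (s + t)) (uop_mul (U s) (U t)).
Hypothesis UL : forall t f, 0 <= t -> (t%:E < L)%E -> fmem (L2 O) f ->
  {ae mu, forall x, sval (U t) f x = local_op O a b Phi t f x}.
Hypothesis Scont : forall f, fmem (L2 O) f -> forall e : R, 0 < e ->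
  exists2 d : R, 0 < d & forall t, 0 <= t < d -> (t%:E < L)%E ->
    (en (fun x => local_op O a b Phi t f x - f x)%R < e%:E)%E.

(** A long path is followed in steps shorter than all intervals. *)
Lemma group_moves t : 0 <= t -> moves O (sval (U t)) t.
Proof.
move=> t0; have [l l0 lL] := short_width L0.
pose n := (Num.truncn (t / l)).+1.
have n0 : (n%:R : R) != 0 by rewrite pnatr_eq0.
pose s := t / n%:R; have s0 : 0 <= s by rewrite divr_ge0.
have sL : (s%:E < L)%E.
  apply: lt_trans_L lL; rewrite ler_pdivrMr ?ltr0n// mulrC -ler_pdivrMr//.
  by rewrite ltW// truncnS_gt.
have Us : moves O (sval (U s)) s.
  move=> f f2; refine (ae_imp (UL s0 sL f2) _) => x -> pt.
  exact: (local_op_path H).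
have iter m : moves O (sval (U (m%:R * s))) (m%:R * s).
  elim: m => [|m ih] f f2.
    rewrite mul0r; refine (ae_imp (U0 f2) _) => x -> _ /=.
    by rewrite addr0.
  have -> : m.+1%:R * s = s + m%:R * s by rewrite -natr1; ring.
  have mm := moves_comp s0 (mulr_ge0 (ler0n _ m) s0) (svalP (U (m%:R * s))) Us ih f2.
  by refine (ae_imp2 (UD s (m%:R * s) f2) mm _) => x ->.
by have := iter n; rewrite /s mulrC divfK.
Qed.

Let V t := sval (U t).

Lemma group_small f : fmem (L2 O) f -> forall e : R, 0 < e ->
  exists2 d : R, 0 < d & forall t, 0 <= t -> t < d ->
    (en (fun x => V t f x - f x)%R < e%:E)%E.
Proof.
move=> f2 e e0; have [l l0 lL] := short_width L0; have [d d0 hd] := Scont f2 e0.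
exists (Num.min d l); first by rewrite lt_min d0.
move=> t t0; rewrite lt_min => /andP[td tl].
have tL := lt_trans_L (ltW tl) lL.
have := hd t; rewrite t0 td => /(_ isT tL); congr (_ < _)%E; apply/esym/en_ae.
- apply: cmeasB; last exact: fmem_cmeas f2.
  exact: fmem_cmeas (uop_mem (U t) f2).
- apply: cmeasB; last exact: fmem_cmeas f2.
  apply: cmeas_transfer_op => //; last exact: fmem_cmeas f2.
    exact: (measurable_O H).
  exact: (right_triv H tL).
- by refine (ae_imp (UL t0 tL f2) _) => x; rewrite /V => ->.
Qed.

Lemma group_strongly_continuous : strongly_continuous_unitary_group O V.
Proof.
have Vc f : fmem (L2 O) f -> forall t0 t, t0 <= t ->
    en (fun x => V t f x - V t0 f x) = en (fun x => V (t - t0) f x - f x).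
  move=> f2 t0 t tt; have Vf2 := uop_mem (U (t - t0)) f2.
  rewrite -(uop_enB (U t0) Vf2 f2); apply: en_ae.
  - by apply: cmeasB; [exact: fmem_cmeas (uop_mem (U t) f2)|exact: fmem_cmeas (uop_mem (U t0) f2)].
  - by apply: cmeasB; [exact: fmem_cmeas (uop_mem (U t0) Vf2)|exact: fmem_cmeas (uop_mem (U t0) f2)].
  - have := UD t0 (t - t0) f2; rewrite addrC subrK => h.
    by refine (ae_imp h _) => x; rewrite /V => ->.
have fin s t f : fmem (L2 O) f -> (en (fun x => V s f x - V t f x)%R < +oo)%E.
  move=> f2; apply: (sqintB _ _).2.
    exact: fmem_sqint (uop_mem (U s) f2).
  exact: fmem_sqint (uop_mem (U t) f2).
split.
- by move=> t; exact: svalP.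
- by move=> f f2; apply/feqP; exact: U0.
- by move=> s t f f2; apply/feqP; exact: UD.
- move=> f f2 t0; apply: en_cvg0; first by move=> t; exact: fin.
  apply/cvgrPdist_lt => e e0; have [d d0 hd] := group_small f2 e0.
  apply/nbhs_ballP; exists d => //= t; rewrite /ball/= => td.
  rewrite sub0r normrN ger0_norm ?fine_ge0 ?en_ge0//.
  rewrite -lte_fin fineK ?ge0_fin_numE ?en_ge0 ?fin//.
  have [tt0|t0t] := leP t0 t.
    rewrite Vc//; apply: hd; first by rewrite subr_ge0.
    by move: td; rewrite distrC ger0_norm ?subr_ge0.
  rewrite -enN; under eq_fun do rewrite opprB.
  rewrite Vc ?(ltW t0t)//; apply: hd; first by rewrite subr_ge0 ltW.
  by move: td; rewrite ger0_norm ?subr_ge0// ltW.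
Qed.

Lemma group_integrability : integrability_property O V.
Proof.
have UG := group_strongly_continuous.
move=> x0 W e _ _ WO e0 We t f te f2.
have [t0|t0] := leP 0 t.
  refine (ae_imp (group_moves t0 f2) _) => y h Wy; apply: h => s /andP[s0 st].
  by apply: We Wy; rewrite ger0_norm// (le_lt_trans st)// (le_lt_trans (ler_norm _) te).
have nt0 : 0 <= - t by rewrite oppr_ge0 ltW.
have := moves_back UG group_moves nt0 f2; rewrite opprK => h.
refine (ae_imp h _) => y hy Wy; apply: hy => s /andP[s0 st].
rewrite -addrA; apply: We Wy; move: te; rewrite ltr0_norm// => te.
by rewrite ltr_norml; apply/andP; split; lra.
Qed.

Lemma group_cells (B : J -> K -> R[i]) :
  (forall i z k, Phi (fun j => if j == i then z else 0) k = B i k * z) ->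
  cell_relation1 O a b L V B.
Proof.
move=> PhiB e i f e0 eL f2 fsupp k.
have lt := left_triv H eL.
have zero j : j != i -> {ae mu, forall s, 0 < s < e -> f (a j + s) = 0}.
  move=> ji; refine (ae_imp2 (ae_cell a j fsupp) (ae_neq (a i + e - a j)) _).
  move=> s fs sn /andP[s0 se]; apply: fs; rewrite /= in_itv/= => /andP[h1 h2].
  have/trivIsetP/(_ j i I I ji) := lt; rewrite -subset0 => /(_ (a j + s)); apply.
  split; rewrite /= in_itv/=; apply/andP; split; rewrite ?ltrDl ?ltrD2l//.
    rewrite lt_neqAle h1 andbT; apply/eqP => ij.
    apply: (ly_left_notin H (j := i)); rewrite ij; apply: (ly_left_cell H) => //.
    by apply: lt_trans_L eL; exact: ltW.
  rewrite lt_neqAle h2 andbT; apply/eqP => ij; apply: sn.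
  by rewrite -ij; ring.
have all0 : {ae mu, forall s, forall j, j != i -> 0 < s < e -> f (a j + s) = 0}.
  apply: ae_forall_count => j; have [->|ji] := eqVneq j i; first by apply/aeW.
  by refine (ae_imp (zero j ji) _) => s h _.
have cell := ae_cell (fun k => b k - e) k (UL (ltW e0) eL f2).
refine (ae_imp2 cell all0 _) => s + h0 se; rewrite /V => ->.
case/andP: (se) => s0 s_e; rewrite (local_op_cell H)//.
rewrite -PhiB; congr (Phi _ k); apply/funext => j.
by case: eqVneq => [->//|ji]; rewrite h0.
Qed.

End local.

Lemma group_of_unitary_matrix (B : J -> K -> R[i]) : unitary_matrix B ->
  exists U, [/\ strongly_continuous_unitary_group O U, integrability_property O U,
    forall t, 0 <= t -> moves O (U t) t & cell_relation1 O a b L U B].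
Proof.
move=> [V [VU VB]].
have T1 := mxtr_transfer VU VB; have T2 := mxconj_transfer VU VB.
have [U [U0 UD UL]] := local_group H L0 T1 T2 (mxconjK VU VB).
have C := local_op_continuous H L0 T1 T2 (mxconjK VU VB).
exists (fun t => sval (U t)); split.
- exact: (group_strongly_continuous T1 U0 UD UL C).
- exact: (group_integrability T1 U0 UD UL C).
- exact: (group_moves U0 UD UL).
- by apply: (group_cells UL) => i z k; exact: mxtr_single.
Qed.

End group_of_matrix.

Section intervals.
Variables (R : realType) (I : countType) (alpha beta : I -> \bar R).
Hypothesis ab : forall i, (alpha i < beta i)%E.
Hypothesis disj : trivIset [set: I] (itv_of alpha beta).
Notation L := (itv_minlength alpha beta).
Notation O := (itv_union alpha beta).

Lemma left_endE (j : left_index alpha) : (left_end j)%:E = alpha (val j).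
Proof.
rewrite /left_end fineK// fin_numE; have := valP j; rewrite /= => h.
by rewrite gt_eqF//= lt_eqF// (lt_le_trans (ab _)) ?leey.
Qed.

Lemma right_endE (k : right_index beta) : (right_end k)%:E = beta (val k).
Proof.
rewrite /right_end fineK// fin_numE; have := valP k; rewrite /= => h.
by rewrite (lt_eqF h) andbT gt_eqF// (le_lt_trans _ (ab _)) ?leNye.
Qed.

Lemma minlength_le i : (L <= beta i - alpha i)%E.
Proof. by apply: ereal_inf_lbound; exists i. Qed.

Lemma room_right (r : R) (B : \bar R) : (r%:E < B)%E ->
  exists2 d : R, 0 < d & forall s, s <= d -> ((r + s)%:E < B)%E.
Proof.
case: B => [B|_|//]; last by exists 1 => // s _; rewrite ltry.
rewrite lte_fin => rB; exists ((B - r) / 2) => [|s sd]; first by rewrite divr_gt0 ?subr_gt0.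
by rewrite lte_fin; lra.
Qed.

Lemma room_left (r : R) (A : \bar R) : (A < r%:E)%E ->
  exists2 d : R, 0 < d & forall s, s <= d -> (A < (r - s)%:E)%E.
Proof.
case: A => [A|//|_]; last by exists 1 => // s _; rewrite ltNyr.
rewrite lte_fin => rB; exists ((r - A) / 2) => [|s sd]; first by rewrite divr_gt0 ?subr_gt0.
by rewrite lte_fin; lra.
Qed.

Lemma same_itv i i' x : itv_of alpha beta i x -> itv_of alpha beta i' x -> i = i'.
Proof.
move=> h h'; apply: contrapT => /eqP ii.
have/trivIsetP/(_ i i' Logic.I Logic.I ii) := disj; rewrite -subset0 => /(_ x).
by apply; split.
Qed.

Lemma left_end_cover (r : R) i i' : alpha i = r%:E -> (alpha i' <= r%:E)%E ->
  (r%:E < beta i')%E -> i = i'.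
Proof.
move=> ir i'r ri'; have := ab i; rewrite ir => rb.
have [d d0 hd] := room_right rb; have [d' d'0 hd'] := room_right ri'.
apply: (@same_itv _ _ (r + Num.min d d')); rewrite /itv_of /=.
  by rewrite ir lte_fin ltrDl lt_min d0 d'0; split => //; apply: hd; rewrite ge_min lexx.
split; last by apply: hd'; rewrite ge_min lexx orbT.
by apply: le_lt_trans i'r _; rewrite lte_fin ltrDl lt_min d0 d'0.
Qed.

Lemma right_end_cover (r : R) i i' : beta i = r%:E -> (alpha i' < r%:E)%E ->
  (r%:E <= beta i')%E -> i = i'.
Proof.
move=> ir i'r ri'; have := ab i; rewrite ir => rb.
have [d d0 hd] := room_left rb; have [d' d'0 hd'] := room_left i'r.
apply: (@same_itv _ _ (r - Num.min d d')); rewrite /itv_of /=.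
  by rewrite ir lte_fin gtrBl lt_min d0 d'0; split => //; apply: hd; rewrite ge_min lexx.
split; first by apply: hd'; rewrite ge_min lexx orbT.
by apply: lt_le_trans ri'; rewrite lte_fin gtrBl lt_min d0 d'0.
Qed.

(** The minimal length keeps the layers inside the intervals, and disjointness keeps
    an end point of one interval out of the others, even when two intervals touch. *)
Lemma itv_union_layered : layered O (@left_end R I alpha) (@right_end R I beta) L.
Proof.
split.
- apply: bigcup_open => i _.
  rewrite openE => x [h1 h2]; have [d d0 hd] := room_right h2.
  have [d' d'0 hd'] := room_left h1.
  apply/nbhs_ballP; exists (Num.min d d'); first by rewrite /= lt_min d0.
  move=> y; rewrite /ball/= lt_min => /andP[yd yd'].
  have -> : y = x + (y - x) by ring.
  split; last by apply: hd; rewrite ltW// (le_lt_trans (ler_norm _))// distrC.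
  rewrite -[y - x]opprB; apply: hd'; rewrite ltW// (le_lt_trans (ler_norm _))//.
- move=> j [i _ [h1 h2]]; rewrite left_endE in h1 h2.
  have := @left_end_cover (left_end j) (val j) i; rewrite !left_endE => /(_ erefl (ltW h1) h2) E.
  by move: h1; rewrite E ltxx.
- move=> k [i _ [h1 h2]]; rewrite right_endE in h1 h2.
  have := @right_end_cover (right_end k) (val k) i; rewrite !right_endE => /(_ erefl h1 (ltW h2)) E.
  by move: h2; rewrite E ltxx.
- move=> i j ij; apply: val_inj; apply: (@left_end_cover (left_end i)).
  + by rewrite left_endE.
  + by rewrite ij left_endE.
  + by rewrite ij left_endE; exact: ab.
- move=> i j ij; apply: val_inj; apply: (@right_end_cover (right_end i)).
  + by rewrite right_endE.
  + by rewrite ij right_endE; exact: ab.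
  + by rewrite ij right_endE.
- move=> x t [i _ [h1 h2]] t0; have [xt|xt] := ltP (x + t)%:E (beta i).
    left=> s /andP[s0 st]; exists i => //; split.
      by apply: lt_le_trans h1 _; rewrite lee_fin lerDl.
    by apply: le_lt_trans xt; rewrite lee_fin lerD2l.
  right; have bi : (beta i < +oo)%E by apply: le_lt_trans xt _; rewrite ltry.
  exists (exist _ i bi : right_index beta).
  have E := right_endE (exist _ i bi : right_index beta); rewrite /= -E in xt h2.
  by rewrite lee_fin in xt; rewrite lte_fin in h2; apply/andP; split => //; lra.
- move=> x t [i _ [h1 h2]] t0; have [xt|xt] := ltP (alpha i) (x - t)%:E.
    left=> s /andP[s0 st]; exists i => //; split.
      by apply: lt_le_trans xt _; rewrite lee_fin lerD2l lerN2.
    by apply: le_lt_trans h2; rewrite lee_fin gerBl.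
  right; have bi : (-oo < alpha i)%E by apply: lt_le_trans xt; rewrite ltNyr.
  exists (exist _ i bi : left_index alpha).
  have E := left_endE (exist _ i bi : left_index alpha); rewrite /= -E in xt h1.
  by rewrite lee_fin in xt; rewrite lte_fin in h1; apply/andP; split => //; lra.
- move=> j s s0 sL; exists (val j) => //; split.
    by rewrite -left_endE lte_fin ltrDl.
  have := lt_le_trans sL (minlength_le (val j)); rewrite -left_endE.
  by rewrite lteBrDr// EFinD addeC.
- move=> k s s0 sL; exists (val k) => //; split; last first.
    by rewrite -right_endE lte_fin gtrBl.
  have := lt_le_trans sL (minlength_le (val k)); rewrite -right_endE.
  case: (alpha (val k)) => [r| |] //=; last by rewrite ltNyr.
  by rewrite -EFinB !lte_fin => ?; lra.
Qed.

End intervals.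

Theorem theorem4p1 (R : realType) (I : countType) (alpha beta : I -> \bar R)
    (alpha_lt_beta : forall i, (alpha i < beta i)%E)
    (disj : trivIset [set: I] (itv_of alpha beta))
    (minlength_gt0 : (0 < itv_minlength alpha beta)%E) :
  (forall U : R -> (R -> R[i]) -> (R -> R[i]),
    strongly_continuous_unitary_group (itv_union alpha beta) U ->
    integrability_property (itv_union alpha beta) U ->
    exists B : left_index alpha -> right_index beta -> R[i],
      [/\ unitary_matrix B, boundary_relation1 U B & boundary_relation2 U B]) /\
  (forall B : left_index alpha -> right_index beta -> R[i],
    unitary_matrix B ->
    exists U : R -> (R -> R[i]) -> (R -> R[i]),
      [/\ strongly_continuous_unitary_group (itv_union alpha beta) U,
          integrability_property (itv_union alpha beta) U,
          boundary_relation1 U B & boundary_relation2 U B]).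
Proof.
have H := itv_union_layered alpha_lt_beta disj.
have O1 := ly_open H.
split.
  move=> U UG UI; have Um := integrability_moves O1 UG UI.
  have [e0 e0_gt0 e0L] := short_width minlength_gt0.
  pose B := boundary_coef H UG Um e0_gt0 e0L.
  have cells := boundary_coef_cells H UG Um e0_gt0 e0L; rewrite -/B in cells.
  exists B; split; first exact: boundary_coef_unitary.
    move=> e i f; exact: (boundary_relation1_of_cells H UG Um cells).
  move=> e k f; exact: (boundary_relation2_of_cells H UG Um cells).
move=> B BU; have [U [UG UI Um cells]] := group_of_unitary_matrix H minlength_gt0 BU.
exists U; split=> //.
  move=> e i f; exact: (boundary_relation1_of_cells H UG Um cells).
move=> e k f; exact: (boundary_relation2_of_cells H UG Um cells).
Qed.
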